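(* Let $\gamma\ge 1/2$. For any integer $N\ge 2$, $$L_{\gamma,N}^{(\mathrm{rad})}=L_\gamma ,$$ where $L_{\gamma,N}^{(\mathrm{rad})}$ is the optimal constant in the Lieb--Thirring inequality on the star graph $\Gamma_N$ restricted to radial potentials, and $L_\gamma$ is the optimal constant in the Lieb--Thirring inequality on $\mathbb{R}$, as defined in the context.
   Context: For an integer $N\ge 1$, the star graph $\Gamma_N$ consists of $N$ half-lines (edges) $[0,\infty)$ with their endpoints $0$ identified (the vertex), equipped with Lebesgue measure $dx$ on each edge. A function $\psi$ on $\Gamma_N$ is given by its restrictions $\psi_1,\dots,\psi_N$ to the edges, and $\int_{\Gamma_N} f\,dx=\sum_{j=1}^N\int_0^\infty f_j\,dt$. The Sobolev space $H^1(\Gamma_N)$ consists of the functions $\psi$ on $\Gamma_N$ with $\psi_j\in H^1(0,\infty)$ for all $j$ and $\psi_1(0)=\dots=\psi_N(0)$. The graph $\Gamma_2$ is identified with $\mathbb{R}$. For a real-valued function $V$, write $V_\pm=\max(\pm V,0)$. A potential $V:\Gamma_N\to\mathbb{R}$ is called admissible if $V_-\in L_p(\Gamma_N)$ for some $1\le p<\infty$ and $V_+\in L_1^{\mathrm{loc}}(\Gamma_N)$ (integrable on compact subsets of $\Gamma_N$, including neighbourhoods of the vertex). For admissible $V$, the Schrödinger operator $H=-\frac{d^2}{dx^2}+V$ in $L_2(\Gamma_N)$ is the self-adjoint operator associated with the closed, lower semi-bounded quadratic form $$h[\psi]=\int_{\Gamma_N}\left(|\psi'|^2+V|\psi|^2\right)dx,\qquad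 \psi\in H^1(\Gamma_N)\cap L_2(\Gamma_N,V_+\,dx)$$ (this corresponds to Kirchhoff conditions $\sum_{j=1}^N\psi_j'(0+)=0$ at the vertex). Its negative spectrum consists of discrete eigenvalues of finite multiplicity, and $\operatorname{Tr} H_-^\gamma$ denotes the sum of the $\gamma$-th powers of the absolute values of the negative eigenvalues of $H$, counted with multiplicity. A function $V$ on $\Gamma_N$ is called radial if $V(x)$ depends only on the distance of $x$ from the vertex of $\Gamma_N$, i.e. $V_1=\dots=V_N$. For $\gamma\ge 1/2$, $L_{\gamma,N}^{(\mathrm{rad})}$ denotes the smallest constant such that $$\operatorname{Tr} H_-^\gamma\le L_{\gamma,N}^{(\mathrm{rad})}\int_{\Gamma_N}V_-^{\gamma+1/2}\,dx$$ for all admissible radial $V$ on $\Gamma_N$. The constant $L_\gamma$ is the smallest constant such that $\operatorname{Tr}\left(-\frac{d^2}{dx^2}+V\right)_-^\gamma\le L_\gamma\int_{\mathbb{R}}V_-^{\gamma+1/2}\,dx$ for all admissible (not necessarily symmetric) $V$ on $\mathbb{R}=\Gamma_2$, with the operator acting in $L_2(\mathbb{R})$ (it is known that $L_\gamma<\infty$). *)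

(* Defs.v *)
From HB Require Import structures.
From mathcomp Require Export all_boot all_order all_algebra.
From mathcomp Require Export complex.
From mathcomp Require Export all_classical all_reals all_analysis.
Export numFieldNormedType.Exports.

Set Implicit Arguments.
Unset Strict Implicit.
Unset Printing Implicit Defensive.

Import Order.TTheory GRing.Theory Num.Theory.

Local Open Scope classical_set_scope.
Local Open Scope complex_scope.
Local Open Scope ring_scope.

Definition edge (R : realType) : set R := `[0, +oo[%classic.
Arguments edge : clear implicits.

(* A T-valued function on the star graph with N edges, given by its edge
   restrictions.  Only the values at arguments t >= 0 are ever used. *)
Definition starfun (N : nat) (R : realType) (T : Type) := 'I_N -> R -> T.

Definition sqabs (R : realType) (z : R[i]) : R :=
  complex.Re z ^+ 2 + complex.Im z ^+ 2.

Definition star_integral (R : realType) (N : nat) (f : starfun N R (\bar R)) :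
    \bar R :=
  (\sum_(j < N) \int[lebesgue_measure]_(t in edge R) f j t)%E.

Definition cmeasurable (R : realType) (D : set R) (f : R -> R[i]) : Prop :=
  measurable_fun D (fun t => complex.Re (f t)) /\
  measurable_fun D (fun t => complex.Im (f t)).

Definition cintegral (R : realType) (D : set R) (f : R -> R[i]) : R[i] :=
  (\int[lebesgue_measure]_(t in D) complex.Re (f t)) +i*
  (\int[lebesgue_measure]_(t in D) complex.Im (f t)).

Definition star_cintegral (R : realType) (N : nat) (f : starfun N R R[i]) :
    R[i] :=
  \sum_(j < N) cintegral (edge R) (f j).

Definition edge_L2 (R : realType) (u : R -> R[i]) : Prop :=
  cmeasurable (edge R) u /\
  (\int[lebesgue_measure]_(t in edge R) (sqabs (u t))%:E < +oo)%E.

Definition star_L2 (R : realType) (N : nat) (f : starfun N R R[i]) : Prop :=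
  forall j, edge_L2 (f j).

Definition star_ae_eq (R : realType) (N : nat) (f g : starfun N R R[i]) :
    Prop :=
  forall j, {ae lebesgue_measure, forall t, edge R t -> f j t = g j t}.

(* g is a square-integrable derivative of the absolutely continuous function
   u on [0, +oo). *)
Definition L2_derivative (R : realType) (u g : R -> R[i]) : Prop :=
  edge_L2 g /\ forall x, 0 <= x -> u x = u 0 + cintegral `[0, x] g.

(* Elements of H^1(0, +oo) are represented by their continuous version, so
   that u 0 is the boundary value. *)
Definition edge_H1 (R : realType) (u : R -> R[i]) : Prop :=
  edge_L2 u /\ exists g, L2_derivative u g.

(* The weak derivative of an H^1 function, unique up to null sets. *)
Definition deriv_H1 (R : realType) (u : R -> R[i]) : R -> R[i] :=
  xget (fun=> 0) [set g | L2_derivative u g].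

Definition star_H1 (R : realType) (N : nat) (psi : starfun N R R[i]) : Prop :=
  (forall j, edge_H1 (psi j)) /\ (forall j k, psi j 0 = psi k 0).

Definition admissible (R : realType) (N : nat) (V : starfun N R R) : Prop :=
  [/\ forall j, measurable_fun (edge R) (V j),
      exists2 p : R, 1 <= p &
        (star_integral (fun j t => (((V j)^\- t) `^ p)%:E) < +oo)%E
    & forall (j : 'I_N) (a : R), 0 < a ->
        lebesgue_measure.-integrable `[0, a] (EFin \o (V j)^\+)].

Definition radial (R : realType) (N : nat) (V : starfun N R R) : Prop :=
  forall j k t, 0 <= t -> V j t = V k t.

Definition form_domain (R : realType) (N : nat) (V : starfun N R R)
    (psi : starfun N R R[i]) : Prop :=
  star_H1 psi /\
  (star_integral (fun j t => ((V j)^\+ t * sqabs (psi j t))%:E) < +oo)%E.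

(* The sesquilinear form whose diagonal is h[psi], linear in psi. *)
Definition schrodinger_form (R : realType) (N : nat) (V : starfun N R R)
    (psi phi : starfun N R R[i]) : R[i] :=
  star_cintegral (fun j t =>
    deriv_H1 (psi j) t * (deriv_H1 (phi j) t)^* +
    (V j t)%:C * psi j t * (phi j t)^*).

Definition inner (R : realType) (N : nat) (f g : starfun N R R[i]) : R[i] :=
  star_cintegral (fun j t => f j t * (g j t)^*).

(* H psi = f, for the self-adjoint operator H associated with the form by the
   first representation theorem. *)
Definition schrodinger (R : realType) (N : nat) (V : starfun N R R)
    (psi f : starfun N R R[i]) : Prop :=
  [/\ form_domain V psi, star_L2 f &
      forall phi, form_domain V phi ->
        schrodinger_form V psi phi = inner f phi].

Definition eigenspace_of (R : realType) (N : nat) (V : starfun N R R)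
    (lambda : R) : set (starfun N R R[i]) :=
  [set psi | schrodinger V psi (fun j t => lambda%:C * psi j t)].

Definition lin_indep (R : realType) (N n : nat)
    (e : 'I_n -> starfun N R R[i]) : Prop :=
  forall c : 'I_n -> R[i],
    star_ae_eq (fun j t => \sum_(k < n) c k * e k j t) (fun _ _ => 0) ->
    forall k, c k = 0.

(* Dimension of the eigenspace; it is 0 when lambda is not an eigenvalue. *)
Definition multiplicity (R : realType) (N : nat) (V : starfun N R R)
    (lambda : R) : \bar R :=
  ereal_sup [set n%:R%:E | n in [set n : nat |
    exists e : 'I_n -> starfun N R R[i],
      (forall k, eigenspace_of V lambda (e k)) /\ lin_indep e]].

(* Tr H_-^gamma *)
Definition trace_neg (R : realType) (N : nat) (gamma : R)
    (V : starfun N R R) : \bar R :=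
  (\esum_(lambda in [set lambda : R | (lambda < 0)%R])
     (multiplicity V lambda * (`|lambda| `^ gamma)%:E))%E.

(* The smallest constant in the Lieb--Thirring inequality over the admissible
   potentials in the class K, equal to +oo if no finite constant exists. *)
Definition LT_constant (R : realType) (N : nat) (gamma : R)
    (K : set (starfun N R R)) : \bar R :=
  ereal_inf [set L%:E | L in [set L : R |
    forall V : starfun N R R, admissible V -> K V ->
      (trace_neg gamma V <=
       L%:E * star_integral (fun j t =>
                (((V j)^\- t) `^ (gamma + 2^-1))%:E))%E]].

Definition LT_rad (R : realType) (gamma : R) (N : nat) : \bar R :=
  LT_constant gamma [set V : starfun N R R | radial V].

(* The real line is the star graph with two edges. *)
Definition LT_line (R : realType) (gamma : R) : \bar R :=
  LT_constant gamma [set: starfun 2 R R].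

(* Main.v *)
From HB Require Import structures.
Require Import Defs.
From mathcomp Require Import ring lra measurable_realfun.

(** For a radial potential with profile [v] the operator on the star splits
    into half-line operators with potential [v].  The sum over the edges of an
    eigenfunction is an eigenfunction with Neumann condition at [0], the
    difference of two edge components is one with Dirichlet condition, and both
    constructions can be reversed.  Writing [TN] and [TD] for the traces with
    Neumann and Dirichlet condition, the trace on the star with [N] edges is
    therefore [TN + (N - 1) * TD] ([radial_trace]).  Imposing the Dirichlet
    condition shrinks the form domain, so [TD <= TN] ([dirichlet_le_neumann]).
    Let [I] be the integral of the power [gamma + 1/2] of [v^\-] over one edge.

    A bound on the line gives the same bound for radial potentials: the even
    extension of [v] to the line yields [TN + TD <= 2 * L * I], hence
    [TD <= L * I], and adding the remaining [N - 2] copies of [TD] gives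
    [TN + (N - 1) * TD <= N * L * I].

    Conversely, a bound for radial potentials gives
    [N * TD <= TN + (N - 1) * TD <= N * L * I], that is, a bound for Dirichlet
    conditions on the half-line.  A potential on the line is moved into a
    half-line with its vertex at distance [m] from the endpoint, forgetting the
    part that does not fit.  Eigenfunctions of the line, multiplied by a linear
    cutoff that vanishes at the endpoint, become trial functions there, and
    their form matrices converge as [m] grows.  Hence a finite system of
    eigenvalues [nu i] of the line satisfies
    [\sum_i `|nu i + e| `^ gamma <= TD] for every small [e > 0] and suitable
    [m] ([eigtrace_glue_ge]), and [e] tends to [0].

    In place of the spectral theorem there are two facts on a real symmetric
    form [h] relative to a semidefinite form [b].  First, sums over eigenvalues
    are controlled by finite [b]-orthonormal systems of weak eigenvectors
    ([eigtrace_ge], [esum_le_eigsys]).  Second, [variational_principle]: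
    trial vectors with form values below [mu i < 0] produce as many orthonormal
    eigenvectors with eigenvalues at most [mu i].  These come from minimising
    the Rayleigh quotient on the complement of the eigenvectors already found.
    A minimiser exists because the form domain is complete ([hl_complete]) and
    because, up to finitely many point evaluations, [h] is coercive
    ([sqM_compact]); this replaces the relative compactness of [v^\-].
    Complex eigenfunctions are handled through their real and imaginary parts,
    which does not change dimensions ([multiplicity_ge],
    [multiplicity_le_eigdim]). *)

Set Implicit Arguments.
Unset Strict Implicit.
Unset Printing Implicit Defensive.

Import Order.TTheory GRing.Theory Num.Theory.

Local Open Scope classical_set_scope.
Local Open Scope ring_scope.

(** * Linear algebra of symmetric forms *)

(** Fewer equations than unknowns: the coefficient matrix has a nonzero kernel. *)
Lemma lincomb_ker (F : fieldType) (J : finType) n (A : 'I_n -> J -> F) :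
  (#|J| < n)%N ->
  exists2 d : 'I_n -> F, (exists k, d k != 0) &
    forall j, \sum_k d k * A k j = 0.
Proof.
move=> Jn; pose M := \matrix_(i < n, j < #|J|) A i (enum_val j).
have : kermx M != 0.
  rewrite kermx_eq0; apply/negP => /eqP rM.
  by have := rank_leq_col M; rewrite rM leqNgt Jn.
rewrite -nz_row_eq0 => nz.
have kM : nz_row (kermx M) *m M = 0.
  by apply/eqP; rewrite -sub_kermx nz_row_sub.
exists (fun k => nz_row (kermx M) ord0 k).
  by have /rV0Pn[k hk] := nz; exists k.
move=> j; have /rowP/(_ (enum_rank j)) := kM; rewrite !mxE => {2}<-.
by apply: eq_bigr => k _; rewrite mxE enum_rankK.
Qed.

Lemma ler_sqr_norm {R : realDomainType} (x y : R) : `|x| <= `|y| -> x ^+ 2 <= y ^+ 2.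
Proof. by rewrite -ler_sqr ?nnegrE// !real_normK ?num_real. Qed.

Section symmetric_forms.
Context {R : realType} {E : lmodType R}.
Implicit Types (f g : E -> E -> R) (u v w : E).

Definition symform f : Prop :=
  (forall u v, f u v = f v u) /\
  (forall a u v w, f (a *: u + v) w = a * f u w + f v w).

Section theory.
Variables (f : E -> E -> R) (sf : symform f).

Lemma symformC u v : f u v = f v u. Proof. by case: sf. Qed.

Lemma symform0l v : f 0 v = 0.
Proof.
case: sf => _ /(_ 1 0 0 v); rewrite scaler0 addr0 mul1r => /eqP.
by rewrite -subr_eq0 opprD addrA subrr sub0r oppr_eq0 => /eqP.
Qed.

Lemma symformDl u v w : f (u + v) w = f u w + f v w.
Proof. by case: sf => _ /(_ 1 u v w); rewrite scale1r mul1r. Qed.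

Lemma symformZl a u w : f (a *: u) w = a * f u w.
Proof. by case: (sf) => _ /(_ a u 0 w); rewrite addr0 symform0l addr0. Qed.

Lemma symformNl u w : f (- u) w = - f u w.
Proof. by rewrite -scaleN1r symformZl mulN1r. Qed.

Lemma symformBl u v w : f (u - v) w = f u w - f v w.
Proof. by rewrite symformDl symformNl. Qed.

Lemma symformDr u v w : f w (u + v) = f w u + f w v.
Proof. by rewrite symformC symformDl !(symformC w). Qed.

Lemma symformZr a u w : f w (a *: u) = a * f w u.
Proof. by rewrite symformC symformZl (symformC w). Qed.

Lemma symformBr u v w : f w (u - v) = f w u - f w v.
Proof. by rewrite symformC symformBl !(symformC w). Qed.

Lemma symform_suml (I : finType) (c : I -> R) (x : I -> E) w :
  f (\sum_i c i *: x i) w = \sum_i c i * f (x i) w.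
Proof.
elim/big_ind2: _ => [|? ? ? ? <- <-|i _]; first exact: symform0l.
- exact: symformDl.
- exact: symformZl.
Qed.

Lemma symform_sumr (I : finType) (c : I -> R) (x : I -> E) w :
  f w (\sum_i c i *: x i) = \sum_i c i * f w (x i).
Proof.
by rewrite symformC symform_suml; apply: eq_bigr => i _; rewrite symformC.
Qed.

Lemma symform_sqZ a u : f (a *: u) (a *: u) = a ^+ 2 * f u u.
Proof. by rewrite symformZl symformZr mulrA. Qed.

Lemma symform_sqN u : f (- u) (- u) = f u u.
Proof. by rewrite -scaleN1r symform_sqZ sqrrN expr1n mul1r. Qed.

Lemma symform_sqD u v : f (u + v) (u + v) = f u u + 2 * f u v + f v v.
Proof. by rewrite !(symformDl, symformDr) (symformC v u); ring. Qed.

Lemma symform_parallelogram u v :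
  f (u + v) (u + v) + f (u - v) (u - v) = 2 * f u u + 2 * f v v.
Proof.
by rewrite !(symformDl, symformBr, symformDr, symformNl) (symformC v u); ring.
Qed.

(** Positivity is only required on the line through [v] in direction [u], so
    that the inequality applies to forms that are semidefinite on a subset. *)
Lemma symform_cauchy_schwarz u v :
  0 <= f u u -> (forall t, 0 <= f (t *: u + v) (t *: u + v)) ->
  f u v ^+ 2 <= f u u * f v v.
Proof.
move=> u0 H; have {}H t : 0 <= t ^+ 2 * f u u + 2 * t * f u v + f v v.
  by have := H t; rewrite symform_sqD symform_sqZ symformZl -mulrA.
move: u0; rewrite le_eqVlt => /orP[/eqP u0|u0].
  rewrite -u0 mul0r; have [->|uv0] := eqVneq (f u v) 0; first by rewrite expr0n.
  have := H (- (f v v + 1) / (2 * f u v)); rewrite -u0 mulr0 add0r.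
  suff -> : 2 * (- (f v v + 1) / (2 * f u v)) * f u v + f v v = -1 by lra.
  by field.
have := H (- f u v / f u u).
have -> : (- f u v / f u u) ^+ 2 * f u u + 2 * (- f u v / f u u) * f u v + f v v
  = (f u u * f v v - f u v ^+ 2) / f u u by field; rewrite gt_eqF.
by rewrite pmulr_lge0 ?invr_gt0// subr_ge0.
Qed.

End theory.

Lemma symform_comb f g a : symform f -> symform g ->
  symform (fun u v => f u v + a * g u v).
Proof.
move=> [fC fl] [gC gl]; split=> [u v|k u v w]; first by rewrite fC gC.
by rewrite fl gl; ring.
Qed.

End symmetric_forms.

(** The rate at which approximating sequences converge below; being the
    square of [2^-k], it makes the sequences of norms summable. *)
Definition geo4 {R : realType} (k : nat) : R := 4^-1 ^+ k.

Lemma geo4_gt0 {R : realType} k : 0 < geo4 k :> R.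
Proof. by rewrite exprn_gt0// invr_gt0. Qed.

Lemma geo4_le {R : realType} k m : (k <= m)%N -> geo4 m <= geo4 k :> R.
Proof. by move=> km; apply: ler_wiXn2l => //; lra. Qed.

Lemma geo4_le1 {R : realType} k : geo4 k <= 1 :> R.
Proof. by apply: exprn_ile1 => //; lra. Qed.

Lemma le_geo4_le0 {R : realType} (x C : R) : (forall k, x <= C * geo4 k) -> x <= 0.
Proof.
move=> xk; have gC : (fun k => C * geo4 k : R) @ \oo --> (C * 0).
  apply: cvgM; first exact: cvg_cst.
  by apply: cvg_expr; rewrite ger0_norm; lra.
rewrite -[leRHS](mulr0 C) -(cvg_lim _ gC)//.
by apply: limr_ge; [apply/cvg_ex; exists (C * 0)|apply: nearW].
Qed.

(** Bolzano--Weierstrass, phrased with the squared distance in which the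
    finitely many functionals of [gf_coer] are measured. *)
Lemma bounded_rV_cluster {R : realType} m (x : nat -> 'I_m -> R) (B : R) :
  (forall n i, `|x n i| <= B) ->
  exists p : 'I_m -> R, forall (e : R), 0 < e -> forall k, exists2 n, (k <= n)%N &
    \sum_i (x n i - p i) ^+ 2 <= e.
Proof.
move=> xB.
pose X n : 'rV[R]_m := \row_i x n i.
have cK : compact [set v : 'rV[R]_m | forall i, `[-B, B]%classic (v ord0 i)].
  apply: (@rV_compact R m (fun=> `[-B, B]%classic)).
  by move=> _; exact: segment_compact.
have [] := cK (X @ \oo) _ _.
  exists 0%N => // n _ i /=.
  by rewrite mxE in_itv/= -ler_norml xB.
move=> p [_ clp]; exists (fun i => p ord0 i) => e e0 k.
pose d := Num.min 1 (e / m.+1%:R).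
have d0 : 0 < d by rewrite lt_min ltr01 divr_gt0.
have [] := clp (X @` [set n | (k <= n)%N]) (ball p d) _ _.
- by exists k => // n kn /=; exists n.
- exact: nbhsx_ballx.
move=> _ [[n kn <-] [_ pn]]; exists n => //.
apply: (@le_trans _ _ (\sum_(i < m) (e / m.+1%:R))).
  apply: ler_sum => i _; have := pn ord0 i; rewrite mxE /ball/= => pni.
  have d1 : d <= 1 by rewrite ge_min lexx.
  rewrite -real_normK ?num_real// distrC expr2.
  apply: (@le_trans _ _ (1 * d)); last by rewrite mul1r ge_min lexx orbT.
  by apply: ler_pM => //; last exact: ltW; apply: le_trans d1; exact: ltW.
rewrite sumr_const card_ord -[leLHS]mulr_natr mulrAC ler_pdivrMr//.
by rewrite ler_pM2l// ler_nat.
Qed.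

(** * The min-max principle for a coercive form *)

Section eigen_systems.
Context {R : realType} {E : lmodType R}.
Variables b h : E -> E -> R.

(** A weak eigenvector: the equation of the first representation theorem,
    tested on the form domain. *)
Definition eigvec (lam : R) (u : E) := forall v, h u v = lam * b u v.

Definition orthosys n (f : 'I_n -> E) :=
  forall i j, b (f i) (f j) = (i == j)%:R.

Definition eigsys n (f : 'I_n -> E) (nu : 'I_n -> R) :=
  orthosys f /\ forall i, eigvec (nu i) (f i).

End eigen_systems.

(** What is used of the form [h] of a Schroedinger operator: [b] is the [L2]
    form and [q] the square of the form norm.  The two essential fields are
    [gf_coer], which says that at each negative level [h - mu * b] controls [q]
    after adding finitely many bounded functionals (so the spectrum below [mu]
    is finite), and [gf_complete], which produces limits of rapidly converging
    sequences.  The form [b] is only semidefinite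
    because form-domain elements will carry their derivative as data. *)
Record good_form {R : realType} {E : lmodType R} (b h q : E -> E -> R) : Prop :=
  GoodForm {
  gf_b : symform b;
  gf_h : symform h;
  gf_b0 : forall u, 0 <= b u u;
  gf_bq : forall u, b u u <= q u u;
  gf_hq : exists C, forall u, h u u <= C * q u u;
  gf_bnd : exists c K : R, 0 < c /\ forall u, c * q u u <= h u u + K * b u u;
  gf_coer : forall mu : R, mu < 0 -> exists c C : R, exists m,
    exists l : 'I_m -> E -> R,
    [/\ 0 < c, forall i u v, l i (u - v) = l i u - l i v,
        forall i u, l i u ^+ 2 <= C * q u u &
        forall u, c * q u u <= h u u - mu * b u u + \sum_i l i u ^+ 2];
  gf_complete : forall u : nat -> E,
    (forall k m, (k <= m)%N -> q (u m - u k) (u m - u k) <= geo4 k) ->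
    exists v, forall k, q (u k - v) (u k - v) <= geo4 k }.

Section variational.
Context {R : realType} {E : lmodType R}.
Variables b h q : E -> E -> R.
Hypothesis gf : good_form b h q.

Let sb := gf_b gf.
Let sh := gf_h gf.

Let q_ge0 u : 0 <= q u u.
Proof. exact: le_trans (gf_b0 gf u) (gf_bq gf u). Qed.

(** A [b]-null vector cannot have negative energy, since [h] is bounded below
    relative to [b]. *)
Lemma neg_b_gt0 u : h u u < 0 -> 0 < b u u.
Proof.
move=> hu; have [c [K [c0 /(_ u) H]]] := gf_bnd gf.
rewrite lt_neqAle (gf_b0 gf) andbT eq_sym; apply: contraTneq hu => bu.
rewrite -leNgt; apply: le_trans (_ : c * q u u <= _); first by rewrite mulr_ge0// ltW.
by rewrite bu mulr0 addr0 in H.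
Qed.

Section constrained.
Variables (n : nat) (f : 'I_n -> E) (nu : 'I_n -> R).
Hypothesis fnu : eigsys b h f nu.

Let perp u := forall i, b (f i) u = 0.

Let perpB u v : perp u -> perp v -> perp (u - v).
Proof. by move=> pu pv i; rewrite (symformBr sb) pu pv subr0. Qed.

Let perpD u v : perp u -> perp v -> perp (u + v).
Proof. by move=> pu pv i; rewrite (symformDr sb) pu pv addr0. Qed.

Let perpZ a u : perp u -> perp (a *: u).
Proof. by move=> pu i; rewrite (symformZr sb) pu mulr0. Qed.

Lemma b_normalize u : 0 < b u u ->
  b ((Num.sqrt (b u u))^-1 *: u) ((Num.sqrt (b u u))^-1 *: u) = 1.
Proof.
move=> u0; rewrite (symform_sqZ sb) exprVn sqr_sqrtr ?ltW// mulVf//.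
by rewrite gt_eqF.
Qed.

(** At a minimum of [h - lam * b] on the complement of the [f i] this form is
    nonnegative and vanishes at [u], so by Cauchy--Schwarz [u] is in its
    kernel; against the [f i] it vanishes because they are eigenvectors. *)
Lemma perp_minimum_eigvec (lam : R) u :
  perp u -> 0 < b u u -> h u u <= lam * b u u ->
  (forall v, perp v -> lam * b v v <= h v v) -> eigvec b h lam u.
Proof.
move=> pu u0 hu lamP v.
pose hl x y := h x y + (- lam) * b x y.
have shl : symform hl by exact: symform_comb.
pose v' := v - \sum_i b (f i) v *: f i.
have pv' : perp v'.
  move=> i; rewrite (symformBr sb) (symform_sumr sb).
  rewrite (bigD1 i)//= big1 ?addr0; first by rewrite fnu.1 eqxx mulr1 subrr.
  by move=> j ji; rewrite fnu.1 eq_sym (negbTE ji) mulr0.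
have uv' : hl u v' = 0.
  apply/eqP; rewrite -sqrf_eq0 eq_le sqr_ge0 andbT.
  have hlu : hl u u = 0.
    by apply/eqP; rewrite /hl eq_le mulNr subr_le0 hu/= subr_ge0 lamP.
  rewrite -[leRHS](mul0r (hl v' v')) -hlu.
  apply: (symform_cauchy_schwarz shl); first by rewrite hlu.
  by move=> t; rewrite /hl mulNr subr_ge0; apply/lamP/perpD => //; exact: perpZ.
have uf i : hl u (f i) = 0.
  by rewrite /hl (symformC sh) (symformC sb) fnu.2 pu !mulr0 addr0.
apply/eqP; rewrite -subr_eq0 -mulNr -/(hl u v).
have -> : v = v' + \sum_i b (f i) v *: f i by rewrite subrK.
rewrite (symformDr shl) uv' (symform_sumr shl) add0r big1// => i _.
by rewrite uf mulr0.
Qed.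

(** The minimum of the Rayleigh quotient is attained.  Along a minimising
    sequence the finitely many functionals of [gf_coer] are bounded, so a
    subsequence makes them converge.  By the parallelogram law
    [h - lam * b] of differences is then small, and coercivity turns this into
    a Cauchy property in [q]; the limit given by completeness is a minimiser. *)
Lemma exists_minimum (mu : R) w : mu < 0 -> perp w -> 0 < b w w ->
  h w w <= mu * b w w ->
  exists (lam : R) u, [/\ lam <= mu, perp u, 0 < b u u, h u u <= lam * b u u &
    forall v, perp v -> lam * b v v <= h v v].
Proof.
move=> mu0 pw w0 hw.
have [c1 [K [c10 bndP]]] := gf_bnd gf.
pose S := [set h u u | u in [set u | perp u /\ b u u = 1]].
pose w1 := (Num.sqrt (b w w))^-1 *: w.
have Sw1 : S (h w1 w1).
  by exists w1 => //; split; [exact: perpZ|exact: b_normalize].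
have infS : has_inf S.
  split; first by exists (h w1 w1).
  exists (- K) => _ [u [_ bu] <-]; have := bndP u; rewrite bu mulr1 => H.
  rewrite -subr_ge0 opprK; apply: le_trans H; by rewrite mulr_ge0// ltW.
pose lam := inf S.
have lamP v : perp v -> lam * b v v <= h v v.
  move=> pv; have := gf_b0 gf v; rewrite le_eqVlt => /orP[/eqP bv|v0].
    rewrite -bv mulr0; have := bndP v; rewrite -bv mulr0 addr0; apply: le_trans.
    by rewrite mulr_ge0// ltW.
  pose v1 := (Num.sqrt (b v v))^-1 *: v.
  have : lam <= h v1 v1.
    apply: ge_inf; first by case: infS.
    by exists v1 => //; split; [exact: perpZ|exact: b_normalize].
  rewrite (symform_sqZ sh) exprVn sqr_sqrtr ?(ltW v0)//.
  by rewrite [leRHS]mulrC ler_pdivlMr.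
have lam_mu : lam <= mu.
  apply: (@le_trans _ _ (h w1 w1)); first by apply: ge_inf => //; case: infS.
  rewrite (symform_sqZ sh) exprVn sqr_sqrtr ?(ltW w0)//.
  by rewrite mulrC ler_pdivrMr.
have [c [C [m [l [c0 lB lq coer]]]]] := gf_coer gf (le_lt_trans lam_mu mu0).
have [Ch hC] := gf_hq gf.
(* with [4 e] from the parallelogram law and [4 e] from the functionals, the
   factor [1 / 8] yields exactly [c * geo4 k] *)
pose e k : R := c / 8 * geo4 k.
have e0 k : 0 < e k by rewrite mulr_gt0 ?geo4_gt0// divr_gt0.
have /choice[u uP] : forall k, exists u, [/\ perp u, b u u = 1 & h u u <= lam + e k].
  move=> k; have [_ [u [pu bu] <-] hu] := inf_adherent (e0 k) infS.
  by exists u; split => //; exact: ltW.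
have lbnd k i : `|l i (u k)| <= Num.sqrt (`|C| * ((lam + c + K) / c1)).
  have [pu bu hu] := uP k.
  rewrite -sqrtr_sqr ler_wsqrtr//; apply: le_trans (lq _ _) _.
  apply: (@le_trans _ _ (`|C| * q (u k) (u k))).
    by apply: ler_wpM2r => //; exact: ler_norm.
  apply: ler_wpM2l => //; rewrite ler_pdivlMr// mulrC.
  apply: le_trans (bndP _) _; rewrite bu mulr1 lerD2r (le_trans hu)// lerD2l.
  rewrite /e; have := @geo4_le1 R k; have := @geo4_gt0 R k; nra.
have [p pP] := bounded_rV_cluster lbnd.
have /choice[s sP] : forall k, exists s, (k <= s)%N /\
    \sum_i (l i (u s) - p i) ^+ 2 <= e k.
  by move=> k; have [s ks sp] := pP _ (e0 k) k; exists s.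
pose v k := u (s k).
have vP k : [/\ perp (v k), b (v k) (v k) = 1 & h (v k) (v k) <= lam + e k].
  have [pu bu hu] := uP (s k); split => //; apply: le_trans hu _.
  by rewrite lerD2l /e ler_pM2l ?divr_gt0// geo4_le//; case: (sP k).
pose hl x y := h x y + (- lam) * b x y.
have shl : symform hl by exact: symform_comb.
have hl0 x : perp x -> 0 <= hl x x by move=> px; rewrite /hl mulNr subr_ge0 lamP.
have hlv k : hl (v k) (v k) <= e k.
  by have [_ bv hv] := vP k; rewrite /hl bv mulNr mulr1 lerBlDl.
have /(gf_complete gf)[x xP] : forall k m, (k <= m)%N ->
    q (v m - v k) (v m - v k) <= geo4 k.
  move=> k j kj; rewrite -(ler_pM2l c0); apply: le_trans (coer _) _.
  have ej : e j <= e k by rewrite /e ler_pM2l ?divr_gt0// geo4_le.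
  have H1 : hl (v j - v k) (v j - v k) <= 4 * e k.
    have := symform_parallelogram shl (v j) (v k).
    have : 0 <= hl (v j + v k) (v j + v k).
      by apply/hl0/perpD; [case: (vP j)|case: (vP k)].
    by have := hlv j; have := hlv k; lra.
  have H2 : \sum_i l i (v j - v k) ^+ 2 <= 4 * e k.
    apply: (@le_trans _ _ (2 * \sum_i (l i (v j) - p i) ^+ 2 +
                           2 * \sum_i (l i (v k) - p i) ^+ 2)).
      rewrite !mulr_sumr -big_split/=; apply: ler_sum => i _; rewrite lB.
      set X := l i (v j); set Y := l i (v k); set Z := p i.
      rewrite -subr_ge0.
      have -> : 2 * (X - Z) ^+ 2 + 2 * (Y - Z) ^+ 2 - (X - Y) ^+ 2 =
        (X + Y - 2 * Z) ^+ 2 by ring.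
      exact: sqr_ge0.
    have [_ h1] := sP j; have [_ h2] := sP k; rewrite -/(v j) -/(v k) in h1 h2.
    by lra.
  rewrite /hl mulNr in H1; have := H1; have := H2; rewrite /e => h1 h2.
  by apply: le_trans (lerD h2 h1) _; lra.
have bx k : b (v k - x) (v k - x) <= geo4 k by apply: le_trans (gf_bq gf _) (xP _).
have px : perp x.
  move=> i; apply/eqP; rewrite -sqrf_eq0 eq_le sqr_ge0 andbT.
  apply: (@le_geo4_le0 _ _ 1) => k; rewrite mul1r.
  have -> : b (f i) x ^+ 2 = b (f i) (v k - x) ^+ 2.
    by rewrite (symformBr sb); case: (vP k) => -> _ _; rewrite sub0r sqrrN.
  apply: le_trans (symform_cauchy_schwarz sb (gf_b0 gf _) _) _.
    by move=> t; exact: (gf_b0 gf).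
  by rewrite fnu.1 eqxx mul1r.
(* the limit is not a null vector: [v 2] has norm one and is close to [x] *)
have x0 : 0 < b x x.
  have := symform_parallelogram sb (v 2%N - x) x; rewrite subrK.
  have [_ -> _] := vP 2%N; have := bx 2%N; rewrite /geo4.
  have := gf_b0 gf (v 2%N - x - x); lra.
have hx : h x x <= lam * b x x.
  rewrite -subr_le0 -mulNr -/(hl x x).
  apply: (@le_geo4_le0 _ _ (c / 4 + 2 * `|lam| + 2 * `|Ch|)) => k.
  have := symform_parallelogram shl (x - v k) (v k); rewrite subrK => H.
  have H0 : 0 <= hl (x - v k - v k) (x - v k - v k).
    by apply: (hl0); apply: perpB; [apply: perpB => //|]; case: (vP k).
  have H1 : hl (x - v k) (x - v k) <= (`|Ch| + `|lam|) * geo4 k.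
    rewrite -opprB (symform_sqN shl) /hl mulrDl; apply: lerD.
      apply: le_trans (hC _) _.
      apply: (@le_trans _ _ (`|Ch| * q (v k - x) (v k - x))).
        by apply: ler_wpM2r => //; exact: ler_norm.
      exact: ler_wpM2l.
    apply: (@le_trans _ _ (`|lam| * b (v k - x) (v k - x))).
      by apply: ler_wpM2r; [exact: (gf_b0 gf)|rewrite -normrN; exact: ler_norm].
    exact: ler_wpM2l.
  have := hlv k; rewrite /e; lra.
by exists lam, x.
Qed.

Lemma exists_eigvec (mu : R) w : mu < 0 -> perp w -> 0 < b w w ->
  h w w <= mu * b w w ->
  exists (lam : R) u, [/\ lam <= mu, perp u, b u u = 1 & eigvec b h lam u].
Proof.
move=> mu0 pw w0 hw.
have [lam [u [lamu pu u0 hu lamP]]] := exists_minimum mu0 pw w0 hw.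
exists lam, ((Num.sqrt (b u u))^-1 *: u); split => //.
- exact: perpZ.
- exact: b_normalize.
- move=> v; rewrite (symformZl sh) (symformZl sb).
  by rewrite (perp_minimum_eigvec pu u0 hu lamP); ring.
Qed.

End constrained.

(** Induction on the number of trial vectors.  The vector with the largest
    [mu] is set aside and the others yield [n] eigenvectors; among the
    combinations of all [n.+1] trial vectors one is orthogonal to these, and its
    Rayleigh quotient is at most the largest [mu], so that [exists_eigvec]
    applies to it. *)
Lemma variational_principle n (w : 'I_n -> E) (mu : 'I_n -> R) :
  (forall i, mu i < 0) ->
  (forall c : 'I_n -> R, b (\sum_i c i *: w i) (\sum_i c i *: w i) <=
    \sum_i c i ^+ 2) ->
  (forall c : 'I_n -> R, h (\sum_i c i *: w i) (\sum_i c i *: w i) <=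
    \sum_i mu i * c i ^+ 2) ->
  exists (f : 'I_n -> E) nu, eigsys b h f nu /\ forall i, nu i <= mu i.
Proof.
elim: n w mu => [|n IH] w mu mu0 bw hw.
  by exists w, mu; split; [split|]; case.
have [k0 _ k0P] := @arg_maxP _ _ _ ord0 xpredT mu isT.
have lift0 (V : nmodType) (G : 'I_n.+1 -> V) : \sum_i G i = G k0 + \sum_j G (lift k0 j).
  by rewrite (bigD1_ord k0).
(* coefficients on the remaining trial vectors, extended by zero at [k0] *)
pose ext (c : 'I_n -> R) i := if unlift k0 i is Some j then c j else 0.
have extk c : ext c k0 = 0 by rewrite /ext unlift_none.
have extl c j : ext c (lift k0 j) = c j by rewrite /ext liftK.
have exts c : \sum_i ext c i *: w i = \sum_j c j *: w (lift k0 j).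
  by rewrite lift0 extk scale0r add0r; apply: eq_bigr => j _; rewrite extl.
have [f [nu [fnu numu]]] : exists (f : 'I_n -> E) nu, eigsys b h f nu /\
    forall i, nu i <= mu (lift k0 i).
  apply: (IH (fun j => w (lift k0 j))) => [j|c|c]; first exact: mu0.
  - have := bw (ext c); rewrite exts; move/le_trans; apply.
    rewrite lift0 extk expr0n add0r; apply: ler_sum => j _; by rewrite extl.
  - have := hw (ext c); rewrite exts; move/le_trans; apply.
    rewrite lift0 extk expr0n mulr0 add0r; apply: ler_sum => j _; by rewrite extl.
have [c c0 cP] : exists2 c : 'I_n.+1 -> R, (exists k, c k != 0) &
    forall j : 'I_n, \sum_k c k * b (f j) (w k) = 0.
  by apply: (lincomb_ker (fun k (j : 'I_n) => b (f j) (w k))); rewrite card_ord.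
pose W := \sum_k c k *: w k.
have pW i : b (f i) W = 0 by rewrite (symform_sumr sb).
have sc0 : 0 < \sum_i c i ^+ 2.
  case: c0 => k ck; rewrite (bigD1 k)//=; apply: ltr_pwDl.
    by rewrite lt_neqAle eq_sym sqrf_eq0 ck sqr_ge0.
  by apply: sumr_ge0 => i _; exact: sqr_ge0.
have hW : h W W <= mu k0 * \sum_i c i ^+ 2.
  apply: le_trans (hw c) _; rewrite mulr_sumr; apply: ler_sum => i _.
  by apply: ler_wpM2r; [exact: sqr_ge0|exact: k0P].
have bW0 : 0 < b W W.
  apply: neg_b_gt0; apply: le_lt_trans hW _.
  by rewrite nmulr_rlt0// mu0.
have [|lam [u [lamu pu bu eu]]] := exists_eigvec fnu (mu0 k0) pW bW0.
  by apply: le_trans hW _; rewrite ler_nM2l ?mu0// bw.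
pose f' i := if unlift k0 i is Some j then f j else u.
pose nu' i := if unlift k0 i is Some j then nu j else lam.
exists f', nu'; split; first split => [i j|i].
- rewrite /f'; case: (unliftP k0 i) => [i'|] ->; case: (unliftP k0 j) => [j'|] ->.
  + by rewrite fnu.1 (inj_eq lift_inj).
  + by rewrite pu eq_sym (negbTE (neq_lift _ _)).
  + by rewrite (symformC sb) pu (negbTE (neq_lift _ _)).
  + by rewrite bu eqxx.
- rewrite /f' /nu'; case: (unliftP k0 i) => [i' _|_] //; exact: fnu.2.
- by move=> i; rewrite /nu'; case: (unliftP k0 i) => [i'|] -> //; exact: numu.
Qed.

End variational.

(** * Sums of powers of negative eigenvalues *)

Lemma eq_pinfty_mulrn_le {R : realType} (a : R) (x : \bar R) : 0 < a ->
  (forall n : nat, ((n%:R * a)%:E <= x)%E) -> x = +oo%E.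
Proof.
case: x => [r||] a0 nx //; last by have := nx 0%N; rewrite leeNy_eq.
have := nx (Num.bound (`|r| / a)); rewrite lee_fin => H.
have /archi_boundP : 0 <= `|r| / a by rewrite divr_ge0// ltW.
by rewrite ltr_pdivrMr// => /lt_le_trans/(_ H); rewrite ltNge ler_norm.
Qed.

Section traces.
Context {R : realType} {E : lmodType R}.
Variables b h : E -> E -> R.
Hypotheses (sb : symform b) (sh : symform h) (b0 : forall u, 0 <= b u u).

Definition eigdim_set (lam : R) : set nat :=
  [set n | exists f : 'I_n -> E, orthosys b f /\ forall i, eigvec b h lam (f i)].

(** The dimension of the eigenspace modulo [b]-null vectors. *)
Definition eigdim (lam : R) : \bar R :=
  ereal_sup [set n%:R%:E | n in eigdim_set lam].

Definition eigtrace (gamma : R) : \bar R :=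
  (\esum_(lambda in [set lambda : R | (lambda < 0)%R])
     (eigdim lambda * (`|lambda| `^ gamma)%:E))%E.

Lemma eigdim_ge n lam : eigdim_set lam n -> (n%:R%:E <= eigdim lam)%E.
Proof. by move=> Sn; apply: ereal_sup_ubound; exists n. Qed.

Lemma eigdim_ge0 lam : (0 <= eigdim lam)%E.
Proof. by apply: (@eigdim_ge 0); exists (fun=> 0); split=> [[]|[]]. Qed.

Lemma eigvecB lam u v : eigvec b h lam u -> eigvec b h lam v -> eigvec b h lam (u - v).
Proof.
by move=> eu ev w; rewrite (symformBl sh) (symformBl sb) eu ev mulrBr.
Qed.

Lemma eigvecZ lam a u : eigvec b h lam u -> eigvec b h lam (a *: u).
Proof.
by move=> eu w; rewrite (symformZl sh) (symformZl sb) eu mulrCA.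
Qed.

Lemma eigvec_sum lam (I : finType) (c : I -> R) (x : I -> E) :
  (forall i, eigvec b h lam (x i)) -> eigvec b h lam (\sum_i c i *: x i).
Proof.
move=> ex w; rewrite (symform_suml sh) (symform_suml sb) mulr_sumr.
by apply: eq_bigr => i _; rewrite ex mulrCA.
Qed.

Lemma eigvec_ortho lam1 lam2 u v : eigvec b h lam1 u -> eigvec b h lam2 v ->
  lam1 != lam2 -> b u v = 0.
Proof.
move=> eu ev l12; have := eu v; rewrite (symformC sh) ev (symformC sb) => /eqP.
rewrite -subr_eq0 -mulrBl mulf_eq0 subr_eq0 eq_sym (negbTE l12)/=.
by move/eqP.
Qed.

(** In the finite case a maximal orthonormal system of eigenvectors spans the
    eigenspace up to null vectors: a remainder of positive norm could be
    normalised and added to the system. *)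
Lemma eigdimP lam :
  (eigdim lam = +oo%E /\ forall n, eigdim_set lam n) \/
  exists n (f : 'I_n -> E), [/\ eigdim lam = n%:R%:E, orthosys b f,
    forall i, eigvec b h lam (f i) &
    forall u, eigvec b h lam u ->
      let r := u - \sum_i b (f i) u *: f i in b r r = 0].
Proof.
have dwn n m : (n <= m)%N -> eigdim_set lam m -> eigdim_set lam n.
  move=> nm [f [fo fe]]; exists (f \o widen_ord nm); split=> [i j|i] /=.
    by rewrite fo -!val_eqE.
  exact: fe.
have [all|] := pselect (forall n, eigdim_set lam n).
  left; split => //; apply: (@eq_pinfty_mulrn_le _ 1) => // n.
  by rewrite mulr1; apply: eigdim_ge.
move=> /existsNP[N SN]; right.
have bnd n : `[< eigdim_set lam n >] -> (n <= N)%N.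
  by move=> /asboolP Sn; rewrite leqNgt; apply/negP => /ltnW Nn; exact/SN/(dwn _ n).
have ex0 : exists n, `[< eigdim_set lam n >].
  by exists 0%N; apply/asboolP; exists (fun=> 0); split=> [[]|[]].
have [n /asboolP Sn nmax] := ex_maxnP ex0 bnd.
have [f [fo fe]] := Sn; exists n, f; split => //.
  apply/eqP; rewrite eq_le eigdim_ge// andbT.
  apply: ge_ereal_sup => _ [m Sm <-]; rewrite lee_fin ler_nat.
  by apply: nmax; exact/asboolP.
move=> u eu r; apply/eqP; rewrite eq_le b0 andbT leNgt; apply/negP => r0.
suff : (n.+1 <= n)%N by rewrite ltnn.
apply: nmax; apply/asboolP.
have er : eigvec b h lam r by apply: eigvecB => //; exact: eigvec_sum.
have fr i : b (f i) r = 0.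
  rewrite /r (symformBr sb) (symform_sumr sb) (bigD1 i)//= big1 ?addr0.
    by rewrite fo eqxx mulr1 subrr.
  by move=> j ji; rewrite fo eq_sym (negbTE ji) mulr0.
pose s := (Num.sqrt (b r r))^-1.
exists (fun i => if unlift ord0 i is Some j then f j else s *: r); split.
  move=> i j; case: (unliftP ord0 i) => [i'|] ->; case: (unliftP ord0 j) => [j'|] ->.
  - by rewrite fo (inj_eq lift_inj).
  - by rewrite (symformZr sb) fr mulr0.
  - by rewrite (symformZl sb) (symformC sb) fr mulr0.
  - rewrite (symform_sqZ sb) exprVn sqr_sqrtr ?(ltW r0)// mulVf ?eqxx//.
    by rewrite gt_eqF.
by move=> i; case: (unliftP ord0 i) => [i'|] _ //; exact: eigvecZ.
Qed.

(** Group the indices by eigenvalue: the vectors with the same eigenvalue form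
    an orthonormal system in its eigenspace. *)
Lemma eigtrace_ge n (f : 'I_n -> E) (nu : 'I_n -> R) gamma :
  eigsys b h f nu -> (forall i, nu i < 0) ->
  ((\sum_i `|nu i| `^ gamma)%:E <= eigtrace gamma)%E.
Proof.
move=> [fo fe] nu0; pose s := undup (codom nu).
have us : uniq s by exact: undup_uniq.
have s0 x : x \in s -> x < 0.
  by rewrite mem_undup => /codomP[i ->].
apply: esum_ge; exists [set` s].
  by split; [exact: finite_seq|move=> x /= /s0].
rewrite -fsbig_seq//=.
have -> : \sum_i `|nu i| `^ gamma =
    \sum_(x <- s) (#|[pred k | nu k == x]|%:R * `|x| `^ gamma).
  have -> : \sum_(x <- s) (#|[pred k | nu k == x]|%:R * `|x| `^ gamma) =
      \sum_(x <- s) \sum_k (if nu k == x then `|nu k| `^ gamma else 0).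
    apply: eq_bigr => x _; rewrite -big_mkcond/=.
    rewrite (eq_bigr (fun=> `|x| `^ gamma)); last by move=> i /eqP ->.
    by rewrite sumr_const mulr_natl.
  rewrite exchange_big/=; apply: eq_bigr => k _.
  rewrite (bigD1_seq (nu k))//= ?eqxx ?big1 ?addr0//.
    by move=> x xk; rewrite eq_sym (negbTE xk).
  by rewrite mem_undup codom_f.
rewrite -sumEFin big_seq [leRHS]big_seq; apply: lee_sum => x xs.
rewrite EFinM; apply: lee_wpmul2r; first by rewrite lee_fin powR_ge0.
apply: eigdim_ge; exists (fun i => f (enum_val i)); split.
  by move=> i j; rewrite fo (inj_eq enum_val_inj).
move=> i; have := fe (enum_val i); have /eqP nui := enum_valP i.
by rewrite [nu _]nui.
Qed.

Lemma eigsys_cat n m (f : 'I_n -> E) nu (g : 'I_m -> E) (lam : R) :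
  eigsys b h f nu -> (forall i, nu i != lam) ->
  orthosys b g -> (forall i, eigvec b h lam (g i)) ->
  eigsys b h (fun i => match fintype.split i with inl j => f j | inr j => g j end)
    (fun i => match fintype.split i with inl j => nu j | inr j => lam end).
Proof.
move=> [fo fe] nul go ge; split=> [i j|i]; last by case: (fintype.split i).
rewrite -(inj_eq (can_inj splitK)).
case: (fintype.split i) => i'; case: (fintype.split j) => j' /=.
- exact: fo.
- exact: (eigvec_ortho (fe _) (ge _)).
- by rewrite (symformC sb); exact: (eigvec_ortho (fe _) (ge _)).
- exact: go.
Qed.

(** To bound a sum over all negative eigenvalues it suffices to bound the sums
    along finite orthonormal systems.  The eigenvalues of a finite set are
    absorbed one by one into the system, eigenvectors of different eigenvalues
    being orthogonal; an infinite eigenspace forces the bound to be infinite.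
    The weight [M] is general so that the result also applies to the complex
    multiplicity. *)
Lemma esum_le_eigsys gamma (M : R -> \bar R) (X : \bar R) :
  (forall lam, (0 <= M lam)%E) ->
  (forall lam : R, lam < 0 -> (M lam <= eigdim lam)%E) ->
  (forall n (f : 'I_n -> E) nu, eigsys b h f nu -> (forall i, nu i < 0) ->
     ((\sum_i `|nu i| `^ gamma)%:E <= X)%E) ->
  (\esum_(lambda in [set lambda : R | (lambda < 0)%R])
     (M lambda * (`|lambda| `^ gamma)%:E) <= X)%E.
Proof.
move=> M0 ME sysX.
have key (s : seq R) : uniq s -> (forall x, x \in s -> x < 0) ->
  forall n (f : 'I_n -> E) nu, eigsys b h f nu -> (forall i, nu i < 0) ->
    (forall i, nu i \notin s) ->
  ((\sum_i `|nu i| `^ gamma)%:E + \sum_(x <- s) (M x * (`|x| `^ gamma)%:E) <= X)%E.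
  elim: s => [|x s IH] /=; first by move=> _ _ n f nu fe nu0 _; rewrite big_nil adde0; exact: sysX fe nu0.
  move=> /andP[xs us] s0 n f nu fe nu0 nus; rewrite big_cons.
  have x0 : x < 0 by apply: s0; rewrite inE eqxx.
  have step m : eigdim_set x m ->
    ((\sum_i `|nu i| `^ gamma)%:E + ((m%:R * `|x| `^ gamma)%:E +
      \sum_(x <- s) (M x * (`|x| `^ gamma)%:E)) <= X)%E.
    move=> [g [go ge]].
    have nux i : nu i != x by have := nus i; rewrite inE negb_or => /andP[].
    have := IH us _ _ _ _ (eigsys_cat fe nux go ge).
    rewrite big_split_ord/=.
    rewrite (eq_bigr (fun i => `|nu i| `^ gamma)); last first.
      by move=> i _; rewrite (unsplitK (inl _ i)).
    rewrite [X in ((_ + X)%R)%:E](eq_bigr (fun=> `|x| `^ gamma)); last first.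
      by move=> i _; rewrite (unsplitK (inr _ i)).
    rewrite sumr_const card_ord -[X in ((_ + X)%R)%:E]mulr_natl EFinD -addeA; apply.
    - by move=> y ys; apply: s0; rewrite inE ys orbT.
    - by move=> i; case: (fintype.split i).
    - by move=> i; case: (fintype.split i) => j //; have := nus j; rewrite inE negb_or => /andP[].
  have S0 : (0 <= \sum_(x <- s) (M x * (`|x| `^ gamma)%:E))%E.
    by apply: sume_ge0 => y _; rewrite mule_ge0// lee_fin powR_ge0.
  have [[_ all]|[m [g [eqm go ge _]]]] := eigdimP x.
    suff -> : X = +oo%E by rewrite leey.
    apply: (@eq_pinfty_mulrn_le _ (`|x| `^ gamma)).
      by rewrite powR_gt0// normr_gt0 lt_eqF.
    move=> m; apply: le_trans (step m (all m)).
    rewrite -[leLHS]add0e leeD//; first by rewrite lee_fin sumr_ge0// => i _; exact: powR_ge0.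
    by rewrite leeDl.
  apply: le_trans (step m _); last by exists g.
  rewrite leeD2l// leeD2r// EFinM; apply: lee_wpmul2r; first by rewrite lee_fin powR_ge0.
  by rewrite -eqm ME.
apply: ge_ereal_sup => _ [A [Afin A0] <-].
rewrite fsbig_finite//=.
have := key (finmap.enum_fset (fset_set A)) (finmap.fset_uniq _) _ 0%N (fun=> 0) (fun=> 0).
rewrite big_ord0 add0e; apply.
- by move=> x; rewrite in_fset_set// inE => /A0.
- by split=> [[]|[]].
- by case.
- by case.
Qed.

End traces.

(** * Integrable and square-integrable real functions *)

Section real_integrable.
Context d (T : measurableType d) (R : realType) (mu : {measure set T -> \bar R}).
Variables (D : set T) (mD : measurable D).
Implicit Types f g u v w : T -> R.

Definition rintegrable (A : set T) f := mu.-integrable A (EFin \o f).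

Lemma rintegrable_measurable f : rintegrable D f -> measurable_fun D f.
Proof. by move=> /integrableP[/measurable_EFinP]. Qed.

Lemma rintegrable_le f g : measurable_fun D f ->
  (forall x, D x -> `|f x| <= g x) -> rintegrable D g -> rintegrable D f.
Proof.
move=> mf fg; apply: le_integrable => //; first exact/measurable_EFinP.
move=> x Dx /=; rewrite lee_fin; apply: le_trans (fg x Dx) _.
exact: ler_norm.
Qed.

Lemma rintegrableD f g : rintegrable D f -> rintegrable D g ->
  rintegrable D (fun x => f x + g x).
Proof. exact: integrableD. Qed.

Lemma rintegrableB f g : rintegrable D f -> rintegrable D g ->
  rintegrable D (fun x => f x - g x).
Proof. exact: integrableB. Qed.

Lemma rintegrableZ a f : rintegrable D f -> rintegrable D (fun x => a * f x).
Proof. exact: integrableZl. Qed.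

Lemma rintegrable_eq f g : (forall x, D x -> f x = g x) ->
  rintegrable D f -> rintegrable D g.
Proof.
by move=> fg; apply: eq_integrable => // x /set_mem Dx /=; rewrite fg.
Qed.

Lemma eq_Rint f g : (forall x, D x -> f x = g x) ->
  \int[mu]_(x in D) f x = \int[mu]_(x in D) g x.
Proof. by move=> fg; apply: eq_Rintegral => x /set_mem; exact: fg. Qed.

Lemma rintegrable_ge0P f : measurable_fun D f -> (forall x, D x -> 0 <= f x) ->
  rintegrable D f <-> (\int[mu]_(x in D) (f x)%:E < +oo)%E.
Proof.
move=> mf f0; split => [/integrableP[_]|fI].
  by under eq_integral => x /set_mem Dx do rewrite /= ger0_norm ?f0//.
apply/integrableP; split; first exact/measurable_EFinP.
by under eq_integral => x /set_mem Dx do rewrite /= ger0_norm ?f0//.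
Qed.

Lemma rintegrableE f : rintegrable D f ->
  (\int[mu]_(x in D) (f x)%:E)%E = (\int[mu]_(x in D) f x)%:E.
Proof. by move=> fi; rewrite /Rintegral fineK//; exact: integrable_fin_num. Qed.

Lemma rintegrable_wsqr_mul w u v :
  measurable_fun D w -> measurable_fun D u -> measurable_fun D v ->
  (forall x, D x -> 0 <= w x) ->
  rintegrable D (fun x => w x * u x ^+ 2) ->
  rintegrable D (fun x => w x * v x ^+ 2) ->
  rintegrable D (fun x => w x * u x * v x).
Proof.
move=> mw mu0 mv w0 iu iv.
apply: (rintegrable_le _ _ (rintegrableD iu iv)).
  by apply: measurable_funM => //; exact: measurable_funM.
move=> x Dx /=; rewrite -mulrDr -mulrA normrM ger0_norm ?w0//.
apply: ler_wpM2l; first exact: w0.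
by rewrite ler_norml; nra.
Qed.

Lemma rintegrable_wsqr_comb w u v a :
  measurable_fun D w -> measurable_fun D u -> measurable_fun D v ->
  (forall x, D x -> 0 <= w x) ->
  rintegrable D (fun x => w x * u x ^+ 2) ->
  rintegrable D (fun x => w x * v x ^+ 2) ->
  rintegrable D (fun x => w x * (a * u x + v x) ^+ 2).
Proof.
move=> mw mu0 mv w0 iu iv.
have := rintegrableD (rintegrableZ (a ^+ 2) iu)
  (rintegrableD (rintegrableZ (2 * a) (rintegrable_wsqr_mul mw mu0 mv w0 iu iv)) iv).
by apply: rintegrable_eq => x _; ring.
Qed.

Definition sqint u := measurable_fun D u /\ rintegrable D (fun x => u x ^+ 2).

Lemma sqint_mul u v : sqint u -> sqint v -> rintegrable D (fun x => u x * v x).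
Proof.
move=> [mu0 iu] [mv iv].
have H := @rintegrable_wsqr_mul (fun=> 1) u v; apply: rintegrable_eq (H _ mu0 mv _ _ _) => //.
- by move=> x _; rewrite mul1r.
- by apply: rintegrable_eq iu => x _; rewrite mul1r.
- by apply: rintegrable_eq iv => x _; rewrite mul1r.
Qed.

Lemma measurable_fun_comb a u v : measurable_fun D u -> measurable_fun D v ->
  measurable_fun D (fun x => a * u x + v x).
Proof.
by move=> mu0 mv; apply: measurable_funD => //; exact: measurable_funM.
Qed.

Lemma sqint_comb a u v : sqint u -> sqint v -> sqint (fun x => a * u x + v x).
Proof.
move=> [mu0 iu] [mv iv]; split; first exact: measurable_fun_comb.
have := @rintegrable_wsqr_comb (fun=> 1) u v a.
move=> H; apply: rintegrable_eq (H _ mu0 mv _ _ _) => //.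
- by move=> x _; rewrite mul1r.
- by apply: rintegrable_eq iu => x _; rewrite mul1r.
- by apply: rintegrable_eq iv => x _; rewrite mul1r.
Qed.

Lemma Rint_comb a f g : rintegrable D f -> rintegrable D g ->
  \int[mu]_(x in D) (a * f x + g x) =
  a * \int[mu]_(x in D) f x + \int[mu]_(x in D) g x.
Proof.
move=> fi gi; rewrite RintegralD//; last exact: rintegrableZ.
by rewrite RintegralZl.
Qed.

Lemma rintegrable_cst a : (mu D < +oo)%E -> rintegrable D (fun=> a).
Proof.
move=> Doo; apply/integrableP; split; first exact/measurable_EFinP.
by rewrite integral_cst//= lte_mul_pinfty.
Qed.

Lemma sqint_integrable g : (mu D < +oo)%E -> sqint g -> rintegrable D g.
Proof.
move=> Doo [mg ig]; apply: (rintegrable_le _ _ (rintegrableD (rintegrable_cst 1 Doo) ig)) => //.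
by move=> x _; rewrite ler_norml; nra.
Qed.

(** Cauchy--Schwarz against the constant function, from the nonnegativity of
    the integral of [(g - c)^2] for the optimal [c]. *)
Lemma sqr_Rintegral_le g : (mu D < +oo)%E -> sqint g ->
  (\int[mu]_(x in D) g x) ^+ 2 <= fine (mu D) * \int[mu]_(x in D) (g x ^+ 2).
Proof.
move=> Doo sg; have [mg ig] := sg.
have ia : rintegrable D g by exact: sqint_integrable.
have D0 : 0 <= fine (mu D) by exact: fine_ge0.
have key c : 0 <= \int[mu]_(x in D) (g x ^+ 2) - 2 * c * \int[mu]_(x in D) g x
    + c ^+ 2 * fine (mu D).
  have -> : \int[mu]_(x in D) (g x ^+ 2) - 2 * c * \int[mu]_(x in D) g x
    + c ^+ 2 * fine (mu D) = \int[mu]_(x in D) ((g x - c) ^+ 2).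
    rewrite -Rintegral_cst// -RintegralZl// -RintegralB//; last first.
      exact: rintegrableZ.
    rewrite -RintegralD//.
    - by apply: eq_Rint => x _; ring.
    - by apply: rintegrableB => //; exact: rintegrableZ.
    - exact: rintegrable_cst.
  by apply: Rintegral_ge0 => x _; exact: sqr_ge0.
move: key; set A := \int[mu]_(x in D) (_ ^+ 2); set B := \int[mu]_(x in D) g x.
set s := fine _ => key.
have [s0|s0] := eqVneq s 0.
  have [->|B0] := eqVneq B 0; first by rewrite s0 mul0r expr0n.
  have := key ((A + 1) / (2 * B)); rewrite s0 mulr0 addr0.
  have -> : A - 2 * ((A + 1) / (2 * B)) * B = -1 by field.
  by rewrite oppr_ge0 ler10.
have s1 : 0 < s by rewrite lt_neqAle eq_sym s0.
have := key (B / s); have -> : A - 2 * (B / s) * B + (B / s) ^+ 2 * s =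
  (s * A - B ^+ 2) / s by field.
by rewrite pmulr_lge0 ?invr_gt0// subr_ge0.
Qed.

End real_integrable.
Arguments rintegrable {d T R} mu A f.

(** * Absolutely continuous functions on the half-line *)

Section half_line.
Context {R : realType}.
Notation mu := (@lebesgue_measure R).
Notation edge := (edge R).
Notation fpair := ((R -> R) * (R -> R))%type.
Implicit Types (v w : R -> R) (p r : fpair) (x y s : R).

Lemma edgeE x : edge x = (0 <= x) :> Prop.
Proof. by rewrite /Defs.edge /= in_itv/= andbT. Qed.

Lemma measurable_edge : measurable edge.
Proof. exact: measurable_itv. Qed.

Lemma measurable_edgeL : @measurable _ (measurableTypeR R) edge.
Proof. exact: measurable_itv. Qed.

#[local] Hint Extern 0 (measurable _) => solve [apply: measurable_edge] : core.

Definition hl_pot v := measurable_fun edge v /\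
  exists2 p : R, 1 <= p & rintegrable mu edge (fun t => v^\- t `^ p).

(** Form-domain functions are pairs of a function and a square-integrable
    derivative, the continuous representative being recovered by integration.
    Keeping the derivative as data makes the forms below bilinear on the nose;
    the price is that derivatives differing on a null set are distinct. *)
Definition hl_dom v p := [/\ sqint mu edge p.1, sqint mu edge p.2,
  rintegrable mu edge (fun t => v^\+ t * p.1 t ^+ 2) &
  forall x, 0 <= x -> p.1 x = p.1 0 + \int[mu]_(t in `[0, x]) p.2 t].

Definition hl_b p r := \int[mu]_(t in edge) (p.1 t * r.1 t).
Definition hl_h v p r := \int[mu]_(t in edge) (p.2 t * r.2 t + v t * p.1 t * r.1 t).
(** The inner product of the form norm of [H^1] with weight [v^\+]. *)
Definition hl_q v p r :=
  \int[mu]_(t in edge) (p.2 t * r.2 t + p.1 t * r.1 t + v^\+ t * p.1 t * r.1 t).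

Lemma sub_itv_edge x y (b0 b1 : bool) : 0 <= x ->
  [set` Interval (BSide b0 x) (BSide b1 y)] `<=` edge.
Proof.
move=> x0 t /=; rewrite edgeE !itv_boundlr/= => /andP[xt _].
by apply: le_trans x0 _; move: xt; case: b0; rewrite bnd_simp// => /ltW.
Qed.

Lemma sub_itv_edge_pinfty x (b0 : bool) : 0 <= x ->
  [set` Interval (BSide b0 x) +oo%O] `<=` edge.
Proof.
move=> x0 t /=; rewrite edgeE !itv_boundlr/= => /andP[xt _].
by apply: le_trans x0 _; move: xt; case: b0; rewrite bnd_simp// => /ltW.
Qed.

Lemma sqint_subset (A : set R) f : measurable A -> A `<=` edge ->
  sqint mu edge f -> sqint mu A f.
Proof.
move=> mA AE [mf fi]; split; first exact: measurable_funS mf.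
exact: integrableS fi.
Qed.

Lemma Rint_subset (A : set R) f : measurable A -> A `<=` edge ->
  (forall t, edge t -> 0 <= f t) -> rintegrable mu edge f ->
  \int[mu]_(t in A) f t <= \int[mu]_(t in edge) f t.
Proof.
move=> mA AE f0 fi.
have fA : rintegrable mu A f by exact: integrableS fi.
rewrite -lee_fin -!rintegrableE//; apply: ge0_subset_integral => //.
  by apply/measurable_EFinP; exact: rintegrable_measurable fi.
Qed.

Lemma Rintegral_itv0_restrict f y :
  \int[mu]_(t in `[0, y]) f t = \int[mu]_(t in edge) (f \_ `[0, y]%classic) t.
Proof.
by rewrite -Rintegral_mkcondr; congr Rintegral; apply/esym/setIidr; exact: sub_itv_edge.
Qed.

Lemma mu_itv x y (b0 b1 : bool) : x <= y ->
  fine (mu [set` Interval (BSide b0 x) (BSide b1 y)]) = y - x.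
Proof.
rewrite lebesgue_measure_itv/= lte_fin le_eqVlt => /orP[/eqP ->|->] //.
by rewrite ltxx/= subrr.
Qed.

Section pairs.
Variables (p : fpair).
Hypotheses (s1 : sqint mu edge p.1) (s2 : sqint mu edge p.2).
Hypothesis pE : forall x, 0 <= x -> p.1 x = p.1 0 + \int[mu]_(t in `[0, x]) p.2 t.

Lemma itv_lty x y (b0 b1 : bool) :
  (mu [set` Interval (BSide b0 x) (BSide b1 y)] < +oo)%E.
Proof. by rewrite lebesgue_measure_itv/=; case: ifPn => // _; rewrite -EFinB ltry. Qed.

Lemma deriv_integrable x y (b0 b1 : bool) : 0 <= x ->
  rintegrable mu [set` Interval (BSide b0 x) (BSide b1 y)] p.2.
Proof.
move=> x0; apply: sqint_integrable => //; first exact: itv_lty.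
by apply: sqint_subset => //; exact: sub_itv_edge.
Qed.

Lemma pair_diff x y : 0 <= x -> x <= y ->
  p.1 y - p.1 x = \int[mu]_(t in `]x, y]) p.2 t.
Proof.
move=> x0 xy; rewrite (pE (le_trans x0 xy)) (pE x0) opprD addrACA subrr add0r.
by rewrite Rintegral_itvB// ?bnd_simp//; exact: deriv_integrable.
Qed.

Lemma pair_diff_sqr x y : 0 <= x -> x <= y ->
  (p.1 y - p.1 x) ^+ 2 <= (y - x) * \int[mu]_(t in edge) (p.2 t ^+ 2).
Proof.
move=> x0 xy; rewrite (pair_diff x0 xy).
have sub : `]x, y]%classic `<=` edge by exact: sub_itv_edge.
have sI : sqint mu `]x, y]%classic p.2 by apply: sqint_subset.
have := sqr_Rintegral_le _ (itv_lty _ _ _ _) sI => H.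
apply: le_trans (H _) _ => //.
rewrite [X in X * _](mu_itv _ _ xy); apply: ler_wpM2l; first by rewrite subr_ge0.
by apply: Rint_subset => //; [move=> t _; exact: sqr_ge0|case: s2].
Qed.

(** The value at [y] is controlled by a value at distance [y - x] and the
    Dirichlet energy; the constant [2] comes from
    [(a + b)^2 <= 2 a^2 + 2 b^2]. *)
Lemma pair_near_sqr x y : 0 <= x -> x <= y ->
  p.1 y ^+ 2 <= 2 * p.1 x ^+ 2 + 2 * (y - x) * \int[mu]_(t in edge) (p.2 t ^+ 2).
Proof.
move=> x0 xy; have := pair_diff_sqr x0 xy; have := sqr_ge0 (p.1 y - 2 * p.1 x).
set G := \int[mu]_(_ in _) _; lra.
Qed.

Lemma pair_near_sqr' x y : 0 <= x -> x <= y ->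
  p.1 x ^+ 2 <= 2 * p.1 y ^+ 2 + 2 * (y - x) * \int[mu]_(t in edge) (p.2 t ^+ 2).
Proof.
move=> x0 xy; have := pair_diff_sqr x0 xy; have := sqr_ge0 (p.1 x - 2 * p.1 y).
set G := \int[mu]_(_ in _) _; lra.
Qed.

(** The Sobolev bound with a free scale: average the bound of the value at [x]
    by the values on an interval of length [s]. *)
Lemma pair_sup_sqr x s : 0 <= x -> 0 < s ->
  p.1 x ^+ 2 <= 2 / s * \int[mu]_(t in edge) (p.1 t ^+ 2) +
     2 * s * \int[mu]_(t in edge) (p.2 t ^+ 2).
Proof.
move=> x0 sp; set A := \int[mu]_(t in edge) (p.1 t ^+ 2); set G := \int[mu]_(t in edge) _.
have sub : `[x, x + s]%classic `<=` edge by exact: sub_itv_edge.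
have m1 : measurable `[x, x + s]%classic by exact: measurable_itv.
have G0 : 0 <= G by apply: Rintegral_ge0 => t _; exact: sqr_ge0.
have ms : fine (mu `[x, x + s]%classic) = s.
  by rewrite mu_itv ?lerDl ?(ltW sp)// addrAC subrr add0r.
have ci c : rintegrable mu `[x, x + s]%classic (fun=> c).
  by apply: rintegrable_cst => //; exact: itv_lty.
have [_ i1] := sqint_subset m1 sub s1.
have H : \int[mu]_(t in `[x, x + s]) (p.1 x ^+ 2) <=
    \int[mu]_(t in `[x, x + s]) (2 * p.1 t ^+ 2 + 2 * s * G).
  apply: le_Rintegral => //; first exact: ci.
    by apply: rintegrableD => //; exact: rintegrableZ.
  move=> t /=; rewrite in_itv/= => /andP[xt txs].
  apply: le_trans (pair_near_sqr' x0 xt) _; rewrite lerD2l.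
  by apply: ler_wpM2r => //; lra.
move: H; rewrite Rintegral_cst// RintegralD//; [|exact: rintegrableZ|exact: ci].
rewrite RintegralZl// Rintegral_cst// ms.
have : \int[mu]_(t in `[x, x + s]) (p.1 t ^+ 2) <= A.
  by apply: Rint_subset => //; [move=> t _; exact: sqr_ge0|case: s1].
set B := \int[mu]_(_ in _) _ => BA H.
rewrite -(ler_pM2r sp); apply: le_trans H _.
have -> : (2 / s * A + 2 * s * G) * s = 2 * A + 2 * s * G * s.
  by field; rewrite gt_eqF.
lra.
Qed.

End pairs.

End half_line.
#[local] Hint Extern 0 (measurable _) => solve [apply: measurable_edge] : core.

(** * The Schroedinger form on the half-line *)

Section half_line_forms.
Context {R : realType}.
Notation mu := (@lebesgue_measure R).
Notation edge := (edge R).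
Notation fpair := ((R -> R) * (R -> R))%type.
Implicit Types (v w : R -> R) (p r : fpair) (x y s : R).

Lemma hl_tail w : (forall t, edge t -> 0 <= w t) -> rintegrable mu edge w ->
  forall e : R, 0 < e -> exists2 a : R, 0 < a & \int[mu]_(t in `[a, +oo[) w t <= e.
Proof.
move=> w0 iw e e0.
have mw : measurable_fun edge w by exact: rintegrable_measurable iw.
pose F n : set R := `[0, n.+1%:R[%classic.
have UF : \bigcup_n F n = edge.
  apply/seteqP; split => [x [n _]|x]; rewrite edgeE.
    by rewrite /F /= in_itv/= => /andP[].
  move=> x0; exists (Num.truncn x) => //=; rewrite /F/= in_itv/= x0/=.
  by case/andP: (truncn_itv x0).
have subF n : F n `<=` edge by exact: sub_itv_edge.
have /= := @ge0_nondecreasing_set_cvg_integral _ (measurableTypeR R) R F (EFin \o w) mu _ _ _ _.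
rewrite UF => cv.
have {}cv : \int[mu]_(t in F n) w t @[n --> \oo] --> \int[mu]_(t in edge) w t.
  apply: fine_cvg; rewrite fineK; first apply: cv.
  - apply/nondecreasing_seqP => n; rewrite subsetEset => x /=.
    rewrite /F/= !in_itv/= => /andP[-> xn]/=; apply: lt_le_trans xn _.
    by rewrite ler_nat.
  - by move=> i; exact: measurable_itv.
  - by move=> i; apply/measurable_EFinP; exact: (measurable_funS measurable_edge (@subF i) mw).
  - by move=> i x /subF /w0; rewrite lee_fin.
  - by rewrite rintegrableE.
have [n _ /(_ n)/=] := (cvgrPdist_le _ _).1 cv e e0.
move=> /(_ (leqnn _)) H.
exists n.+1%:R => //.
have nE : edge = F n `|` `[n.+1%:R, +oo[%classic.
  by rewrite /F /Defs.edge -itv_bndbnd_setU// bnd_simp.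
have : \int[mu]_(t in edge) w t = \int[mu]_(t in F n) w t +
    \int[mu]_(t in `[n.+1%:R, +oo[) w t.
  rewrite {1}nE Rintegral_setU//; first exact: measurable_itv.
  - by rewrite -nE.
  - apply/disj_setPS => x [/=]; rewrite /F/= !in_itv/= andbT => /andP[_ xn].
    by rewrite leNgt xn.
move=> E; apply: le_trans H; apply: le_trans (ler_norm _).
by rewrite E addrAC subrr add0r.
Qed.

Section potential.
Variable v : R -> R.
Hypothesis hv : hl_pot v.

Lemma hl_pot_measurable : measurable_fun edge v. Proof. by case: hv. Qed.

(** A function with integrable [p]-th power is the sum of a small bounded part
    and an integrable one: where [v^\- > d] the ratio [v^\- / d] is at most its
    [p]-th power. *)
Lemma neg_split d : 0 < d -> exists w, [/\ measurable_fun edge w,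
  forall t, 0 <= w t, rintegrable mu edge w & forall t, v^\- t <= d + w t].
Proof.
move=> d0; have [mv [p p1 ip]] := hv.
pose w t := d * d^-1 `^ p * v^\- t `^ p.
have iw : rintegrable mu edge w by exact: rintegrableZ.
exists w; split => //.
- exact: rintegrable_measurable iw.
- by move=> t; rewrite !mulr_ge0 ?powR_ge0// ltW.
- move=> t; have vt : 0 <= v^\- t by exact: funrneg_ge0.
  have [vd|vd] := leP (v^\- t) d.
    by apply: le_trans vd _; rewrite lerDl !mulr_ge0 ?powR_ge0// ltW.
  apply: le_trans (_ : w t <= _); last by rewrite lerDr ltW.
  rewrite /w -mulrA -powRM ?invr_ge0 ?(ltW d0)//.
  rewrite -ler_pdivrMl//; apply: le1r_powR => //.
  by rewrite mulrC ler_pdivlMr// mul1r ltW.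
Qed.

Lemma wsqr_integrable w p M : measurable_fun edge w ->
  (forall t, edge t -> 0 <= w t) -> rintegrable mu edge w -> measurable_fun edge p.1 ->
  (forall t, edge t -> p.1 t ^+ 2 <= M) ->
  rintegrable mu edge (fun t => w t * p.1 t ^+ 2).
Proof.
move=> mw w0 iw mp pM.
apply: (rintegrable_le _ _ _ (rintegrableZ _ M iw)) => //.
  by apply: measurable_funM => //; exact: measurable_funX.
move=> t Et /=; rewrite ger0_norm; last first.
  by apply: mulr_ge0; [exact: w0|exact: sqr_ge0].
rewrite mulrC.
by apply: ler_wpM2r; [exact: w0|exact: pM].
Qed.

Lemma wsqr_le w p M : measurable_fun edge w ->
  (forall t, edge t -> 0 <= w t) -> rintegrable mu edge w -> measurable_fun edge p.1 ->
  (forall t, edge t -> p.1 t ^+ 2 <= M) ->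
  \int[mu]_(t in edge) (w t * p.1 t ^+ 2) <= M * \int[mu]_(t in edge) w t.
Proof.
move=> mw w0 iw mp pM.
rewrite -RintegralZl//; apply: le_Rintegral => //.
- exact: wsqr_integrable pM.
- exact: rintegrableZ.
- by move=> t Et; rewrite mulrC; apply: ler_wpM2r; [exact: w0|exact: pM].
Qed.

(** The diagonal terms: [L2] norm, gradient energy, and the potential energies
    of the positive (plus) and negative (minus) part. *)
Definition sqA p := \int[mu]_(t in edge) (p.1 t ^+ 2).
Definition sqG p := \int[mu]_(t in edge) (p.2 t ^+ 2).
Definition sqP p := \int[mu]_(t in edge) (v^\+ t * p.1 t ^+ 2).
Definition sqM p := \int[mu]_(t in edge) (v^\- t * p.1 t ^+ 2).

Lemma sqA_ge0 p : 0 <= sqA p. Proof. by apply: Rintegral_ge0 => t _; exact: sqr_ge0. Qed.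
Lemma sqG_ge0 p : 0 <= sqG p. Proof. by apply: Rintegral_ge0 => t _; exact: sqr_ge0. Qed.
Lemma sqP_ge0 p : 0 <= sqP p.
Proof. by apply: Rintegral_ge0 => t _; rewrite mulr_ge0// sqr_ge0. Qed.
Lemma sqM_ge0 p : 0 <= sqM p.
Proof. by apply: Rintegral_ge0 => t _; rewrite mulr_ge0// sqr_ge0. Qed.

Lemma hl_dom_sup p x s : hl_dom v p -> 0 < s -> edge x ->
  p.1 x ^+ 2 <= 2 / s * sqA p + 2 * s * sqG p.
Proof. by move=> [s1 s2 _ pE] s0; rewrite edgeE => x0; exact: pair_sup_sqr. Qed.

Lemma hl_dom_measurable p : hl_dom v p -> measurable_fun edge p.1.
Proof. by case=> -[]. Qed.

Lemma hl_dom_neg p : hl_dom v p -> rintegrable mu edge (fun t => v^\- t * p.1 t ^+ 2).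
Proof.
move=> dp; have mp := hl_dom_measurable dp; have [[_ i1] _ _ _] := dp.
have [w [mw w0 iw vw]] := neg_split ltr01.
have iw2 : rintegrable mu edge (fun t => w t * p.1 t ^+ 2).
  apply: (@wsqr_integrable _ _ (2 / 1 * sqA p + 2 * 1 * sqG p)) => // t Et.
  exact: hl_dom_sup.
apply: (rintegrable_le _ _ _ (rintegrableD _ (rintegrableZ _ 1 i1) iw2)) => //.
  apply: measurable_funM => //; last exact: measurable_funX.
  by apply: measurable_funrneg; exact: hl_pot_measurable.
move=> t Et /=; rewrite ger0_norm; last first.
  by apply: mulr_ge0; [exact: funrneg_ge0|exact: sqr_ge0].
rewrite -mulrDl.
by apply: ler_wpM2r; [exact: sqr_ge0|exact: vw].
Qed.

Lemma hl_dom_pmul p r : hl_dom v p -> hl_dom v r ->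
  rintegrable mu edge (fun t => v^\+ t * p.1 t * r.1 t).
Proof.
move=> dp dr; apply: rintegrable_wsqr_mul => //.
- by apply: measurable_funrpos; exact: hl_pot_measurable.
- exact: hl_dom_measurable dp.
- exact: hl_dom_measurable dr.
- by case: dp.
- by case: dr.
Qed.

Lemma hl_dom_nmul p r : hl_dom v p -> hl_dom v r ->
  rintegrable mu edge (fun t => v^\- t * p.1 t * r.1 t).
Proof.
move=> dp dr; apply: rintegrable_wsqr_mul => //.
- by apply: measurable_funrneg; exact: hl_pot_measurable.
- exact: hl_dom_measurable dp.
- exact: hl_dom_measurable dr.
- exact: hl_dom_neg.
- exact: hl_dom_neg.
Qed.

Lemma funrposneg t : v t = v^\+ t - v^\- t.
Proof. by have /(congr1 (@^~ t)) := funrposBneg v. Qed.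

Lemma hl_dom_vmul p r : hl_dom v p -> hl_dom v r ->
  rintegrable mu edge (fun t => v t * p.1 t * r.1 t).
Proof.
move=> dp dr; have := rintegrableB measurable_edgeL (hl_dom_pmul dp dr) (hl_dom_nmul dp dr).
by apply: rintegrable_eq => // t _; rewrite [v t]funrposneg; ring.
Qed.

Lemma hl_dom_bmul p r : hl_dom v p -> hl_dom v r ->
  rintegrable mu edge (fun t => p.1 t * r.1 t).
Proof. by move=> [? _ _ _] [? _ _ _]; exact: sqint_mul. Qed.

Lemma hl_dom_gmul p r : hl_dom v p -> hl_dom v r ->
  rintegrable mu edge (fun t => p.2 t * r.2 t).
Proof. by move=> [_ ? _ _] [_ ? _ _]; exact: sqint_mul. Qed.

Lemma hl_dom_hmul p r : hl_dom v p -> hl_dom v r ->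
  rintegrable mu edge (fun t => p.2 t * r.2 t + v t * p.1 t * r.1 t).
Proof.
by move=> dp dr; apply: rintegrableD => //; [exact: hl_dom_gmul|exact: hl_dom_vmul].
Qed.

Lemma hl_dom_qmul p r : hl_dom v p -> hl_dom v r ->
  rintegrable mu edge (fun t => p.2 t * r.2 t + p.1 t * r.1 t + v^\+ t * p.1 t * r.1 t).
Proof.
move=> dp dr; apply: rintegrableD => //; last exact: hl_dom_pmul.
by apply: rintegrableD => //; [exact: hl_dom_gmul|exact: hl_dom_bmul].
Qed.

Lemma hl_dom0 : hl_dom v (0, 0).
Proof.
have i0 : rintegrable mu edge (fun=> 0 : R) by exact: integrable0.
split => /=.
- split; [exact: measurable_cst|]; apply: (rintegrable_eq _ _ i0) => // t _; by rewrite expr0n.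
- split; [exact: measurable_cst|]; apply: (rintegrable_eq _ _ i0) => // t _; by rewrite expr0n.
- by apply: (rintegrable_eq _ _ i0) => // t _; rewrite expr0n mulr0.
- by move=> x x0; rewrite Rintegral_cst ?mul0r ?addr0//; exact: measurable_itv.
Qed.

Lemma hl_dom_comb (a : R) p r : hl_dom v p -> hl_dom v r -> hl_dom v (a *: p + r).
Proof.
move=> dp dr; have [p1 p2 p3 p4] := dp; have [r1 r2 r3 r4] := dr; split.
- exact: (sqint_comb _ a p1 r1).
- exact: (sqint_comb _ a p2 r2).
- rewrite -[(a *: p + r).1]/(fun t => a * p.1 t + r.1 t).
  apply: rintegrable_wsqr_comb => //.
  + by apply: measurable_funrpos; exact: hl_pot_measurable.
  + by case: p1.
  + by case: r1.
- move=> x x0 /=.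
  have -> : \int[mu]_(t in `[0, x]) ((a *: p.2 + r.2) t) =
      a * \int[mu]_(t in `[0, x]) p.2 t + \int[mu]_(t in `[0, x]) r.2 t.
    rewrite -Rint_comb//; first exact: deriv_integrable p2 _ _ _ _ (lexx 0).
    exact: deriv_integrable r2 _ _ _ _ (lexx 0).
  rewrite -[LHS]/(a * p.1 x + r.1 x) p4// r4//.
  rewrite -[(_ + _) 0]/(a * p.1 0 + r.1 0); ring.
Qed.

Lemma hl_bC p r : hl_b p r = hl_b r p.
Proof. by apply: eq_Rint => t _; rewrite mulrC. Qed.

Lemma hl_hC p r : hl_h v p r = hl_h v r p.
Proof. by apply: eq_Rint => t _; ring. Qed.

Lemma hl_b_comb (a : R) p r (s : fpair) : hl_dom v p -> hl_dom v r -> hl_dom v s ->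
  hl_b (a *: p + r) s = a * hl_b p s + hl_b r s.
Proof.
move=> dp dr ds; rewrite -Rint_comb//; [|exact: hl_dom_bmul..].
by apply: eq_Rint => t _; rewrite -[(_ + _).1 t]/(a * p.1 t + r.1 t); ring.
Qed.

Lemma hl_h_comb (a : R) p r (s : fpair) : hl_dom v p -> hl_dom v r -> hl_dom v s ->
  hl_h v (a *: p + r) s = a * hl_h v p s + hl_h v r s.
Proof.
move=> dp dr ds; rewrite -Rint_comb//; [|exact: hl_dom_hmul..].
apply: eq_Rint => t _; rewrite -[(_ + _).1 t]/(a * p.1 t + r.1 t).
by rewrite -[(_ + _).2 t]/(a * p.2 t + r.2 t); ring.
Qed.

Lemma hl_bE p : hl_b p p = sqA p.
Proof. by apply: eq_Rint => t _; rewrite expr2. Qed.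

Lemma hl_hE p : hl_dom v p -> hl_h v p p = sqG p + sqP p - sqM p.
Proof.
move=> dp; have [_ [_ i2] i3 _] := dp.
rewrite -RintegralD//; rewrite -RintegralB//.
- by apply: eq_Rint => t _; rewrite [v t]funrposneg; ring.
- exact: rintegrableD.
- exact: hl_dom_neg.
Qed.

Lemma hl_qE p : hl_dom v p -> hl_q v p p = sqG p + sqA p + sqP p.
Proof.
move=> dp; have [[_ i1] [_ i2] i3 _] := dp.
rewrite -!RintegralD//; last exact: rintegrableD.
by apply: eq_Rint => t _; ring.
Qed.

Lemma sqM_split d w p : 0 < d -> measurable_fun edge w ->
  (forall t, 0 <= w t) -> rintegrable mu edge w -> (forall t, v^\- t <= d + w t) ->
  hl_dom v p -> rintegrable mu edge (fun t => w t * p.1 t ^+ 2) /\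
  sqM p <= d * sqA p + \int[mu]_(t in edge) (w t * p.1 t ^+ 2).
Proof.
move=> d0 mw w0 iw vw dp; have [[m1 i1] _ _ _] := dp.
have iw2 : rintegrable mu edge (fun t => w t * p.1 t ^+ 2).
  apply: (@wsqr_integrable _ _ (2 / 1 * sqA p + 2 * 1 * sqG p)) => // t Et.
  exact: hl_dom_sup.
split => //; rewrite -RintegralZl// -RintegralD//; last exact: rintegrableZ.
apply: le_Rintegral => //.
- exact: hl_dom_neg.
- by apply: rintegrableD => //; exact: rintegrableZ.
- by move=> t _; rewrite -mulrDl; apply: ler_wpM2r; [exact: sqr_ge0|exact: vw].
Qed.

(** The negative part is form-bounded with arbitrarily small relative bound:
    its integrable part is estimated by the Sobolev bound at a small scale. *)
Lemma sqM_bounded d : 0 < d -> exists2 K, 0 <= K & forall p, hl_dom v p ->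
  sqM p <= d * sqG p + K * sqA p.
Proof.
move=> d0; have [w [mw w0 iw vw]] := neg_split ltr01.
pose I := \int[mu]_(t in edge) w t.
have I0 : 0 <= I by apply: Rintegral_ge0.
pose s := d / (2 * (I + 1)).
have s0 : 0 < s by rewrite divr_gt0// mulr_gt0// ltr_wpDl.
exists (1 + 2 / s * I).
  by rewrite addr_ge0// mulr_ge0// divr_ge0// ltW.
move=> p dp; have [_ H] := sqM_split ltr01 mw w0 iw vw dp.
apply: le_trans H _.
have := @wsqr_le w p (2 / s * sqA p + 2 * s * sqG p) mw _ iw _ _ => H.
have {}H : \int[mu]_(t in edge) (w t * p.1 t ^+ 2) <= (2 / s * sqA p + 2 * s * sqG p) * I.
  apply: H => //; first exact: hl_dom_measurable.
  by move=> t Et; exact: hl_dom_sup.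
have sI : 2 * s * I <= d.
  rewrite /s; have -> : 2 * (d / (2 * (I + 1))) * I = d * (I / (I + 1)).
    by field; rewrite gt_eqF// ltr_wpDl.
  by rewrite ger_pMr// ler_pdivrMr ?ltr_wpDl// mul1r lerDl.
apply: le_trans (lerD (lexx _) H) _.
have -> : (2 / s * sqA p + 2 * s * sqG p) * I = 2 / s * I * sqA p + 2 * s * I * sqG p.
  by ring.
have := ler_wpM2r (sqG_ge0 p) sI; lra.
Qed.

(** The negative part is small relative to the [H^1] norm up to finitely many
    point evaluations.  Beyond a point [a] the integrable part [w] of [v^\-] has
    little mass; on [[0, a]] the square of the function is bounded by its values
    on a grid of mesh [s] plus [s] times the energy. *)
Lemma sqM_compact d : 0 < d -> exists m (y : 'I_m -> R) (C : R),
  [/\ 0 <= C, forall i, 0 <= y i & forall p, hl_dom v p ->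
  sqM p <= d * (sqG p + sqA p) + C * \sum_i p.1 (y i) ^+ 2].
Proof.
move=> d0; have d2 : 0 < d / 2 by rewrite divr_gt0.
have [w [mw w0 iw vw]] := neg_split d2.
pose I := \int[mu]_(t in edge) w t.
have I0 : 0 <= I by apply: Rintegral_ge0.
have d8 : 0 < d / 8 by rewrite divr_gt0.
have [a a0 aP] := hl_tail (fun t _ => w0 t) iw d8.
pose s := d / (8 * (I + 1)).
have s0 : 0 < s by rewrite divr_gt0// mulr_gt0// ltr_wpDl.
have sI : 2 * s * I <= d / 4.
  rewrite /s; have -> : 2 * (d / (8 * (I + 1))) * I = d / 4 * (I / (I + 1)).
    by field; rewrite gt_eqF// ltr_wpDl.
  by rewrite ger_pMr ?divr_gt0// ler_pdivrMr ?ltr_wpDl// mul1r lerDl.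
pose m := (Num.truncn (a / s)).+1.
pose y (i : 'I_m) : R := i%:R * s.
exists m, y, (2 * I); split; first by rewrite mulr_ge0.
  by move=> i; rewrite mulr_ge0// ltW.
move=> p dp; have [iw2 H] := sqM_split d2 mw w0 iw vw dp.
apply: le_trans H _.
have near x : 0 <= x -> x < a ->
    p.1 x ^+ 2 <= 2 * \sum_i p.1 (y i) ^+ 2 + 2 * s * sqG p.
  move=> x0 xa; have xs0 : 0 <= x / s by rewrite divr_ge0// ltW.
  have /andP[t1 t2] := truncn_itv xs0.
  have im : (Num.truncn (x / s) < m)%N.
    rewrite ltnS; apply: le_truncn; rewrite ler_pM2r ?invr_gt0//.
    exact: ltW.
  have [_ q2 _ pE] := dp; pose i := Ordinal im.
  have yx : y i <= x by rewrite /y -ler_pdivlMr.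
  have y0 : 0 <= y i by rewrite mulr_ge0// ltW.
  have xy : x - y i <= s.
    rewrite lerBlDl /y -{2}[s]mul1r -mulrDl -ler_pdivrMr// -[1]/(1%:R) -natrD addn1.
    exact: ltW.
  apply: le_trans (pair_near_sqr q2 pE y0 yx) _; apply: lerD.
    apply: ler_wpM2l => //; rewrite (bigD1 i)//= lerDl; apply: sumr_ge0 => j _.
    exact: sqr_ge0.
  by apply: ler_wpM2r; [exact: sqG_ge0|rewrite ler_wpM2l].
have edgeU : edge = `[0, a[%classic `|` `[a, +oo[%classic.
  by rewrite /Defs.edge -itv_bndbnd_setU// bnd_simp ltW.
have sub1 : `[0, a[%classic `<=` edge by exact: sub_itv_edge.
have sub2 : `[a, +oo[%classic `<=` edge by apply: sub_itv_edge_pinfty; exact: ltW.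
have m1 : measurable (`[0, a[%classic : set R) by exact: measurable_itv.
have m2 : measurable (`[a, +oo[%classic : set R) by exact: measurable_itv.
have -> : \int[mu]_(t in edge) (w t * p.1 t ^+ 2) =
    \int[mu]_(t in `[0, a[) (w t * p.1 t ^+ 2) +
    \int[mu]_(t in `[a, +oo[) (w t * p.1 t ^+ 2).
  rewrite {1}edgeU Rintegral_setU//; first by rewrite -edgeU.
  apply/disj_setPS => x [/=]; rewrite !in_itv/= andbT => /andP[_ xn].
  by rewrite leNgt xn.
set S := \sum_i _ in near *.
have S0 : 0 <= S by apply: sumr_ge0 => i _; exact: sqr_ge0.
have H1 : \int[mu]_(t in `[0, a[) (w t * p.1 t ^+ 2) <= (2 * S + 2 * s * sqG p) * I.
  apply: (@le_trans _ _ (\int[mu]_(t in `[0, a[) ((2 * S + 2 * s * sqG p) * w t))).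
    apply: le_Rintegral => //.
    - exact: integrableS iw2.
    - by apply: rintegrableZ => //; exact: integrableS iw.
    - move=> t /=; rewrite in_itv/= => /andP[t0 ta]; rewrite mulrC.
      by apply: ler_wpM2r; [exact: w0|exact: near].
  rewrite RintegralZl//; last exact: integrableS iw.
  apply: ler_wpM2l; last by apply: Rint_subset => // t _; exact: w0.
  apply: addr_ge0; first by rewrite mulr_ge0.
  by apply: mulr_ge0; [rewrite mulr_ge0// ltW|exact: sqG_ge0].
have H2 : \int[mu]_(t in `[a, +oo[) (w t * p.1 t ^+ 2) <=
    (2 * sqA p + 2 * sqG p) * (d / 8).
  apply: (@le_trans _ _ (\int[mu]_(t in `[a, +oo[) ((2 * sqA p + 2 * sqG p) * w t))).
    apply: le_Rintegral => //.
    - exact: integrableS iw2.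
    - by apply: rintegrableZ => //; exact: integrableS iw.
    - move=> t /sub2 Et; rewrite mulrC; apply: ler_wpM2r; first exact: w0.
      by have := hl_dom_sup dp ltr01 Et; rewrite divr1 mulr1.
  rewrite RintegralZl//; last exact: integrableS iw.
  by apply: ler_wpM2l => //; rewrite addr_ge0// !mulr_ge0 ?sqG_ge0 ?sqA_ge0.
have := ler_wpM2r (sqG_ge0 p) sI; have := sqA_ge0 p; have := sqG_ge0 p; nra.
Qed.

End potential.
End half_line_forms.

(** * Completeness of the form domain *)

Lemma cvgn_geometric {R : realType} (a : nat -> R) (C z : R) : `|z| < 1 ->
  (forall k, `|a k.+1 - a k| <= C * z ^+ k) -> cvgn a.
Proof.
move=> z1 az.
have : cvgn (series (telescope a)).
  apply: normed_cvg.
  apply: (@series_le_cvg _ _ (geometric C z)) => //.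
  - by move=> n; exact: normr_ge0.
  - by move=> n; exact: le_trans (normr_ge0 _) (az n).
  - exact: is_cvg_geometric_series.
rewrite telescopeK => /cvg_ex[l al]; apply/cvg_ex; exists (l + a 0%N).
have aE : (fun n => (a n - a 0%N) + a 0%N) = a by apply/funext => n; rewrite subrK.
rewrite -[X in X @ _]aE.
by apply: cvgD => //; exact: cvg_cst.
Qed.

Lemma limn_einf_le {R : realType} (a : nat -> \bar R) c k :
  (forall n, (k <= n)%N -> (a n <= c)%E) -> (limn_einf a <= c)%E.
Proof.
move=> ac; rewrite limn_einf_lim; apply: lime_le; first exact: is_cvg_einfs.
apply: nearW => n; apply: le_trans (ac (maxn n k) _); last exact: leq_maxr.
by apply: ereal_inf_lbound; exists (maxn n k) => //=; exact: leq_maxl.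
Qed.

Section fast_cauchy.
Context d (T : measurableType d) (R : realType) (mu : {measure set T -> \bar R}).
Variables (D : set T) (mD : measurable D) (g : nat -> T -> R) (C : R).
Hypothesis mg : forall k, measurable_fun D (g k).
Hypothesis C0 : 0 <= C.
Hypothesis gC : forall k,
  (\int[mu]_(x in D) ((g k.+1 x - g k x) ^+ 2)%:E <= (C * geo4 k)%:E)%E.

Let f k x : \bar R := ((16 / 9) ^+ k * (g k.+1 x - g k x) ^+ 2)%:E.

Let f0 k x : (0 <= f k x)%E.
Proof. by rewrite lee_fin mulr_ge0 ?sqr_ge0// exprn_ge0// divr_ge0. Qed.

Let mf k : measurable_fun D (f k).
Proof.
apply/measurable_EFinP; apply: measurable_funM => //.
by apply: measurable_funX; exact: measurable_funB.
Qed.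

Let S x := (\sum_(n <oo) f n x)%E.

Let S_integrable : mu.-integrable D S.
Proof.
have S0 x : (0 <= S x)%E by apply: nneseries_ge0 => n _ _; exact: f0.
apply/integrableP; split; first by apply: ge0_emeasurable_sum => // k x _ _; exact: f0.
rewrite (eq_integral S); last by move=> x _; rewrite gee0_abs.
rewrite integral_nneseries//.
apply: (@le_lt_trans _ _ ((C * (9 / 5))%:E)); last by rewrite ltry.
apply: lime_le; first by apply: is_cvg_nneseries => n _ _; exact: integral_ge0.
apply: nearW => n; rewrite big_mkord.
apply: (@le_trans _ _ (\sum_(i < n) (C * (4 / 9) ^+ i)%:E)%E).
  apply: lee_sum => i _; rewrite /f; under eq_integral do rewrite EFinM.
  rewrite ge0_integralZl//=.
  - apply: le_trans (_ : (((16 / 9) ^+ i)%:E * (C * geo4 i)%:E)%E <= _)%E.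
      apply: lee_wpmul2l; last exact: gC.
      by rewrite lee_fin exprn_ge0// divr_ge0.
    rewrite -EFinM lee_fin /geo4 mulrCA -exprMn.
    have -> : 16 / 9 * 4^-1 = 4 / 9 :> R by field.
    by [].
  - apply/measurable_EFinP; apply: measurable_funX; exact: measurable_funB.
  - by move=> x _; rewrite lee_fin sqr_ge0.
rewrite sumEFin lee_fin -mulr_sumr; apply: ler_wpM2l => //.
have -> : \sum_(i < n) (4 / 9) ^+ i = 9 / 5 - 9 / 5 * (4 / 9) ^+ n :> R.
  elim: n => [|n IH]; first by rewrite big_ord0 expr0 mulr1 subrr.
  by rewrite big_ord_recr/= IH exprS; field.
by rewrite lerBlDr lerDl mulr_ge0 ?exprn_ge0// divr_ge0.
Qed.

(** A sequence whose increments have squared [L2] norm of order [4^-k] converges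
    almost everywhere.  The increments are weighted by [(16/9)^k]: the weighted
    sum still has finite integral, as [16/9 * 1/4 < 1], and where it is finite
    the increments decay like [(3/4)^k]. *)
Lemma fast_cauchy_cvg_ae : exists A : set T, [/\ measurable A, mu A = 0 &
  forall x, D x -> ~ A x -> cvgn (g ^~ x)].
Proof.
have [A [mA muA HA]] := integrable_ae mD S_integrable.
exists A; split => // x Dx Ax.
have Sx : S x \is a fin_num.
  by apply: contrapT => Sx; apply/Ax/HA => /= /(_ Dx).
have fS k : (16 / 9) ^+ k * (g k.+1 x - g k x) ^+ 2 <= fine (S x).
  rewrite -lee_fin fineK//; apply: le_trans (@nneseries_lim_ge _ (fun n => f n x) xpredT 0%N k.+1 _) => //.
  rewrite big_mkord big_ord_recr/= leeDr//; apply: sume_ge0 => i _; exact: f0.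
have s0 : 0 <= fine (S x).
  by apply: le_trans (fS 0%N); rewrite mulr_ge0 ?sqr_ge0.
set s := fine (S x) in fS s0.
apply: (@cvgn_geometric _ _ (s + 1) (3 / 4)); first by rewrite ger0_norm; lra.
move=> k; have e34 : 0 <= (3 / 4) ^+ k :> R by rewrite exprn_ge0// divr_ge0.
rewrite -ler_sqr ?nnegrE ?mulr_ge0 ?addr_ge0//.
rewrite real_normK ?num_real// exprMn.
have e0 : 0 < (16 / 9) ^+ k :> R by rewrite exprn_gt0// divr_gt0.
rewrite -(ler_pM2l e0); apply: le_trans (fS k) _.
have -> : (16 / 9) ^+ k * ((s + 1) ^+ 2 * ((3 / 4) ^+ k) ^+ 2) = (s + 1) ^+ 2.
  rewrite mulrCA -[X in _ * (_ * X)]exprM mulnC exprM -exprMn.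
  have -> : 16 / 9 * (3 / 4) ^+ 2 = 1 :> R by field.
  by rewrite expr1n mulr1.
by rewrite sqrrD1; have := sqr_ge0 s; lra.
Qed.

End fast_cauchy.

Lemma cvgn_le {R : realType} (a : nat -> R) (l c : R) k :
  a @ \oo --> l -> (forall n, (k <= n)%N -> a n <= c) -> l <= c.
Proof.
move=> al ac; rewrite -(cvg_lim _ al)//; apply: limr_le.
  by apply/cvg_ex; exists l.
by exists k => // n /= kn; exact: ac.
Qed.

Section completeness.
Context {R : realType}.
Notation mu := (@lebesgue_measure R).
Notation edge := (edge R).
Notation fpair := ((R -> R) * (R -> R))%type.
Implicit Types (p r : fpair) (x y s : R).

Variable v : R -> R.
Hypothesis hv : hl_pot v.

(** The integrand of the squared form norm. *)
Definition qd p t := p.2 t ^+ 2 + p.1 t ^+ 2 + v^\+ t * p.1 t ^+ 2.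

Lemma qd_ge0 p t : 0 <= qd p t.
Proof. by rewrite /qd !addr_ge0 ?sqr_ge0// mulr_ge0 ?sqr_ge0. Qed.

Lemma hl_q_qd p : hl_q v p p = \int[mu]_(t in edge) qd p t.
Proof. by apply: eq_Rint => t _; rewrite /qd; ring. Qed.

Lemma qd_integrable p : hl_dom v p -> rintegrable mu edge (qd p).
Proof.
move=> dp; apply: rintegrable_eq (hl_dom_qmul hv dp dp) => // t _.
by rewrite /qd; ring.
Qed.

Lemma hl_sup_q p x : hl_dom v p -> 0 <= x -> p.1 x ^+ 2 <= 2 * hl_q v p p.
Proof.
move=> dp x0; rewrite (hl_qE dp); apply: le_trans (hl_dom_sup dp ltr01 _) _.
  by rewrite edgeE.
by have := sqP_ge0 v p; rewrite divr1 mulr1; lra.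
Qed.

Variable u : nat -> fpair.
Hypothesis du : forall k, hl_dom v (u k).
Hypothesis cu : forall k m, (k <= m)%N -> hl_q v (u m - u k) (u m - u k) <= geo4 k.

Let dB p r : hl_dom v p -> hl_dom v r -> hl_dom v (p - r).
Proof. by move=> dp dr; rewrite -scaleN1r addrC; exact: hl_dom_comb. Qed.

Let u_sup k m x : 0 <= x -> (k <= m)%N ->
  ((u m).1 x - (u k).1 x) ^+ 2 <= 2 * geo4 k.
Proof.
move=> x0 km; apply: le_trans (hl_sup_q (dB (du m) (du k)) x0) _.
by rewrite ler_pM2l// cu.
Qed.

Let u_cvg x : 0 <= x -> cvgn (fun k => (u k).1 x).
Proof.
move=> x0; apply: (@cvgn_geometric _ _ 2 (1 / 2)); first by rewrite ger0_norm; lra.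
move=> k; have e0 : 0 <= (1 / 2) ^+ k :> R by rewrite exprn_ge0// divr_ge0.
rewrite -ler_sqr ?nnegrE ?mulr_ge0// real_normK ?num_real//.
apply: le_trans (u_sup x0 (leqnSn k)) _.
rewrite exprMn -exprM mulnC exprM.
have -> : (1 / 2) ^+ 2 = 4^-1 :> R by field.
by apply: ler_wpM2r; [exact/ltW/geo4_gt0|lra].
Qed.

Let U x := limn (fun k => (u k).1 x).

Let U_cvg x : 0 <= x -> (u k).1 x @[k --> \oo] --> U x.
Proof. by move=> x0; exact: u_cvg. Qed.

Let U_near k x : 0 <= x -> ((u k).1 x - U x) ^+ 2 <= 2 * geo4 k.
Proof.
move=> x0; apply: (@cvgn_le _ (fun m => ((u k).1 x - (u m).1 x) ^+ 2) _ _ k).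
  apply: (@cvgM _ _ _ _ (fun m => (u k).1 x - (u m).1 x) (fun m => (u k).1 x - (u m).1 x)).
    by apply: cvgB; [exact: cvg_cst|exact: U_cvg].
  by apply: cvgB; [exact: cvg_cst|exact: U_cvg].
by move=> n kn; rewrite -sqrrN opprB; exact: u_sup.
Qed.

(** The functions converge pointwise by the Sobolev bound and the derivatives
    almost everywhere by [fast_cauchy_cvg_ae].  Fatou's lemma gives the distance
    to the limit, and the integral formula between function and derivative
    passes to the limit because each of its terms is continuous in the form
    norm. *)
Lemma hl_complete : exists r, [/\ hl_dom v r,
  forall k, hl_q v (u k - r) (u k - r) <= geo4 k &
  forall x, 0 <= x -> (u k).1 x @[k --> \oo] --> r.1 x].
Proof.
have mg k : measurable_fun edge (u k).2 by case: (du k) => _ [].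
have mu1 k : measurable_fun edge (u k).1 by case: (du k) => -[].
have mv : measurable_fun edge v by case: hv.
have [A [mA muA cvA]] : exists A : set R, [/\ @measurable _ (measurableTypeR R) A, mu A = 0 &
    forall x, edge x -> ~ A x -> cvgn (fun k => (u k).2 x)].
  apply: (@fast_cauchy_cvg_ae _ (measurableTypeR R) R mu edge _ (fun k => (u k).2) 1) => //.
  move=> k; rewrite mul1r; have dd := dB (du k.+1) (du k).
  have [_ [_ i2] _ _] := dd; rewrite rintegrableE// lee_fin.
  apply: le_trans (cu (leqnSn k)); rewrite hl_q_qd; apply: le_Rintegral => //.
    exact: qd_integrable.
  by move=> t _; rewrite /qd -addrA lerDl addr_ge0 ?sqr_ge0// mulr_ge0// sqr_ge0.
pose E' := edge `\` A.
have mE' : @measurable _ (measurableTypeR R) E' by apply: measurableD.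
have subE' : E' `<=` edge by move=> x [].
pose G := (fun x => limn (fun k => (u k).2 x)) \_ E'.
have G_cvg x : E' x -> (u k).2 x @[k --> \oo] --> G x.
  by move=> [Ex Ax]; rewrite /G patchE mem_set//; exact: cvA.
have mG : measurable_fun edge G.
  apply: (@measurable_fun_cvg _ _ _ _ (fun k => (u k).2 \_ E')).
    move=> k; apply/measurable_restrict => //.
    by apply: measurable_funS (mg k) => //; move=> x [].
  move=> x Ex; have [Ax|Ax] := pselect (A x).
    have nE : x \notin E' by apply/negP; rewrite inE => -[].
    rewrite /G patchE (negbTE nE); apply: cvg_near_cst; apply: nearW => k.
    by rewrite patchE (negbTE nE).
  have E'x : E' x by [].
  rewrite (_ : (fun k => _) = (fun k => (u k).2 x)); first exact: G_cvg.
  by apply/funext => k; rewrite patchE mem_set.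
have mU : measurable_fun edge U.
  apply: (measurable_fun_cvg mu1) => x; rewrite edgeE; exact: U_cvg.
pose r : fpair := (U, G).
have mqd p : measurable_fun edge p.1 -> measurable_fun edge p.2 -> measurable_fun edge (qd p).
  move=> m1 m2; apply: measurable_funD.
    by apply: measurable_funD; exact: measurable_funX.
  by apply: measurable_funM; [exact: measurable_funrpos|exact: measurable_funX].
have mB k : measurable_fun edge (qd (u k - r)).
  by apply: mqd; exact: measurable_funB.
have qr k : (\int[mu]_(t in edge) (qd (u k - r) t)%:E <= (geo4 k)%:E)%E.
  rewrite (@ge0_negligible_integral _ (measurableTypeR R) R mu edge A (fun t => (qd (u k - r) t)%:E))//; last 2 first.
  - by apply/measurable_EFinP; exact: mB.
  - by move=> t _; rewrite lee_fin qd_ge0.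
  have := @fatou _ _ _ mu E' mE' (fun n t => (qd (u k - u n) t)%:E) _ _.
  rewrite (@eq_integral _ _ _ mu E' (fun t => (qd (u k - r) t)%:E)); last first.
    move=> t /set_mem E't; apply: (cvg_limn_einf_sup _).1.
    apply: cvg_EFin; first exact: nearW.
    have t0 : 0 <= t by have := subE' _ E't; rewrite edgeE.
    have c1 : (u k - u n).1 t @[n --> \oo] --> (u k - r).1 t.
      by apply: cvgB; [exact: cvg_cst|exact: U_cvg].
    have c2 : (u k - u n).2 t @[n --> \oo] --> (u k - r).2 t.
      by apply: cvgB; [exact: cvg_cst|exact: G_cvg].
    apply: cvgD; [apply: cvgD|apply: cvgM; [exact: cvg_cst|]].
    - exact: (cvgM c2 c2).
    - exact: (cvgM c1 c1).
    - exact: (cvgM c1 c1).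
  move=> H; apply: le_trans (H _ _) _.
  - move=> n; apply/measurable_EFinP; apply: measurable_funS (mqd _ _ _) => //.
      exact: measurable_funB.
    exact: measurable_funB.
  - by move=> n t _; rewrite lee_fin qd_ge0.
  apply: (@limn_einf_le _ _ _ k) => n kn.
  have dkn := dB (du k) (du n).
  apply: (@le_trans _ _ (\int[mu]_(t in edge) (qd (u k - u n) t)%:E)%E).
    apply: ge0_subset_integral => //.
    - by apply/measurable_EFinP; apply: rintegrable_measurable (qd_integrable dkn).
    - by move=> t _; rewrite lee_fin qd_ge0.
  rewrite rintegrableE//; last exact: qd_integrable.
  rewrite -hl_q_qd lee_fin; apply: le_trans (cu kn).
  rewrite !hl_q_qd le_eqVlt; apply/orP; left; apply/eqP; apply: eq_Rint => t _.
  rewrite /qd -[(u k - u n).1 t]/((u k).1 t - (u n).1 t).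
  rewrite -[(u k - u n).2 t]/((u k).2 t - (u n).2 t).
  rewrite -[(u n - u k).1 t]/((u n).1 t - (u k).1 t).
  by rewrite -[(u n - u k).2 t]/((u n).2 t - (u k).2 t); ring.
have iqd k : rintegrable mu edge (qd (u k - r)).
  apply: (rintegrable_ge0P mu (mB k) (fun t _ => qd_ge0 _ t)).2.
  by apply: le_lt_trans (qr k) _; rewrite ltry.
have sqd k : sqint mu edge (u k - r).1 /\ sqint mu edge (u k - r).2 /\
    rintegrable mu edge (fun t => v^\+ t * (u k - r).1 t ^+ 2).
  have m1 : measurable_fun edge (u k - r).1 by exact: measurable_funB.
  have m2 : measurable_fun edge (u k - r).2 by exact: measurable_funB.
  split; [split=> //|split; [split=> //|]].
  - apply: (rintegrable_le _ _ _ (iqd k)) => //; first exact: measurable_funX.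
    move=> t _; rewrite ger0_norm ?sqr_ge0// /qd addrAC lerDr addr_ge0 ?sqr_ge0//.
    by rewrite mulr_ge0// sqr_ge0.
  - apply: (rintegrable_le _ _ _ (iqd k)) => //; first exact: measurable_funX.
    move=> t _; rewrite ger0_norm ?sqr_ge0// /qd -addrA lerDl addr_ge0 ?sqr_ge0//.
    by rewrite mulr_ge0// sqr_ge0.
  - apply: (rintegrable_le _ _ _ (iqd k)) => //.
      by apply: measurable_funM; [exact: measurable_funrpos|exact: measurable_funX].
    move=> t _; rewrite ger0_norm; last by rewrite mulr_ge0// sqr_ge0.
    by rewrite /qd lerDr addr_ge0 ?sqr_ge0.
have rE1 : r.1 = (fun t => -1 * (u 0%N - r).1 t + (u 0%N).1 t).
  by apply/funext => t; rewrite -[(u 0%N - r).1 t]/((u 0%N).1 t - r.1 t); ring.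
have rE2 : r.2 = (fun t => -1 * (u 0%N - r).2 t + (u 0%N).2 t).
  by apply/funext => t; rewrite -[(u 0%N - r).2 t]/((u 0%N).2 t - r.2 t); ring.
have [s1 [s2 s3]] := sqd 0%N; have [d1 d2 d3 _] := du 0%N.
have r2 : sqint mu edge r.2 by rewrite rE2; exact: sqint_comb.
have dr : hl_dom v r.
  split => //.
  - by rewrite rE1; exact: sqint_comb.
  - rewrite rE1; apply: rintegrable_wsqr_comb => //.
    + exact: measurable_funrpos.
    + by case: s1.
    + exact: mu1.
  - move=> x x0 /=; apply/eqP; rewrite -subr_eq0 -sqrf_eq0 eq_le sqr_ge0 andbT.
  apply: (@le_geo4_le0 _ _ (3 * (4 + x))) => k.
  have [_ _ _ ukE] := du k.
  (* the defect of the limit is split into three terms that tend to 0 *)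
  have Ik : ((u k).1 x - (u k).1 0) - \int[mu]_(t in `[0, x]) G t =
      \int[mu]_(t in `[0, x]) (u k - r).2 t.
    rewrite ukE// [X in X - _]addrC addKr RintegralB//.
    - by apply: deriv_integrable => //; case: (du k).
    - exact: deriv_integrable r2 _ _ _ _ (lexx 0).
  have I2 : (\int[mu]_(t in `[0, x]) (u k - r).2 t) ^+ 2 <= x * geo4 k.
    have sx : sqint mu `[0, x]%classic (u k - r).2.
      by apply: sqint_subset => //; [exact: sub_itv_edge|case: (sqd k) => _ []].
    have := sqr_Rintegral_le _ (itv_lty _ _ _ _) sx => H.
    apply: le_trans (H _) _ => //.
    rewrite [X in X * _](mu_itv _ _ x0) subr0; apply: ler_wpM2l => //.
    apply: (@le_trans _ _ (\int[mu]_(t in edge) qd (u k - r) t)); last first.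
      by rewrite -lee_fin -rintegrableE.
    apply: (@le_trans _ _ (\int[mu]_(t in edge) ((u k - r).2 t ^+ 2))).
      apply: Rint_subset => //; [exact: sub_itv_edge|by move=> t _; exact: sqr_ge0|].
      by case: (sqd k) => _ [[]].
    apply: le_Rintegral => //; [by case: (sqd k) => _ [[]]|exact: iqd|].
    by move=> t _; rewrite /qd -addrA lerDl addr_ge0 ?sqr_ge0// mulr_ge0// sqr_ge0.
  have H1 := U_near k x0; have H0 := U_near k (lexx 0).
  rewrite -Ik in I2; move: I2 H1 H0.
  set a := (u k).1 x; set b := (u k).1 0; set J := \int[mu]_(_ in _) _.
  set Ux := U x; set U0 := U 0; set e := geo4 k => I2 H1 H0.
  have -> : (Ux - (U0 + J)) ^+ 2 = ((a - b - J) + (b - U0) - (a - Ux)) ^+ 2 by ring.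
  have : ((a - b - J) + (b - U0) - (a - Ux)) ^+ 2 <=
    3 * ((a - b - J) ^+ 2 + (b - U0) ^+ 2 + (a - Ux) ^+ 2).
    set X := a - b - J; set Y := b - U0; set Z := a - Ux.
    rewrite -subr_ge0.
    have -> : 3 * (X ^+ 2 + Y ^+ 2 + Z ^+ 2) - (X + Y - Z) ^+ 2 =
      (X - Y) ^+ 2 + (X + Z) ^+ 2 + (Y + Z) ^+ 2 by ring.
    by rewrite !addr_ge0 ?sqr_ge0.
  by lra.
exists r; split => //.
by move=> k; rewrite hl_q_qd -lee_fin -rintegrableE.
Qed.

End completeness.

(** * The form domain on a star *)

Definition starpairs (R : realType) (N : nat) := 'I_N -> (R -> R) * (R -> R).
HB.instance Definition _ R N := GRing.Lmodule.on (@starpairs R N).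

Record starpot (R : realType) (N : nat) := StarPot {
  starpot_fun :> 'I_N -> R -> R;
  starpotP : forall j, hl_pot (starpot_fun j) }.

Section star_space.
Context {R : realType} {N : nat}.
Variables (V : starpot R N) (dir : bool).

Definition star_dom (psi : starpairs R N) : Prop :=
  [/\ forall j, hl_dom (V j) (psi j),
      forall j k, (psi j).1 0 = (psi k).1 0 &
      dir -> forall j, (psi j).1 0 = 0].

Definition star_pred : {pred starpairs R N} := fun psi => `[< star_dom psi >].

Lemma star_submod_closed : submod_closed star_pred.
Proof.
split.
  apply/asboolP; split => // j; exact: hl_dom0.
move=> a psi phi /asboolP[p1 p2 p3] /asboolP[q1 q2 q3]; apply/asboolP; split.
- by move=> j; apply: hl_dom_comb => //; exact: starpotP.
- move=> j k; rewrite -[LHS]/(a * (psi j).1 0 + (phi j).1 0).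
  by rewrite -[RHS]/(a * (psi k).1 0 + (phi k).1 0) (p2 j k) (q2 j k).
- move=> dT j; rewrite -[LHS]/(a * (psi j).1 0 + (phi j).1 0).
  by rewrite p3// q3// mulr0 addr0.
Qed.

HB.instance Definition _ :=
  GRing.isSubmodClosed.Build R (starpairs R N) star_pred star_submod_closed.

(** The form domain as a vector space.  The flag [dir] imposes the Dirichlet
    condition at the vertex; without it one has the continuity (Kirchhoff)
    condition of the star.  For a single edge this is the Dirichlet and the
    Neumann operator on the half-line. *)
Record starspace := StarSpace {
  starspace_val : starpairs R N; starspace_valP : star_pred starspace_val}.

HB.instance Definition _ := [isSub for starspace_val].
HB.instance Definition _ := [Choice of starspace by <:].
HB.instance Definition _ := [SubChoice_isSubLmodule of starspace by <:].

Definition mkstar psi (h : star_dom psi) : starspace := StarSpace (asboolT h).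

Lemma star_valP (u : starspace) : star_dom (val u).
Proof. exact/asboolP/(starspace_valP u). Qed.

Lemma star_val_comb (a : R) (u v : starspace) :
  val (a *: u + v) = a *: val u + val v.
Proof. by []. Qed.

Definition star_b (u v : starspace) := \sum_j hl_b (val u j) (val v j).
Definition star_h (u v : starspace) := \sum_j hl_h (V j) (val u j) (val v j).
Definition star_q (u v : starspace) := \sum_j hl_q (V j) (val u j) (val v j).

Lemma star_hl_dom (u : starspace) j : hl_dom (V j) (val u j).
Proof. by case: (star_valP u). Qed.

Lemma symform_star_b : symform star_b.
Proof.
split=> [u v|a u v w]; first by apply: eq_bigr => j _; exact: hl_bC.
rewrite /star_b mulr_sumr -big_split; apply: eq_bigr => j _ /=.
exact: (hl_b_comb a (star_hl_dom u j) (star_hl_dom v j) (star_hl_dom w j)).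
Qed.

Lemma symform_star_h : symform star_h.
Proof.
split=> [u v|a u v w]; first by apply: eq_bigr => j _; exact: hl_hC.
rewrite /star_h mulr_sumr -big_split; apply: eq_bigr => j _ /=.
exact: (hl_h_comb (starpotP V j) a (star_hl_dom u j) (star_hl_dom v j) (star_hl_dom w j)).
Qed.

Lemma star_b_ge0 u : 0 <= star_b u u.
Proof. by apply: sumr_ge0 => j _; rewrite hl_bE sqA_ge0. Qed.

End star_space.

Local Notation star_eigvec V dir := (eigvec (@star_b _ _ V dir) (@star_h _ _ V dir)).
Local Notation star_eigsys V dir := (eigsys (@star_b _ _ V dir) (@star_h _ _ V dir)).
Local Notation star_trace V dir := (eigtrace (@star_b _ _ V dir) (@star_h _ _ V dir)).

Section half_line_good.
Context {R : realType}.
Variables (V : starpot R 1) (dir : bool).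
Let v := V ord0.
Let hv : hl_pot v := starpotP V ord0.
Notation E := (starspace V dir).

Let dom (u : E) : hl_dom v (val u ord0). Proof. exact: star_hl_dom. Qed.

(** The functionals of [gf_coer] are the point evaluations of [sqM_compact],
    with [d] small enough for the gain in [- mu * b] to absorb the loss.  The
    Dirichlet condition survives limits because point values do. *)
Lemma half_line_good_form :
  good_form (@star_b _ _ V dir) (@star_h _ _ V dir) (@star_q _ _ V dir).
Proof.
have bE (u : E) : star_b u u = sqA (val u ord0) by rewrite /star_b big_ord1 hl_bE.
have hE (u : E) : star_h u u = sqG (val u ord0) + sqP v (val u ord0) - sqM v (val u ord0).
  by rewrite /star_h big_ord1 (hl_hE hv).
have qE (u : E) : star_q u u = sqG (val u ord0) + sqA (val u ord0) + sqP v (val u ord0).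
  by rewrite /star_q big_ord1 (hl_qE (dom u)).
split.
- exact: symform_star_b.
- exact: symform_star_h.
- exact: star_b_ge0.
- by move=> u; rewrite bE qE; have := sqG_ge0 (val u ord0); have := sqP_ge0 v (val u ord0); lra.
- exists 1 => u; rewrite hE qE.
  by have := sqA_ge0 (val u ord0); have := sqM_ge0 v (val u ord0); lra.
- have h2 : 0 < 1 / 2 :> R by lra.
  have [K K0 KP] := sqM_bounded hv h2.
  exists (1 / 2), (K + 1 / 2); split => // u; rewrite hE bE qE.
  have := KP _ (dom u); have := sqP_ge0 v (val u ord0); lra.
- move=> mu mu0; pose d := Num.min (1 / 2) (- mu / 2).
  have d0 : 0 < d by rewrite lt_min !divr_gt0// oppr_gt0.
  have d1 : d <= 1 / 2 by rewrite ge_min lexx.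
  have d2 : d <= - mu / 2 by rewrite ge_min lexx orbT.
  have [m [y [C [C0 y0 CP]]]] := sqM_compact hv d0.
  exists d, (2 * C), m, (fun i (u : E) => Num.sqrt C * (val u ord0).1 (y i)); split => //.
  + move=> i u w; rewrite -mulrBr; congr (_ * _).
  + move=> i u; rewrite exprMn sqr_sqrtr// mulrAC mulrC [leRHS]mulrC.
    rewrite [leLHS]mulrC; apply: ler_wpM2l => //; rewrite mulrC.
    have := hl_sup_q (dom u) (y0 i); rewrite (hl_qE (dom u)) qE; lra.
  + move=> u; rewrite hE bE qE; have := CP _ (dom u).
    have -> : \sum_i (Num.sqrt C * (val u ord0).1 (y i)) ^+ 2 =
      C * \sum_i (val u ord0).1 (y i) ^+ 2.
      by rewrite mulr_sumr; apply: eq_bigr => i _; rewrite exprMn sqr_sqrtr.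
    have := sqP_ge0 v (val u ord0); have := sqG_ge0 (val u ord0).
    have := sqA_ge0 (val u ord0).
    set G := sqG _; set P := sqP _ _; set M := sqM _ _; set A := sqA _; set S := C * _.
    move=> A0 G0 P0 MS.
    have := ler_wpM2r A0 d2; have := ler_wpM2r G0 d1; have := ler_wpM2r P0 d1; lra.
- move=> u uc.
  have [k m km|r [dr rP r0]] := hl_complete hv (fun k => dom (u k)).
    by have := uc k m km; rewrite /star_q big_ord1.
  have rd : star_dom V dir (fun=> r).
    split=> [j|//|dT j]; first by rewrite ord1.
    have := r0 0 (lexx 0); rewrite (_ : (fun k => _) = fun=> 0).
      by move=> /(cvg_lim (@norm_hausdorff _ _)) <-; rewrite lim_cst.
    by apply/funext => k; have [_ _ ->] := star_valP (u k).
  exists (mkstar rd) => k; have := rP k.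
  by rewrite /star_q big_ord1.
Qed.

End half_line_good.

(** * From complex eigenfunctions to real eigenvectors *)

Section weak_derivative.
Context {R : realType}.
Notation mu := (@lebesgue_measure R).
Notation edge := (edge R).

Lemma ae_imply (P Q : R -> Prop) : (forall t, P t -> Q t) ->
  {ae mu, forall t, P t} -> {ae mu, forall t, Q t}.
Proof.
move=> PQ [A [mA A0 HA]]; exists A; split => // t nQ; apply: HA => /= /PQ.
exact: nQ.
Qed.

Lemma ae_imply2 (P1 P2 Q : R -> Prop) : (forall t, P1 t -> P2 t -> Q t) ->
  {ae mu, forall t, P1 t} -> {ae mu, forall t, P2 t} -> {ae mu, forall t, Q t}.
Proof.
move=> PQ ae1 ae2; have : mu.-negligible (~` P1 `|` ~` P2) by exact: negligibleU.
apply: negligibleS => t nQ /=; apply: contrapT => /not_orP[/contrapT p1 /contrapT p2].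
exact: nQ (PQ _ p1 p2).
Qed.

(** A function with vanishing primitive is null, by Lebesgue differentiation
    of its restrictions to bounded intervals. *)
Lemma Rintegral_primitive0_ae (f : R -> R) :
  (forall x, 0 <= x -> rintegrable mu `[0, x]%classic f) ->
  (forall x, 0 <= x -> \int[mu]_(t in `[0, x]) f t = 0) ->
  {ae mu, forall t, edge t -> f t = 0}.
Proof.
move=> fi f0.
have aen (n : nat) : {ae mu, forall t, edge t -> (f \_ `[0, n%:R]%classic) t = 0}.
  pose g := f \_ `[0, n%:R]%classic.
  have n0 : 0 <= n%:R :> R by [].
  have gi : rintegrable mu setT g.
    have /integrable_mkcond := fi _ n0.
    move=> /(_ (measurable_itv _)); rewrite /rintegrable /g.
    by rewrite -restrict_EFin.
  have gl : locally_integrable [set: R] g by apply: integrable_locally => //; exact: fi.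
  have gy y : mu.-integrable [set` Interval (BLeft 0) (BRight y)] (EFin \o g).
    exact: integrableS gi.
  have := FTC1 gy gl; rewrite /=.
  have -> : (fun x => \int[mu]_(t in [set` Interval (BLeft 0) (BRight x)]) g t) =
      fun=> 0.
    apply/funext => x; have [x0|x0] := leP 0 x; last first.
      by rewrite set_itv_ge ?Rintegral_set0// bnd_simp -ltNge.
    have [xn|nx] := leP x n%:R.
      rewrite -[RHS](f0 _ x0); apply: eq_Rint => t /=; rewrite in_itv/= => /andP[t0 tx].
      by rewrite /g patchE mem_set//= in_itv/= t0 (le_trans tx xn).
    rewrite -[RHS](f0 _ n0) /g -Rintegral_mkcondr; congr Rintegral.
    apply/seteqP; split=> t /=; rewrite !in_itv/=; first by case.
    by move=> /andP[-> tn]; split => //=; rewrite (le_trans tn (ltW nx)).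
  have ae_neq0 : {ae mu, forall t : R, t <> 0}.
    exists [set 0]; split => //; first exact: lebesgue_measure_set1.
    by move=> t /= /contrapT ->.
  apply: filterS2 ae_neq0; first exact: (ae_filter_ringOfSetsType mu).
  move=> t /eqP t0 + Et; rewrite edgeE in Et.
  move=> /(_ _)[]; first by rewrite lte_fin lt_neqAle eq_sym t0.
  by move=> _; rewrite -/g derive1_cst => <-.
have /ae_foralln : forall n, {ae mu, forall t, edge t -> (f \_ `[0, n%:R]%classic) t = 0}.
  exact: aen.
apply: filterS => t Ht Et; have := Ht (Num.truncn t).+1 Et.
rewrite patchE mem_set//= in_itv/=; rewrite edgeE in Et; rewrite Et/=.
by case/andP: (truncn_itv Et) => _ /ltW.
Qed.

End weak_derivative.

Section complex_half_line.
Local Open Scope complex_scope.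
Context {R : realType}.
Notation mu := (@lebesgue_measure R).
Notation edge := (edge R).
Implicit Types (u g : R -> R[i]) (f : R -> R).

Lemma Re_sum (I : finType) (F : I -> R[i]) :
  complex.Re (\sum_i F i) = \sum_i complex.Re (F i).
Proof. by apply: (big_morph _ _ (erefl _)) => -[a b] [c d]. Qed.

Lemma Im_sum (I : finType) (F : I -> R[i]) :
  complex.Im (\sum_i F i) = \sum_i complex.Im (F i).
Proof. by apply: (big_morph _ _ (erefl _)) => -[a b] [c d]. Qed.

Lemma eq_complexP (x y : R[i]) : complex.Re x = complex.Re y ->
  complex.Im x = complex.Im y -> x = y.
Proof. by case: x y => [a b] [c d] /= -> ->. Qed.

Lemma wsqabs_integrable (w : R -> R) u : measurable_fun edge w ->
  (forall t, 0 <= w t) -> cmeasurable edge u ->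
  (\int[mu]_(t in edge) (w t * sqabs (u t))%:E < +oo)%E <->
  rintegrable mu edge (fun t => w t * complex.Re (u t) ^+ 2) /\
  rintegrable mu edge (fun t => w t * complex.Im (u t) ^+ 2).
Proof.
move=> mw w0 [mr mi]; pose s t := w t * sqabs (u t).
have mr2 := measurable_funM mw (measurable_funX 2 mr).
have mi2 := measurable_funM mw (measurable_funX 2 mi).
have sE t : s t = w t * complex.Re (u t) ^+ 2 + w t * complex.Im (u t) ^+ 2.
  by rewrite /s /sqabs mulrDr.
have ms : measurable_fun edge s.
  by apply: eq_measurable_fun (measurable_funD mr2 mi2) => t _; rewrite /= sE.
have s0 t : edge t -> 0 <= s t.
  by move=> _; rewrite /s mulr_ge0// addr_ge0 ?sqr_ge0.
have sP := rintegrable_ge0P mu ms s0.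
split => [/sP si|[ir ii]].
  split; apply: (rintegrable_le _ _ _ si) => // t _; rewrite sE ger0_norm.
  - by rewrite lerDl; rewrite mulr_ge0// sqr_ge0.
  - by rewrite mulr_ge0// sqr_ge0.
  - by rewrite lerDr; rewrite mulr_ge0// sqr_ge0.
  - by rewrite mulr_ge0// sqr_ge0.
by apply/sP; apply: rintegrable_eq (rintegrableD _ ir ii) => // t _; rewrite sE.
Qed.

Lemma edge_L2P u : edge_L2 u <->
  sqint mu edge (fun t => complex.Re (u t)) /\
  sqint mu edge (fun t => complex.Im (u t)).
Proof.
have one f : rintegrable mu edge (fun t => 1 * f t ^+ 2) <->
    rintegrable mu edge (fun t => f t ^+ 2).
  by split; apply: rintegrable_eq => // t _; rewrite mul1r.
have E : (\int[mu]_(t in edge) (1 * sqabs (u t))%:E)%E =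
    (\int[mu]_(t in edge) (sqabs (u t))%:E)%E.
  by apply: eq_integral => t _; rewrite mul1r.
split.
  move=> [mu1]; rewrite -E.
  have P := @wsqabs_integrable (fun=> 1) u (measurable_cst _) (fun=> ler01) mu1.
  by move=> /P[/one ? /one ?]; case: mu1.
move=> [[mr ir] [mi ii]]; split => //; rewrite -E.
have P := @wsqabs_integrable (fun=> 1) u (measurable_cst _) (fun=> ler01) (conj mr mi).
by apply/P; split; apply/one.
Qed.

Lemma L2_derivativeP u g : L2_derivative u g <-> edge_L2 g /\ forall x, 0 <= x ->
  complex.Re (u x) = complex.Re (u 0) + \int[mu]_(t in `[0, x]) complex.Re (g t) /\
  complex.Im (u x) = complex.Im (u 0) + \int[mu]_(t in `[0, x]) complex.Im (g t).
Proof.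
split=> -[gL H]; split => // x x0.
  by rewrite (H _ x0); case: (u 0).
by have [h1 h2] := H _ x0; apply: eq_complexP; rewrite ?h1 ?h2; case: (u 0).
Qed.

Lemma sqint_itv_integrable f x : sqint mu edge f -> 0 <= x -> rintegrable mu `[0, x]%classic f.
Proof.
move=> sf x0; apply: sqint_integrable => //; first exact: itv_lty.
by apply: sqint_subset => //; exact: sub_itv_edge.
Qed.

Lemma primitive_unique_ae (f1 f2 : R -> R) :
  sqint mu edge f1 -> sqint mu edge f2 ->
  (forall x, 0 <= x -> \int[mu]_(t in `[0, x]) f1 t = \int[mu]_(t in `[0, x]) f2 t) ->
  {ae mu, forall t, edge t -> f1 t = f2 t}.
Proof.
move=> s1 s2 H.
have := @Rintegral_primitive0_ae R (fun t => f1 t - f2 t).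
have i1 x (x0 : 0 <= x) := sqint_itv_integrable s1 x0.
have i2 x (x0 : 0 <= x) := sqint_itv_integrable s2 x0.
case.
- by move=> x x0; apply: rintegrableB => //; [exact: i1|exact: i2].
- by move=> x x0; rewrite RintegralB ?H ?subrr//; [exact: i1|exact: i2].
- move=> A [mA A0 HA]; exists A; split => // t /= nt; apply: HA => /= H'; apply: nt => Et.
  by apply/eqP; rewrite -subr_eq0 H'.
Qed.

Lemma L2_derivative_unique u g g' : L2_derivative u g -> L2_derivative u g' ->
  {ae mu, forall t, edge t -> complex.Re (g t) = complex.Re (g' t)} /\
  {ae mu, forall t, edge t -> complex.Im (g t) = complex.Im (g' t)}.
Proof.
move=> /L2_derivativeP[/edge_L2P[gr gi] H] /L2_derivativeP[/edge_L2P[gr' gi'] H'].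
split; apply: primitive_unique_ae => // x x0.
  by apply: (@addrI _ (complex.Re (u 0))); rewrite -(H _ x0).1 (H' _ x0).1.
by apply: (@addrI _ (complex.Im (u 0))); rewrite -(H _ x0).2 (H' _ x0).2.
Qed.

Lemma deriv_H1P u : edge_H1 u -> L2_derivative u (deriv_H1 u).
Proof. by move=> [_ [g Hg]]; rewrite /deriv_H1; case: xgetP => [g' _ //|/(_ g)]. Qed.

(** The form does not see which representative of the derivative is chosen. *)
Lemma hl_h_ae v (p r r' : (R -> R) * (R -> R)) : hl_pot v -> hl_dom v p -> hl_dom v r ->
  hl_dom v r' -> (forall t, edge t -> r.1 t = r'.1 t) ->
  {ae mu, forall t, edge t -> r.2 t = r'.2 t} -> hl_h v p r = hl_h v p r'.
Proof.
move=> hv dp dr dr' E1 E2; congr fine; apply: ae_eq_integral => //.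
- by apply/measurable_EFinP; apply: rintegrable_measurable (hl_dom_hmul hv dp dr).
- by apply/measurable_EFinP; apply: rintegrable_measurable (hl_dom_hmul hv dp dr').
- move: E2 => [A [mA A0 HA]]; exists A; split => // t /= nt; apply: HA => /= H'.
  by apply: nt => Et; rewrite E1// H'.
Qed.

End complex_half_line.

Section star_bridge.
Local Open Scope complex_scope.
Context {R : realType} {N : nat}.
Notation mu := (@lebesgue_measure R).
Notation edge := (edge R).
Implicit Types (psi phi : starfun N R R[i]).

Lemma star_integral_ltyP (f : starfun N R (\bar R)) :
  (forall j t, edge t -> (0 <= f j t)%E) ->
  (star_integral f < +oo)%E <->
  forall j, (\int[mu]_(t in edge) f j t < +oo)%E.
Proof.
move=> f0; split => [fI j|fj].
  apply: le_lt_trans fI; rewrite /star_integral (bigD1 j)//= leeDl//.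
  by apply: sume_ge0 => i _; apply: integral_ge0 => t; exact: f0.
by apply: lte_sum_pinfty => j _; exact: fj.
Qed.

Lemma admissible_exponent (V : starfun N R R) : admissible V ->
  exists2 p : R, 1 <= p & forall j, rintegrable mu edge (fun t => (V j)^\- t `^ p).
Proof.
move=> [mV [p p1 /star_integral_ltyP H] _]; exists p => // j.
apply: (rintegrable_ge0P mu _ _).2.
- apply: (measurableT_comp (measurable_powR _)) => //.
  by apply: measurable_funrneg; exact: mV.
- by move=> t _; exact: powR_ge0.
- by apply: H => // i t _; rewrite lee_fin powR_ge0.
Qed.

Lemma admissible_hl_pot (V : starfun N R R) : admissible V -> forall j, hl_pot (V j).
Proof.
move=> admV j; have [p p1 ip] := admissible_exponent admV.
by case: admV => mV _ _; split; [exact: mV|exists p].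
Qed.

Definition repart psi : starpairs R N :=
  fun j => (fun t => complex.Re (psi j t), fun t => complex.Re (deriv_H1 (psi j) t)).
Definition impart psi : starpairs R N :=
  fun j => (fun t => complex.Im (psi j t), fun t => complex.Im (deriv_H1 (psi j) t)).

Variable V : starpot R N.
Notation E := (starspace V false).

Lemma form_domainP psi : form_domain V psi <-> star_H1 psi /\
  forall j, rintegrable mu edge (fun t => (V j)^\+ t * complex.Re (psi j t) ^+ 2) /\
    rintegrable mu edge (fun t => (V j)^\+ t * complex.Im (psi j t) ^+ 2).
Proof.
have P j : edge_H1 (psi j) -> _ := fun H =>
  @wsqabs_integrable R (V j)^\+ (psi j) (measurable_funrpos (starpotP V j).1)
    (funrpos_ge0 _) H.1.1.
have f0 j t : edge t -> (0 <= ((V j)^\+ t * sqabs (psi j t))%:E)%E.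
  by move=> _; rewrite lee_fin mulr_ge0// addr_ge0 ?sqr_ge0.
split => -[Hpsi H]; split => //.
  by move=> j; apply/P; [case: Hpsi|apply: (star_integral_ltyP f0).1].
by apply/(star_integral_ltyP f0) => j; apply/P; [case: Hpsi|exact: H].
Qed.

Lemma repart_dom psi : form_domain V psi -> star_dom V false (repart psi).
Proof.
move=> /form_domainP[[h1 h2] hV]; split => //.
- move=> j; have /L2_derivativeP[/edge_L2P[gr gi] gE] := deriv_H1P (h1 j).
  have [/edge_L2P[ur ui] _] := h1 j.
  split => //=; first by case: (hV j).
  by move=> x x0; rewrite (gE _ x0).1.
- by move=> j k /=; rewrite (h2 j k).
Qed.

Lemma impart_dom psi : form_domain V psi -> star_dom V false (impart psi).
Proof.
move=> /form_domainP[[h1 h2] hV]; split => //.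
- move=> j; have /L2_derivativeP[/edge_L2P[gr gi] gE] := deriv_H1P (h1 j).
  have [/edge_L2P[ur ui] _] := h1 j.
  split => //=; first by case: (hV j).
  by move=> x x0; rewrite (gE _ x0).2.
- by move=> j k /=; rewrite (h2 j k).
Qed.

(** Real test vectors seen as complex functions.  Their derivative chosen by
    [deriv_H1] agrees with the given one almost everywhere only, hence the
    lemmas up to null sets below. *)
Definition complexify (p : E) : starfun N R R[i] := fun j t => (val p j).1 t +i* 0.

Let sqint0 : sqint mu edge (fun=> 0 : R).
Proof.
split; first exact: measurable_cst.
have : rintegrable mu edge (fun=> 0 : R) by exact: integrable0.
by apply: rintegrable_eq => // t _; rewrite expr0n.
Qed.

Lemma complexify_deriv p j :
  L2_derivative (complexify p j) (fun t => (val p j).2 t +i* 0).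
Proof.
have [d1 d2 d3 d4] := star_hl_dom p j.
apply/L2_derivativeP; split; first exact/edge_L2P.
move=> x x0 /=; split; first exact: d4.
by rewrite Rintegral_cst ?mul0r ?addr0.
Qed.

Lemma complexify_domain p : form_domain V (complexify p).
Proof.
apply/form_domainP; split; first split.
- move=> j; have [d1 d2 d3 d4] := star_hl_dom p j; split; first exact/edge_L2P.
  by eexists; exact: complexify_deriv.
- by move=> j k; have [_ pE _] := star_valP p; rewrite /complexify (pE j k).
- move=> j; have [d1 d2 d3 d4] := star_hl_dom p j; split => //=.
  by apply: rintegrable_eq sqint0.2 => // t _; rewrite expr0n mulr0.
Qed.

Lemma complexify_deriv_H1 p j :
  {ae mu, forall t, edge t -> complex.Re (deriv_H1 (complexify p j) t) = (val p j).2 t} /\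
  {ae mu, forall t, edge t -> complex.Im (deriv_H1 (complexify p j) t) = 0}.
Proof.
have H1 : edge_H1 (complexify p j) by have /form_domainP[[H _] _] := complexify_domain p.
exact: L2_derivative_unique (deriv_H1P H1) (complexify_deriv p j).
Qed.

Let H (p r : starpairs R N) := \sum_j hl_h (V j) (p j) (r j).
Let B (p r : starpairs R N) := \sum_j hl_b (p j) (r j).

Lemma schrodinger_formE psi phi : form_domain V psi -> form_domain V phi ->
  schrodinger_form V psi phi =
    (H (repart psi) (repart phi) + H (impart psi) (impart phi)) +i*
    (H (impart psi) (repart phi) - H (repart psi) (impart phi)).
Proof.
move=> dpsi dphi.
have hr := fun j => (repart_dom dpsi).
have [r1 _ _] := repart_dom dpsi; have [i1 _ _] := impart_dom dpsi.
have [r2 _ _] := repart_dom dphi; have [i2 _ _] := impart_dom dphi.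
apply: eq_complexP; rewrite /schrodinger_form /star_cintegral ?Re_sum ?Im_sum /=.
- rewrite -big_split; apply: eq_bigr => j _ /=.
  rewrite -RintegralD//; [|exact: (hl_dom_hmul (starpotP V j))..].
  apply: eq_Rint => t _ /=.
  by case: (deriv_H1 _ _) => a b; case: (deriv_H1 _ _) => c d;
    case: (psi j t) => e f; case: (phi j t) => g k /=; ring.
- rewrite -sumrB; apply: eq_bigr => j _ /=.
  rewrite -RintegralB//; [|exact: (hl_dom_hmul (starpotP V j))..].
  apply: eq_Rint => t _ /=.
  by case: (deriv_H1 _ _) => a b; case: (deriv_H1 _ _) => c d;
    case: (psi j t) => e f; case: (phi j t) => g k /=; ring.
Qed.

Lemma innerE (lam : R) psi phi : form_domain V psi -> form_domain V phi ->
  inner (fun j t => lam%:C * psi j t) phi =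
    (lam * (B (repart psi) (repart phi) + B (impart psi) (impart phi))) +i*
    (lam * (B (impart psi) (repart phi) - B (repart psi) (impart phi))).
Proof.
move=> dpsi dphi.
have [r1 _ _] := repart_dom dpsi; have [i1 _ _] := impart_dom dpsi.
have [r2 _ _] := repart_dom dphi; have [i2 _ _] := impart_dom dphi.
apply: eq_complexP; rewrite /inner /star_cintegral ?Re_sum ?Im_sum /=.
- rewrite -big_split mulr_sumr; apply: eq_bigr => j _ /=.
  rewrite -RintegralD//; [|exact: (@hl_dom_bmul _ (V j))..].
  rewrite -RintegralZl//; last first.
    by apply: rintegrableD => //; exact: (@hl_dom_bmul _ (V j)).
  apply: eq_Rint => t _ /=.
  by case: (psi j t) => e f; case: (phi j t) => g k /=; ring.
- rewrite -sumrB mulr_sumr; apply: eq_bigr => j _ /=.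
  rewrite -RintegralB//; [|exact: (@hl_dom_bmul _ (V j))..].
  rewrite -RintegralZl//; last first.
    by apply: rintegrableB => //; exact: (@hl_dom_bmul _ (V j)).
  apply: eq_Rint => t _ /=.
  by case: (psi j t) => e f; case: (phi j t) => g k /=; ring.
Qed.

Lemma H_complexify_re (p : starpairs R N) (r : E) : star_dom V false p ->
  H p (repart (complexify r)) = H p (val r).
Proof.
move=> [dp _ _]; apply: eq_bigr => j _.
have [dr _ _] := repart_dom (complexify_domain r).
apply: (hl_h_ae (starpotP V j)) => //; first exact: star_hl_dom.
exact: (complexify_deriv_H1 _ _).1.
Qed.

Lemma H_complexify_im (p : starpairs R N) (r : E) : star_dom V false p ->
  H p (impart (complexify r)) = 0.
Proof.
move=> [dp _ _]; apply: big1 => j _.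
have [dr _ _] := impart_dom (complexify_domain r).
have d0 : hl_dom (V j) (0, 0) := hl_dom0 _.
transitivity (hl_h (V j) (p j) (0, 0)).
  apply: (hl_h_ae (starpotP V j)) => //.
  exact: (complexify_deriv_H1 _ _).2.
rewrite /hl_h/= (@eq_Rint _ _ _ _ _ _ (fun=> 0)).
  by rewrite Rintegral_cst ?mul0r.
by move=> t _; rewrite !mulr0 addr0.
Qed.

Lemma B_complexify_im (p : starpairs R N) (r : E) : B p (impart (complexify r)) = 0.
Proof.
apply: big1 => j _; rewrite /hl_b/= (@eq_Rint _ _ _ _ _ _ (fun=> 0)).
  by rewrite Rintegral_cst ?mul0r.
by move=> t _; rewrite mulr0.
Qed.

(** The form is sesquilinear with real coefficients, so testing a complex
    function against real test functions separates real and imaginary part. *)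
Lemma eigenspaceP (lam : R) psi : eigenspace_of V lam psi <->
  form_domain V psi /\ exists a c : E, [/\ val a = repart psi, val c = impart psi,
    star_eigvec V false lam a &
    star_eigvec V false lam c].
Proof.
split.
  move=> [dpsi _ eigpsi]; split => //.
  exists (mkstar (repart_dom dpsi)), (mkstar (impart_dom dpsi)).
  suff key (r : E) : H (repart psi) (val r) = lam * B (repart psi) (val r) /\
      H (impart psi) (val r) = lam * B (impart psi) (val r).
    by split => // r; [case: (key r)|case: (key r)].
  have := eigpsi _ (complexify_domain r).
  rewrite schrodinger_formE ?innerE//; try exact: complexify_domain.
  rewrite !(H_complexify_im, H_complexify_re, B_complexify_im);
    do ?[exact: repart_dom|exact: impart_dom].
  by rewrite !addr0 !subr0 => -[].
move=> [dpsi [a [c [aE cE ea ec]]]]; split => //.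
  have /form_domainP[[h1 _] _] := dpsi.
  move=> j; have [/edge_L2P[[mr ir] [mi ii]] _] := h1 j.
  apply/edge_L2P.
  have sr : sqint mu edge (fun t => complex.Re (psi j t)) by split.
  have si : sqint mu edge (fun t => complex.Im (psi j t)) by split.
  split.
  - rewrite (_ : (fun t => _) = (fun t => lam * complex.Re (psi j t) + 0)).
      exact: sqint_comb.
    by apply/funext => t; case: (psi j t) => x y /=; ring.
  - rewrite (_ : (fun t => _) = (fun t => lam * complex.Im (psi j t) + 0)).
      exact: sqint_comb.
    by apply/funext => t; case: (psi j t) => x y /=; ring.
move=> phi dphi; rewrite schrodinger_formE ?innerE//.
have ear := ea (mkstar (repart_dom dphi)); have eai := ea (mkstar (impart_dom dphi)).
have ecr := ec (mkstar (repart_dom dphi)); have eci := ec (mkstar (impart_dom dphi)).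
move: ear eai ecr eci; rewrite /star_h /star_b aE cE /=.
rewrite -!/(H _ _) -!/(B _ _) => -> -> -> ->.
by congr (_ +i* _); ring.
Qed.

End star_bridge.

Section null_vectors.
Context {R : realType} {N : nat}.
Notation mu := (@lebesgue_measure R).
Notation edge := (edge R).
Variables (V : starpot R N) (dir : bool).
Notation E := (starspace V dir).
Notation b := (@star_b _ _ V dir).
Notation h := (@star_h _ _ V dir).

Lemma star_val_sum (I : finType) (c : I -> R) (x : I -> E) j t :
  (val (\sum_i c i *: x i) j).1 t = \sum_i c i * (val (x i) j).1 t.
Proof.
elim/big_ind2: _ => [//|u y v z uy vz|//].
by rewrite -uy -vz.
Qed.

Lemma star_b_eq0P (u : E) : b u u = 0 <->
  forall j, {ae mu, forall t, edge t -> (val u j).1 t = 0}.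
Proof.
have ge0 j : 0 <= hl_b (val u j) (val u j) by rewrite hl_bE sqA_ge0.
have P j : hl_b (val u j) (val u j) = 0 <->
    {ae mu, forall t, edge t -> (val u j).1 t = 0}.
  have [[mu1 iu] _ _ _] := star_hl_dom u j.
  have mf : measurable_fun edge (fun t => ((val u j).1 t ^+ 2)%:E).
    by apply/measurable_EFinP; exact: measurable_funX.
  have [A1 A2] := @ae_eq_integral_abs _ (measurableTypeR R) R mu edge measurable_edgeL _ mf.
  have absE : (\int[mu]_(t in edge) `|((val u j).1 t ^+ 2)%:E|)%E = (hl_b (val u j) (val u j))%:E.
    rewrite hl_bE /sqA -rintegrableE//; apply: eq_integral => t _ /=.
    by rewrite ger0_norm ?sqr_ge0.
  rewrite absE in A1 A2; split => [b0|].
    have := A1 (congr1 EFin b0); apply: ae_imply.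
    move=> t H Et; apply/eqP; rewrite -sqrf_eq0; apply/eqP.
    by have := H Et; exact: EFin_inj.
  move=> ae0; apply: EFin_inj; apply: A2; move: ae0; apply: ae_imply.
  by move=> t H Et; rewrite H// expr0n.
split=> [b0 j|H]; last by apply: big1 => j _; apply/P.
by apply/P/(psumr_eq0P (fun i _ => ge0 i) b0).
Qed.

(** Independence modulo null vectors, which is linear independence of the
    functions almost everywhere. *)
Definition b_independent (I : finType) (x : I -> E) : Prop :=
  forall c : I -> R, b (\sum_i c i *: x i) (\sum_i c i *: x i) = 0 ->
    forall i, c i = 0.

Lemma orthosys_independent n (f : 'I_n -> E) : orthosys b f -> b_independent f.
Proof.
move=> fo c b0 i.
have sb : symform b by exact: symform_star_b.
have : b (\sum_i c i *: f i) (\sum_i c i *: f i) = \sum_i c i ^+ 2.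
  rewrite (symform_suml sb); apply: eq_bigr => k _.
  rewrite (symform_sumr sb) (bigD1 k)//= big1 ?addr0.
    by rewrite fo eqxx mulr1 expr2.
  by move=> l lk; rewrite fo eq_sym (negbTE lk) mulr0.
rewrite b0 => /esym/psumr_eq0P => /(_ (fun i _ => sqr_ge0 _) i isT)/eqP.
by rewrite sqrf_eq0 => /eqP.
Qed.

End null_vectors.

Section multiplicities.
Local Open Scope complex_scope.
Context {R : realType} {N : nat}.
Notation mu := (@lebesgue_measure R).
Notation edge := (edge R).
Variable (V : starpot R N).
Notation E := (starspace V false).
Notation b := (@star_b _ _ V false).
Notation h := (@star_h _ _ V false).

Lemma ae_forall_fin (I : finType) (P : I -> R -> Prop) :
  (forall i, {ae mu, forall t, P i t}) -> {ae mu, forall t, forall i, P i t}.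
Proof.
move=> H.
have : {ae mu, forall t, forall i, i \in enum I -> P i t}.
  elim: (enum I) => [|i s IH]; first by exists set0; split => // t /= [].
  apply: ae_imply2 IH (H i) => t Ps Pi k.
  by rewrite inE => /orP[/eqP ->//|]; exact: Ps.
by apply: ae_imply => t Ht i; apply: Ht; rewrite mem_enum.
Qed.

(** Real independent eigenvectors stay independent over the complex numbers:
    take real and imaginary parts of the coefficients. *)
Lemma multiplicity_ge (lam : R) (I : finType) (x : I -> E) :
  (forall i, eigvec b h lam (x i)) -> b_independent x ->
  (#|I|%:R%:E <= multiplicity V lam)%E.
Proof.
move=> ex ix; apply: ereal_sup_ubound; exists #|I| => //=.
exists (fun k => complexify (x (enum_val k))); split.
  move=> k; apply/eigenspaceP; split; first exact: complexify_domain.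
  have dz : star_dom V false (fun=> (0, 0)) by split => // j; exact: hl_dom0.
  have [dr _ _] := repart_dom (complexify_domain (x (enum_val k))).
  have di := impart_dom (complexify_domain (x (enum_val k))).
  have sh : symform h by exact: symform_star_h.
  have sb : symform b by exact: symform_star_b.
  exists (mkstar (repart_dom (complexify_domain (x (enum_val k))))), (mkstar di).
  split => // w.
    rewrite (symformC sh) [LHS](H_complexify_re _ (star_valP w)).
    by rewrite -[LHS]/(h w (x (enum_val k))) (symformC sh); exact: ex.
  rewrite (symformC sh) [LHS](H_complexify_im _ (star_valP w)) (symformC sb).
  by rewrite [star_b _ _](B_complexify_im (val w) (x (enum_val k))) mulr0.
move=> c c0 k.
suff H (d : 'I_#|I| -> R) : (forall j, {ae mu, forall t, edge t ->
    \sum_k d k * (val (x (enum_val k)) j).1 t = 0}) -> forall k, d k = 0.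
  apply: eq_complexP; apply: (H (fun k => _ (c k))) => j.
    move: (c0 j); apply: ae_imply => t Ht Et.
    rewrite -[RHS]/(complex.Re (0 : R[i])) -(Ht Et) Re_sum.
    by apply: eq_bigr => i _; case: (c i) => a a' /=; ring.
  move: (c0 j); apply: ae_imply => t Ht Et.
  rewrite -[RHS]/(complex.Im (0 : R[i])) -(Ht Et) Im_sum.
  by apply: eq_bigr => i _; case: (c i) => a a' /=; ring.
move=> d0 {}k; have := ix (fun i => d (enum_rank i)).
rewrite -[k in d k]enum_valK; apply.
apply/star_b_eq0P => j; move: (d0 j); apply: ae_imply => t Ht Et.
rewrite star_val_sum -[RHS](Ht Et).
rewrite (reindex (@enum_val I I)); last first.
  by apply: onW_bij; exact: enum_val_bij.
by apply: eq_bigr => i _; rewrite enum_valK.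
Qed.

(** Complex eigenfunctions have real and imaginary part in the real span of
    [r] functions, hence lie in their complex span; more than [r] of them are
    dependent. *)
Lemma multiplicity_le_eigdim (lam : R) : (multiplicity V lam <= eigdim b h lam)%E.
Proof.
have sb : symform b by exact: symform_star_b.
have sh : symform h by exact: symform_star_h.
have [[-> _]|[r [f [-> fo fe span]]]] := eigdimP sb sh (@star_b_ge0 _ _ V false) lam.
  by rewrite leey.
apply: ge_ereal_sup => _ [n [e [ee ie]] <-]; rewrite lee_fin ler_nat.
rewrite leqNgt; apply/negP => rn.
have spanae (u : E) : eigvec b h lam u -> forall j, {ae mu, forall t, edge t ->
    (val u j).1 t = \sum_l b (f l) u * (val (f l) j).1 t}.
  move=> /span/star_b_eq0P H j; move: (H j); apply: ae_imply => t Ht Et.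
  rewrite -star_val_sum; apply/eqP; rewrite -subr_eq0; apply/eqP.
  exact: (Ht Et).
have /choice[ac acP] : forall k, exists p : E * E,
    [/\ val p.1 = repart (e k), val p.2 = impart (e k),
    eigvec b h lam p.1 & eigvec b h lam p.2].
  move=> k; have [_ [a [c H]]] := (eigenspaceP V lam (e k)).1 (ee k).
  by exists (a, c).
(* coordinates of the eigenfunctions in the real eigenvectors *)
pose M k l := (b (f l) (ac k).1) +i* (b (f l) (ac k).2).
have [|d [k0 /negP dk0] dM] := lincomb_ker M; first by rewrite card_ord.
apply: dk0; apply/eqP; apply: ie => j.
have ae1 : {ae mu, forall t, forall k, edge t ->
    e k j t = \sum_l M k l * ((val (f l) j).1 t)%:C}.
  apply: ae_forall_fin => k; have [E1 E2 e1 e2] := acP k.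
  apply: ae_imply2 (spanae _ e1 j) (spanae _ e2 j) => t H1 H2 Et.
  apply: eq_complexP.
    have := H1 Et; rewrite E1 /= => ->; rewrite Re_sum; apply: eq_bigr => l _ /=.
    by ring.
  have := H2 Et; rewrite E2 /= => ->; rewrite Im_sum; apply: eq_bigr => l _ /=.
  by ring.
apply: ae_imply ae1 => t H Et.
under eq_bigr => k _ do rewrite (H k Et) mulr_sumr.
rewrite exchange_big /= big1// => l _.
under eq_bigr => k _ do rewrite mulrA.
by rewrite -mulr_suml dM mul0r.
Qed.

End multiplicities.

(** * Decomposition of a radial operator *)

Section null_space.
Context {R : realType} {E : lmodType R}.
Variables (b : E -> E -> R) (sb : symform b) (b0 : forall u, 0 <= b u u).

(** Cauchy--Schwarz for a semidefinite form. *)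
Lemma null_ortho u v : b u u = 0 -> b u v = 0.
Proof.
move=> u0; apply/eqP; rewrite -sqrf_eq0 eq_le sqr_ge0 andbT.
rewrite -[leRHS](mul0r (b v v)) -u0.
by apply: (symform_cauchy_schwarz sb).
Qed.

Lemma null_comb a u v : b u u = 0 -> b v v = 0 -> b (a *: u + v) (a *: u + v) = 0.
Proof.
move=> u0 v0; rewrite (symform_sqD sb) (symform_sqZ sb) (symformZl sb).
by rewrite (null_ortho v u0) u0 v0; ring.
Qed.

Lemma null_sum (I : finType) (u : I -> E) : (forall i, b (u i) (u i) = 0) ->
  b (\sum_i u i) (\sum_i u i) = 0.
Proof.
move=> H; elim/big_ind: _ => [|x y x0 y0|//]; first by rewrite (symform0l sb).
by rewrite -[x]scale1r null_comb.
Qed.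

End null_space.

Section radial.
Context {R : realType} {n : nat}.
Notation mu := (@lebesgue_measure R).
Notation edge := (edge R).
Variable V : starpot R n.+1.
Hypothesis radV : radial V.

Definition profile : starpot R 1 := StarPot (fun=> starpotP V ord0).

Notation E := (starspace V false).
Notation F := (starspace profile false).
Notation D := (starspace profile true).
Notation bE := (@star_b _ _ V false).
Notation hE := (@star_h _ _ V false).
Notation bF := (@star_b _ _ profile false).
Notation hF := (@star_h _ _ profile false).
Notation bD := (@star_b _ _ profile true).
Notation hD := (@star_h _ _ profile true).

Let VE j t : edge t -> V j t = V ord0 t.
Proof. by rewrite edgeE => t0; exact: radV. Qed.

Lemma radial_hl_dom j p : hl_dom (V j) p <-> hl_dom (V ord0) p.
Proof.
by split=> -[d1 d2 d3 d4]; split => //; apply: rintegrable_eq d3 => // t Et;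
  rewrite /funrpos VE.
Qed.

Lemma radial_hl_h j p r : hl_h (V j) p r = hl_h (V ord0) p r.
Proof. by apply: eq_Rint => t Et; rewrite VE. Qed.

Lemma comp_dom (u : E) j : star_dom profile false (fun=> val u j).
Proof. by split => // i; exact/(radial_hl_dom j)/star_hl_dom. Qed.

Definition comp j (u : E) : F := mkstar (comp_dom u j).

Lemma bE_comp (u w : E) : bE u w = \sum_j bF (comp j u) (comp j w).
Proof. by apply: eq_bigr => j _; rewrite /star_b big_ord1. Qed.

Lemma hE_comp (u w : E) : hE u w = \sum_j hF (comp j u) (comp j w).
Proof. by apply: eq_bigr => j _; rewrite /star_h big_ord1 radial_hl_h. Qed.

Lemma dirichlet_dom (g : D) : star_dom profile false (val g).
Proof. by have [d1 d2 d3] := star_valP g; split. Qed.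

Definition incl (g : D) : F := mkstar (dirichlet_dom g).

(** The sum over the edges; the sum rather than the mean makes [lift_sym] its
    adjoint exactly. *)
Definition proj_sym (u : E) : F := \sum_j comp j u.

Lemma proj_anti_dom l (u : E) :
  star_dom profile true (val (comp (lift ord0 l) u - comp ord0 u)).
Proof.
have [d1 d2 d3] := star_valP (comp (lift ord0 l) u - comp ord0 u); split => //.
move=> _ j; have [_ uE _] := star_valP u.
rewrite -[LHS]/((val u (lift ord0 l)).1 0 - (val u ord0).1 0).
by rewrite (uE (lift ord0 l) ord0) subrr.
Qed.

(** The difference of two edges vanishes at the vertex by continuity, so it
    satisfies the Dirichlet condition. *)
Definition proj_anti l (u : E) : D := mkstar (proj_anti_dom l u).

Lemma lift_sym_dom (f : F) : star_dom V false (fun=> val f ord0).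
Proof. by split => // j; apply/radial_hl_dom; exact: (star_hl_dom f). Qed.

Definition lift_sym (f : F) : E := mkstar (lift_sym_dom f).

Lemma lift_anti_dom (l : 'I_n) (g : D) : star_dom V false
  (fun j => if j == lift ord0 l then val g ord0
            else if j == ord0 then - val g ord0 else 0).
Proof.
have [gd _ g0] := star_valP g.
have g00 : (val g ord0).1 0 = 0 by exact: g0.
have dN : hl_dom (V ord0) (- val g ord0).
  rewrite -[- _]addr0 -scaleN1r; apply: hl_dom_comb; first exact: starpotP.
    exact: (gd ord0).
  exact: hl_dom0.
have val0 (j : 'I_n.+1) : (if j == lift ord0 l then val g ord0
            else if j == ord0 then - val g ord0 else 0).1 0 = 0.
  case: ifP => // _; case: ifP => // _.
  by rewrite -[LHS]/(- (val g ord0).1 0) g00 oppr0.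
split => //; last by move=> j k; rewrite !val0.
move=> j; apply/radial_hl_dom; case: ifP => _; first exact: (gd ord0).
by case: ifP => _ //; exact: hl_dom0.
Qed.

(** Together with [lift_sym] and [proj_sym] this makes two adjoint pairs; the
    opposite signs on two edges are what pairs with a difference of components. *)
Definition lift_anti l (g : D) : E := mkstar (lift_anti_dom l g).

Lemma comp_lift_sym j f : comp j (lift_sym f) = f.
Proof.
by apply: val_inj; apply/funext => i; rewrite ord1.
Qed.

Lemma comp_lift_anti j l g : comp j (lift_anti l g) =
  if j == lift ord0 l then incl g else if j == ord0 then - incl g else 0.
Proof.
apply: val_inj; apply/funext => i; rewrite ord1 /=.
by case: ifP => // _; case: ifP.
Qed.

(** One adjunction serves for [b] and for [h], and this is what makes lifts and
    projections preserve the eigenvalue equation. *)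
Lemma adj_sym (X : F -> F -> R) (sX : symform X) f u :
  \sum_j X (comp j (lift_sym f)) (comp j u) = X f (proj_sym u).
Proof.
rewrite /proj_sym.
have -> : \sum_j comp j u = \sum_j 1 *: comp j u.
  by apply: eq_bigr => j _; rewrite scale1r.
by rewrite (symform_sumr sX); apply: eq_bigr => j _; rewrite comp_lift_sym mul1r.
Qed.

Lemma adj_anti (X : F -> F -> R) (sX : symform X) l g u :
  \sum_j X (comp j (lift_anti l g)) (comp j u) =
  X (incl g) (comp (lift ord0 l) u - comp ord0 u).
Proof.
rewrite (bigD1 (lift ord0 l))//= (bigD1 ord0)//= big1 ?addr0.
  rewrite !comp_lift_anti eqxx (symformBr sX) (negbTE (neq_lift _ _)) eqxx.
  by rewrite (symformNl sX).
move=> j /andP[jl j0]; rewrite comp_lift_anti (negbTE jl) (negbTE j0).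
exact: symform0l.
Qed.

Let sbF : symform bF := symform_star_b profile false.
Let shF : symform hF := symform_star_h profile false.
Let sbE : symform bE := symform_star_b V false.
Let shE : symform hE := symform_star_h V false.
Let sbD : symform bD := symform_star_b profile true.
Let shD : symform hD := symform_star_h profile true.
Let bF0 := star_b_ge0 (V := profile) (dir := false).
Let bD0 := star_b_ge0 (V := profile) (dir := true).
Let bE0 := star_b_ge0 (V := V) (dir := false).

Lemma adj_sym_b f u : bE (lift_sym f) u = bF f (proj_sym u).
Proof. by rewrite bE_comp adj_sym. Qed.
Lemma adj_sym_h f u : hE (lift_sym f) u = hF f (proj_sym u).
Proof. by rewrite hE_comp adj_sym. Qed.
Lemma adj_anti_b l g u : bE (lift_anti l g) u = bD g (proj_anti l u).
Proof. by rewrite bE_comp adj_anti. Qed.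
Lemma adj_anti_h l g u : hE (lift_anti l g) u = hD g (proj_anti l u).
Proof. by rewrite hE_comp adj_anti. Qed.

Section eigen.
Variable lam : R.

Lemma eigvec_lift_sym f : eigvec bF hF lam f -> eigvec bE hE lam (lift_sym f).
Proof. by move=> ef u; rewrite adj_sym_h adj_sym_b ef. Qed.

Lemma eigvec_lift_anti l g : eigvec bD hD lam g -> eigvec bE hE lam (lift_anti l g).
Proof. by move=> eg u; rewrite adj_anti_h adj_anti_b eg. Qed.

Lemma eigvec_proj_sym u : eigvec bE hE lam u -> eigvec bF hF lam (proj_sym u).
Proof.
move=> eu f; rewrite (symformC shF) (symformC sbF) -adj_sym_h -adj_sym_b.
by rewrite (symformC shE) (symformC sbE) eu.
Qed.

Lemma eigvec_proj_anti l u : eigvec bE hE lam u -> eigvec bD hD lam (proj_anti l u).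
Proof.
move=> eu g; rewrite (symformC shD) (symformC sbD) -adj_anti_h -adj_anti_b.
by rewrite (symformC shE) (symformC sbE) eu.
Qed.

(** The component on edge [0] is recovered from the sum and the differences,
    the other components from it and the differences. *)
Lemma proj_null u : bF (proj_sym u) (proj_sym u) = 0 ->
  (forall l, bD (proj_anti l u) (proj_anti l u) = 0) -> bE u u = 0.
Proof.
move=> s0 a0.
have d0 l : bF (comp (lift ord0 l) u - comp ord0 u)
    (comp (lift ord0 l) u - comp ord0 u) = 0 by exact: (a0 l).
have c0 : bF (comp ord0 u) (comp ord0 u) = 0.
  have -> : comp ord0 u = n.+1%:R^-1 *: (proj_sym u -
      \sum_l (comp (lift ord0 l) u - comp ord0 u)).
    rewrite sumrB /proj_sym big_ord_recl sumr_const card_ord opprB addrACA.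
    by rewrite subrr addr0 -mulrS -[X in _ = _ *: X]scaler_nat scalerA mulVf ?scale1r// pnatr_eq0.
  rewrite (symform_sqZ sbF) addrC -scaleN1r (null_comb sbF bF0) ?mulr0//.
  exact: null_sum.
rewrite bE_comp; apply: big1 => j _.
case: (unliftP ord0 j) => [l ->|->//].
have -> : comp (lift ord0 l) u = 1 *: (comp (lift ord0 l) u - comp ord0 u) + comp ord0 u.
  by rewrite scale1r subrK.
exact: (null_comb sbF bF0).
Qed.

(** More eigenvectors on the star than the half-lines provide would admit a
    combination orthogonal to all lifts; all its projections are then null by
    the spanning property of [eigdimP], and so is the combination. *)
Lemma eigdim_radial_le : (0 < n)%N ->
  (eigdim bE hE lam <= eigdim bF hF lam + \sum_(l < n) eigdim bD hD lam)%E.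
Proof.
move=> n0.
have gD : (0 <= \sum_(l < n) eigdim bD hD lam)%E.
  by apply: sume_ge0 => l _; exact: eigdim_ge0.
have [[-> _]|[a [f [-> fo fe fspan]]]] := eigdimP sbF shF bF0 lam.
  by rewrite addye ?leey// gt_eqF// (lt_le_trans _ gD).
have [[-> _]|[c [g [-> go ge gspan]]]] := eigdimP sbD shD bD0 lam.
  have -> : (\sum_(l < n) +oo)%E = +oo%E :> \bar R.
    rewrite (bigD1 (Ordinal n0))//=; apply: addye; rewrite gt_eqF//.
    by apply: (@lt_le_trans _ _ 0%E) => //; apply: sume_ge0.
  by rewrite addey// leey.
rewrite sumEFin -EFinD; apply: ge_ereal_sup => _ [m [Psi [Po Pe]] <-].
rewrite lee_fin sumr_const card_ord -mulrnA -natrD ler_nat leqNgt.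
apply/negP => mlt.
pose A k (i : 'I_a + 'I_n * 'I_c) := match i with
  | inl i => bE (lift_sym (f i)) (Psi k)
  | inr (l, i) => bE (lift_anti l (g i)) (Psi k) end.
have [|d [k0 dk0] dA] := lincomb_ker A.
  by rewrite card_sum card_prod !card_ord mulnC.
pose w := \sum_k d k *: Psi k.
have ew : eigvec bE hE lam w by exact: eigvec_sum.
have w0 : bE w w = 0.
  apply: proj_null => [|l].
    have := fspan _ (eigvec_proj_sym ew); rewrite big1 ?subr0// => i _.
    rewrite -adj_sym_b (symform_sumr sbE).
    by rewrite (dA (inl i)) scale0r.
  have := gspan _ (eigvec_proj_anti l ew); rewrite big1 ?subr0// => i _.
  rewrite -adj_anti_b (symform_sumr sbE).
  by rewrite (dA (inr (l, i))) scale0r.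
by move/eqP: dk0; apply; exact: (orthosys_independent Po w0).
Qed.

(** Independence of the lifts.  The symmetric ones are orthogonal to each other
    and to the antisymmetric ones; the antisymmetric ones belonging to the same
    Dirichlet eigenvector have Gram matrix identity plus the all-ones matrix,
    which is invertible. *)
Lemma radial_multiplicity_count a c : eigdim_set bF hF lam a -> eigdim_set bD hD lam c ->
  ((a + n * c)%:R%:E <= multiplicity V lam)%E.
Proof.
move=> [f [fo fe]] [g [go ge]].
pose x (i : 'I_a + 'I_n * 'I_c) : E := match i with
  | inl i => lift_sym (f i)
  | inr (l, i) => lift_anti l (g i) end.
have := @multiplicity_ge R n.+1 V lam _ x.
rewrite card_sum card_prod !card_ord; apply.
  move=> [i|[l i]]; [exact: eigvec_lift_sym|exact: eigvec_lift_anti].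
move=> d w0.
have null u : \sum_i d i * bE u (x i) = 0.
  by rewrite -(symform_sumr sbE) (symformC sbE) (null_ortho sbE bE0).
have bss i k : bE (lift_sym (f i)) (lift_sym (f k)) = n.+1%:R * (i == k)%:R.
  rewrite adj_sym_b /proj_sym.
  have -> : \sum_j comp j (lift_sym (f k)) = \sum_(j < n.+1) 1 *: f k.
    by apply: eq_bigr => j _; rewrite comp_lift_sym scale1r.
  rewrite (symform_sumr sbF) -mulr_suml sumr_const card_ord.
  by rewrite fo.
have bsa i l k : bE (lift_sym (f i)) (lift_anti l (g k)) = 0.
  rewrite adj_sym_b /proj_sym.
  rewrite (bigD1 (lift ord0 l))//= (bigD1 ord0)//= big1 ?addr0.
    rewrite !comp_lift_anti eqxx (negbTE (neq_lift _ _)) eqxx subrr.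
    by rewrite (symformC sbF) (symform0l sbF).
  by move=> j /andP[jl j0]; rewrite comp_lift_anti (negbTE jl) (negbTE j0).
have baa l i l' k : bE (lift_anti l (g i)) (lift_anti l' (g k)) =
    ((l == l')%:R + 1) * (i == k)%:R.
  rewrite adj_anti_b.
  have -> : bD (g i) (proj_anti l (lift_anti l' (g k))) =
    bF (incl (g i)) (comp (lift ord0 l) (lift_anti l' (g k)) -
      comp ord0 (lift_anti l' (g k))) by [].
  rewrite !comp_lift_anti (inj_eq lift_inj) (negbTE (neq_lift _ _)) eqxx.
  have -> : (lift ord0 l == ord0) = false by rewrite eq_sym (negbTE (neq_lift _ _)).
  rewrite opprK (symformDr sbF).
  have bik : bF (incl (g i)) (incl (g k)) = (i == k)%:R by exact: go.
  rewrite bik; case: (l == l') => /=; rewrite ?mulr1n ?mulr0n.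
    by rewrite bik; ring.
  by rewrite (symformC sbF) (symform0l sbF); ring.
have split_sum (G : ('I_a + 'I_n * 'I_c) -> R) :
    \sum_i G i = \sum_i G (inl i) + \sum_(l < n) \sum_i G (inr (l, i)).
  by rewrite big_sumType/= pair_big/=; congr (_ + _); apply: eq_bigr => -[].
have dl i : d (inl i) = 0.
  have := null (lift_sym (f i)); rewrite split_sum/= (bigD1 i)//= bss eqxx mulr1.
  rewrite big1 ?addr0; last by move=> k ki; rewrite bss eq_sym (negbTE ki) !mulr0.
  rewrite big1 ?addr0; last by move=> l _; rewrite big1// => k _; rewrite bsa mulr0.
  by move/eqP; rewrite mulf_eq0 pnatr_eq0 orbF => /eqP.
(* testing with an antisymmetric lift gives [d_l = - sum of all d_l'];
   summing over [l] shows that the sum vanishes *)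
have dr l i : d (inr (l, i)) = - \sum_(l' < n) d (inr (l', i)).
  have := null (lift_anti l (g i)); rewrite split_sum/= big1 ?add0r; last first.
    by move=> k _; rewrite dl mul0r.
  have -> : \sum_(l' < n) \sum_k d (inr (l', k)) *
      bE (lift_anti l (g i)) (lift_anti l' (g k)) =
      \sum_(l' < n) ((l == l')%:R * d (inr (l', i)) + d (inr (l', i))).
    apply: eq_bigr => l' _; rewrite (bigD1 i)//= big1 ?addr0.
      by rewrite baa eqxx mulr1 mulrDr mulr1 mulrC.
    by move=> k ki; rewrite baa [i == k]eq_sym (negbTE ki) !mulr0.
  rewrite big_split/= (bigD1 l)//= eqxx mul1r big1 ?addr0.
    by move/eqP; rewrite addr_eq0 => /eqP.
  by move=> l' ll; rewrite eq_sym (negbTE ll) mul0r.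
have S0 i : \sum_(l' < n) d (inr (l', i)) = 0.
  set S := \sum_(l' < n) _.
  have : S = - (n%:R * S).
    rewrite {1}/S (eq_bigr (fun=> - S)); last by move=> l _; rewrite dr.
    by rewrite sumr_const card_ord mulNrn mulr_natl.
  move/eqP; rewrite -subr_eq0 opprK -{1}[S]mul1r -mulrDl.
  by rewrite nat1r mulf_eq0 pnatr_eq0 => /eqP.
by move=> [i|[l i]]; [exact: dl|rewrite dr S0 oppr0].
Qed.

Lemma radial_multiplicity_ge :
  (eigdim bF hF lam + \sum_(l < n) eigdim bD hD lam <= multiplicity V lam)%E.
Proof.
have cnt := radial_multiplicity_count.
have [[-> Fall]|[a [f [-> fo fe _]]]] := eigdimP sbF shF bF0 lam.
  have D0 : eigdim_set bD hD lam 0 by exists (fun=> 0); split=> [[]|[]].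
  suff -> : multiplicity V lam = +oo%E by rewrite leey.
  apply: (@eq_pinfty_mulrn_le _ 1) => // k.
  by have := cnt k 0%N (Fall k) D0; rewrite muln0 addn0 mulr1.
have Fa : eigdim_set bF hF lam a by exists f.
have [[-> Dall]|[c [g [-> go ge _]]]] := eigdimP sbD shD bD0 lam.
  have [n0|n0] := posnP n.
    have D0 : eigdim_set bD hD lam 0 by exists (fun=> 0); split=> [[]|[]].
    rewrite big1 ?adde0; last by case=> i; rewrite n0.
    by have := cnt a 0%N Fa D0; rewrite muln0 addn0.
  suff -> : multiplicity V lam = +oo%E by rewrite leey.
  apply: (@eq_pinfty_mulrn_le _ 1) => // k.
  apply: le_trans (cnt a k Fa (Dall k)); rewrite mulr1 lee_fin ler_nat.
  by rewrite (leq_trans _ (leq_addl _ _))// leq_pmull.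
have Dc : eigdim_set bD hD lam c by exists g.
rewrite sumEFin -EFinD; apply: le_trans (cnt a c Fa Dc).
by rewrite lee_fin sumr_const card_ord -mulrnA -natrD mulnC.
Qed.

Lemma radial_multiplicity : (0 < n)%N ->
  multiplicity V lam = (eigdim bF hF lam + \sum_(l < n) eigdim bD hD lam)%E.
Proof.
move=> n0; apply/eqP; rewrite eq_le radial_multiplicity_ge andbT.
exact: le_trans (multiplicity_le_eigdim _ _) (eigdim_radial_le n0).
Qed.

End eigen.

Lemma radial_trace gamma : (0 < n)%N ->
  trace_neg gamma V = (eigtrace bF hF gamma + \sum_(l < n) eigtrace bD hD gamma)%E.
Proof.
move=> n0; have pw (x : R) : (0 <= (`|x| `^ gamma)%:E)%E by rewrite lee_fin powR_ge0.
rewrite /trace_neg /eigtrace -esum_sum; last first.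
  by move=> x l _ _; rewrite mule_ge0// eigdim_ge0.
rewrite -esumD; last 2 first.
- by move=> x _; rewrite mule_ge0// eigdim_ge0.
- by move=> x _; apply: sume_ge0 => l _; rewrite mule_ge0// eigdim_ge0.
apply: eq_esum => x _; rewrite radial_multiplicity// ge0_muleDl ?eigdim_ge0//; last first.
  by apply: sume_ge0 => l _; exact: eigdim_ge0.
by rewrite ge0_sume_distrl// => l _; exact: eigdim_ge0.
Qed.

End radial.

(** * Comparison of traces *)

Lemma symform_sum_sum {R : realType} {E : lmodType R} (f : E -> E -> R)
  (sf : symform f) (I : finType) (c : I -> R) (x : I -> E) :
  f (\sum_i c i *: x i) (\sum_i c i *: x i) =
  \sum_i \sum_j c i * c j * f (x i) (x j).
Proof.
rewrite (symform_suml sf); apply: eq_bigr => i _.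
by rewrite (symform_sumr sf) mulr_sumr; apply: eq_bigr => j _; rewrite mulrA.
Qed.

Lemma sum_sum_diag {R : realType} (I : finType) (c a : I -> R) :
  \sum_i \sum_j c i * c j * (a i * (i == j)%:R) = \sum_i a i * c i ^+ 2.
Proof.
apply: eq_bigr => i _; rewrite (bigD1 i)//= eqxx big1 ?addr0.
  by rewrite mulr1 mulrC expr2.
by move=> j ji; rewrite eq_sym (negbTE ji) !mulr0.
Qed.

Section half_line_variational.
Context {R : realType}.

(** Lowering negative eigenvalues increases the powers of their absolute
    values. *)
Lemma eigtrace_ge_variational (V : starpot R 1) (dir : bool) (gamma : R) n
    (w : 'I_n -> starspace V dir) (m : 'I_n -> R) :
  0 <= gamma -> (forall i, m i < 0) ->
  (forall c : 'I_n -> R, star_b (\sum_i c i *: w i) (\sum_i c i *: w i) <=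
    \sum_i c i ^+ 2) ->
  (forall c : 'I_n -> R, star_h (\sum_i c i *: w i) (\sum_i c i *: w i) <=
    \sum_i m i * c i ^+ 2) ->
  ((\sum_i `|m i| `^ gamma)%:E <=
   star_trace V dir gamma)%E.
Proof.
move=> g0 m0 bw hw.
have [f [nu [fnu num]]] := variational_principle (half_line_good_form V dir) m0 bw hw.
apply: le_trans (eigtrace_ge gamma fnu _); last first.
  by move=> i; exact: le_lt_trans (num i) (m0 i).
rewrite lee_fin; apply: ler_sum => i _; apply: ge0_ler_powR => //;
  rewrite ?nnegrE//.
by rewrite !ltr0_norm ?lerN2 ?m0//; exact: le_lt_trans (num i) (m0 i).
Qed.

(** Dirichlet eigenvectors are trial vectors for the Neumann problem. *)
Lemma dirichlet_le_neumann (V : starpot R 1) (gamma : R) : 0 <= gamma ->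
  (star_trace V true gamma <=
   star_trace V false gamma)%E.
Proof.
move=> g0.
apply: (esum_le_eigsys (symform_star_b V true) (symform_star_h V true)
  (@star_b_ge0 _ _ V true)) => //.
  move=> lam; exact: (eigdim_ge0 (@star_b _ _ V true) (@star_h _ _ V true)).
move=> n f nu [fo fe] nu0.
have dom (g : starspace V true) : star_dom V false (val g).
  by have [d1 d2 d3] := star_valP g; split.
pose w i := mkstar (dom (f i)).
apply: (eigtrace_ge_variational (w := w)) => // c.
  rewrite (symform_sum_sum (symform_star_b V false)).
  have -> : \sum_i c i ^+ 2 = \sum_i 1 * c i ^+ 2 by apply: eq_bigr => i _; rewrite mul1r.
  rewrite -sum_sum_diag le_eqVlt; apply/orP; left; apply/eqP.
  apply: eq_bigr => i _; apply: eq_bigr => j _; congr (_ * _).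
  by rewrite mul1r; exact: fo.
rewrite (symform_sum_sum (symform_star_h V false)) -sum_sum_diag.
rewrite le_eqVlt; apply/orP; left; apply/eqP.
apply: eq_bigr => i _; apply: eq_bigr => j _; congr (_ * _).
by rewrite -fo -fe.
Qed.

End half_line_variational.

Lemma multiplicity_ge0 {R : realType} N (V : starfun N R R) (lam : R) :
  (0 <= multiplicity V lam)%E.
Proof.
apply: ereal_sup_ubound; exists 0%N => //=.
by exists (fun=> (fun _ _ => 0)); split=> [[]|c _ []].
Qed.

Lemma trace_neg_le_eigsys {R : realType} N (V : starpot R N) (gamma : R) (X : \bar R) :
  (forall n (f : 'I_n -> starspace V false) nu,
     star_eigsys V false f nu -> (forall i, nu i < 0) ->
     ((\sum_i `|nu i| `^ gamma)%:E <= X)%E) ->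
  (trace_neg gamma V <= X)%E.
Proof.
move=> sysX.
apply: (esum_le_eigsys (symform_star_b V false) (symform_star_h V false)
  (@star_b_ge0 _ _ V false)) => //.
  by move=> lam; exact: multiplicity_ge0.
by move=> lam _; exact: multiplicity_le_eigdim.
Qed.

(** * Gluing two half-lines *)

Section change_of_variables.
Context {R : realType}.
Notation mu := (@lebesgue_measure R).
Notation T := (measurableTypeR R).

Definition measure_preserving (phi : T -> T) := measurable_fun [set: T] phi /\
  forall A : set T, measurable A -> pushforward mu phi A = mu A.

(** Lebesgue measure is determined by its values on half-open intervals. *)
Lemma measure_preserving_itv (phi : T -> T) : measurable_fun [set: T] phi ->
  (forall a b : R, mu (phi @^-1` `]a, b]%classic) = mu `]a, b]%classic) ->
  measure_preserving phi.
Proof.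
move=> mphi H; split => // A mA.
pose f : {mfun T >-> T} := HB.pack phi (isMeasurableFun.Build _ _ _ _ phi mphi).
have := @lebesgue_measure_unique R (pushforward mu f) _ A mA.
by move=> <- // _ [[a b]] _ <-; exact/esym/(H a b).
Qed.

Lemma measure_preserving_shift (m : R) : measure_preserving (fun t => t - m).
Proof.
apply: measure_preserving_itv; first exact: measurable_funB.
move=> a b.
have -> : (fun t : T => t - m) @^-1` `]a, b]%classic = `]a + m, b + m]%classic.
  by apply/seteqP; split => t /=; rewrite !in_itv/= ltrBrDr lerBlDr.
by rewrite !lebesgue_measure_itv/= !lte_fin ltrD2r; case: ifP => // _;
  rewrite -?EFinB; congr (_%:E); ring.
Qed.

Lemma measure_preserving_reflect (m : R) : measure_preserving (fun t => m - t).
Proof.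
apply: measure_preserving_itv; first exact: measurable_funB.
move=> a b.
have -> : (fun t : T => m - t) @^-1` `]a, b]%classic = `[m - b, m - a[%classic.
  apply/seteqP; split => t /=; rewrite !in_itv/= => /andP[h1 h2]; apply/andP; lra.
rewrite !lebesgue_measure_itv/= !lte_fin ltrD2l ltrN2; case: ifP => // _.
by rewrite -?EFinB; congr (_%:E); ring.
Qed.

Section subst.
Variables (phi : T -> T) (phiP : measure_preserving phi).
Variables (D D' : set R) (mD : @measurable _ T D) (DE : phi @^-1` D = D').

Let phiD t : D' t -> D (phi t).
Proof. by rewrite -DE. Qed.

Lemma measurable_fun_subst (f : R -> R) : measurable_fun D f ->
  measurable_fun D' (f \o phi).
Proof.
move=> mf; apply: (measurable_comp mD _ mf).
  by move=> _ [t /phiD ? <-].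
exact: measurable_funTS phiP.1.
Qed.

Lemma ge0_integral_subst (f : R -> \bar R) : measurable_fun D f ->
  (forall t, D t -> (0 <= f t)%E) ->
  (\int[mu]_(t in D') f (phi t) = \int[mu]_(t in D) f t)%E.
Proof.
move=> mf f0.
have := @ge0_integral_pushforward _ _ T T R phi phiP.1 mu D f mD mf.
rewrite DE => H; rewrite -[LHS]H; last by move=> t /set_mem; exact: f0.
apply: eq_measure_integral => [|? A mA _]; [exact: phiP.1|exact: (phiP.2 A mA)].
Qed.

Lemma Rintegral_subst (f : R -> R) : rintegrable mu D f ->
  \int[mu]_(t in D') f (phi t) = \int[mu]_(t in D) f t.
Proof.
move=> fi; have mf := rintegrable_measurable fi.
congr fine; rewrite integralE [RHS]integralE; congr (_ - _)%E.
- have mp : measurable_fun D ((EFin \o f)^\+)%E.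
    by apply: measurable_funepos; apply/measurable_EFinP.
  rewrite -(ge0_integral_subst mp (fun t _ => funepos_ge0 _ t)).
  by apply: eq_integral => t _; rewrite !funeposE.
- have mn : measurable_fun D ((EFin \o f)^\-)%E.
    by apply: measurable_funeneg; apply/measurable_EFinP.
  rewrite -(ge0_integral_subst mn (fun t _ => funeneg_ge0 _ t)).
  by apply: eq_integral => t _; rewrite !funenegE.
Qed.

End subst.

Section glueing.
Variables (m : R) (m0 : 0 < m).
Notation edge := (edge R).

(** A function on the line with components [f1] and [f2], read on the half-line
    that starts at distance [m] along the second component: the vertex sits at
    [m] and [f2] is reversed.  Values of [f2] beyond [m] are lost. *)
Definition glue {X : Type} (f1 f2 : R -> X) (t : R) : X :=
  if m <= t then f1 (t - m) else f2 (m - t).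

Lemma glue_edge : edge = `[0, m[%classic `|` `[m, +oo[%classic.
Proof. by rewrite /Defs.edge -itv_bndbnd_setU// bnd_simp ltW. Qed.

Lemma glue_r {X : Type} (f1 f2 : R -> X) t : m <= t -> glue f1 f2 t = f1 (t - m).
Proof. by rewrite /glue => ->. Qed.

Lemma glue_l {X : Type} (f1 f2 : R -> X) t : t < m -> glue f1 f2 t = f2 (m - t).
Proof. by rewrite /glue ltNge => /negbTE ->. Qed.

Let shiftE : (fun t => t - m) @^-1` edge = `[m, +oo[%classic.
Proof. by apply/seteqP; split => t; rewrite /= edgeE in_itv/= andbT subr_ge0. Qed.

Let reflectE : (fun t => m - t) @^-1` `]0, m]%classic = `[0, m[%classic.
Proof. by apply/seteqP; split => t /=; rewrite !in_itv/= => /andP[h1 h2]; apply/andP; lra. Qed.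

Let subm : `]0, m]%classic `<=` `[0, m]%classic.
Proof. by move=> t /=; rewrite !in_itv/= => /andP[/ltW -> ->]. Qed.

Lemma measurable_glue (f1 f2 : R -> R) : measurable_fun edge f1 ->
  measurable_fun `[0, m]%classic f2 -> measurable_fun edge (glue f1 f2).
Proof.
move=> m1 m2; rewrite glue_edge; apply/measurable_funU => //; split.
  have := measurable_fun_subst (measure_preserving_reflect m) (measurable_itv _) reflectE
    (measurable_funS (measurable_itv _) subm m2).
  apply: eq_measurable_fun => t /set_mem /=; rewrite in_itv/= => /andP[_ tm].
  by rewrite glue_l.
have := measurable_fun_subst (measure_preserving_shift m) measurable_edge shiftE m1.
apply: eq_measurable_fun => t /set_mem /=; rewrite in_itv/= andbT => tm.
by rewrite glue_r.
Qed.

Lemma ge0_integral_glue (f1 f2 : R -> R) : measurable_fun edge f1 ->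
  measurable_fun `[0, m]%classic f2 -> (forall t, 0 <= f1 t) -> (forall t, 0 <= f2 t) ->
  (\int[mu]_(t in edge) (glue f1 f2 t)%:E =
   \int[mu]_(t in edge) (f1 t)%:E + \int[mu]_(t in `[0%R, m]) (f2 t)%:E)%E.
Proof.
move=> m1 m2 f10 f20; rewrite addeC {1}glue_edge ge0_integral_setU//=; last 3 first.
- by rewrite -glue_edge; apply/measurable_EFinP; exact: measurable_glue.
- by move=> t _; rewrite lee_fin /glue; case: ifP.
- apply/disj_setPS => x [/=]; rewrite !in_itv/= andbT => /andP[_ xn].
  by rewrite leNgt xn.
congr (_ + _)%E.
- rewrite (@eq_integral _ _ _ mu `[0, m[%classic (fun t => (f2 (m - t))%:E)); last first.
    by move=> t /set_mem /=; rewrite in_itv/= => /andP[_ tm]; rewrite glue_l.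
  rewrite (ge0_integral_subst (f := EFin \o f2) (measure_preserving_reflect m) _ reflectE)//.
  + by rewrite integral_itv_obnd_cbnd//; apply/measurable_EFinP; exact: measurable_funS m2.
  + by apply/measurable_EFinP; exact: measurable_funS m2.
  + by move=> t _; rewrite lee_fin.
- rewrite (@eq_integral _ _ _ mu `[m, +oo[%classic (fun t => (f1 (t - m))%:E)); last first.
    by move=> t /set_mem /=; rewrite in_itv/= andbT => tm; rewrite glue_r.
  rewrite (ge0_integral_subst (f := EFin \o f1) (measure_preserving_shift m) _ shiftE)//.
  + by apply/measurable_EFinP.
  + by move=> t _; rewrite lee_fin.
Qed.

Lemma rintegrable_glue (f1 f2 : R -> R) : rintegrable mu edge f1 ->
  rintegrable mu `[0, m]%classic f2 -> rintegrable mu edge (glue f1 f2).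
Proof.
move=> i1 i2; have m1 := rintegrable_measurable i1; have m2 := rintegrable_measurable i2.
apply/integrableP; split; first by apply/measurable_EFinP; exact: measurable_glue.
have -> : (\int[mu]_(t in edge) `|(EFin \o glue f1 f2) t|)%E =
  (\int[mu]_(t in edge) (glue (fun x => `|f1 x|) (fun x => `|f2 x|) t)%:E)%E.
  by apply: eq_integral => t _; rewrite /glue /=; case: ifP.
rewrite ge0_integral_glue//; [|exact: measurableT_comp..].
by apply: lte_add_pinfty; [case/integrableP: i1|case/integrableP: i2].
Qed.

Lemma Rintegral_glue (f1 f2 : R -> R) : rintegrable mu edge f1 ->
  rintegrable mu `[0, m]%classic f2 ->
  \int[mu]_(t in edge) glue f1 f2 t =
  \int[mu]_(t in edge) f1 t + \int[mu]_(t in `[0, m]) f2 t.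
Proof.
move=> i1 i2; have ig := rintegrable_glue i1 i2.
have i2' : rintegrable mu `]0, m]%classic f2 by exact: integrableS i2.
rewrite addrC {1}glue_edge Rintegral_setU//=; last 2 first.
- by rewrite -glue_edge.
- apply/disj_setPS => x [/=]; rewrite !in_itv/= andbT => /andP[_ xn].
  by rewrite leNgt xn.
congr (_ + _).
- rewrite -[RHS]Rintegral_itv_obnd_cbnd// -(Rintegral_subst (measure_preserving_reflect m) _ reflectE)//.
  by apply: eq_Rint => t /=; rewrite in_itv/= => /andP[_ tm]; rewrite glue_l.
- rewrite -(Rintegral_subst (measure_preserving_shift m) _ shiftE)//.
  by apply: eq_Rint => t /=; rewrite in_itv/= andbT => tm; rewrite glue_r.
Qed.

Lemma Rintegral_glue_l (f1 f2 : R -> R) x : rintegrable mu `[0, m]%classic f2 ->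
  0 <= x -> x < m ->
  \int[mu]_(t in `[0, x]) glue f1 f2 t = \int[mu]_(t in `[m - x, m]) f2 t.
Proof.
move=> i2 x0 xm.
have E : (fun t => m - t) @^-1` `[m - x, m]%classic = `[0, x]%classic.
  by apply/seteqP; split => t /=; rewrite !in_itv/= => /andP[h1 h2]; apply/andP; lra.
rewrite -(Rintegral_subst (measure_preserving_reflect m) _ E)//; last first.
  apply: integrableS i2 => //; apply: subset_itvr.
  by rewrite bnd_simp subr_ge0 ltW.
apply: eq_Rint => t /=; rewrite in_itv/= => /andP[_ tx].
by rewrite glue_l// (le_lt_trans tx).
Qed.

Lemma Rintegral_glue_r (f1 f2 : R -> R) x : rintegrable mu `[0, x - m]%classic f1 ->
  rintegrable mu `[0, m]%classic f2 -> m <= x ->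
  \int[mu]_(t in `[0, x]) glue f1 f2 t =
  \int[mu]_(t in `[0, x - m]) f1 t + \int[mu]_(t in `[0, m]) f2 t.
Proof.
move=> i1 i2 mx; pose g := f1 \_ `[0, x - m]%classic.
have ig : rintegrable mu edge g.
  apply: (@integrableS _ _ _ _ setT) => //.
  have /integrable_mkcond := i1.
  by move=> /(_ (measurable_itv _)); rewrite -restrict_EFin.
rewrite (Rintegral_itv0_restrict _ x) (Rintegral_itv0_restrict f1) -/g -(Rintegral_glue ig i2).
apply: eq_Rint => t; rewrite edgeE => t0; rewrite /glue /g !patchE.
rewrite (_ : (t \in `[0, x]%classic) = (t <= x)); last first.
  by apply/idP/idP => [/set_mem|tx]; [|apply/mem_set]; rewrite /= in_itv/= t0.
case: (leP m t) => [mt|tm]; last by rewrite (le_trans (ltW tm) mx).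
rewrite (_ : (t - m \in `[0, x - m]%classic) = (t <= x))//.
by apply/idP/idP => [/set_mem|tx]; [|apply/mem_set]; rewrite /= in_itv/= subr_ge0 mt lerD2r.
Qed.

End glueing.
End change_of_variables.

(** * Cutting off a function at distance m *)

(** Over a subdivision of [[0, x]] into [n] equal steps the increments of [Phi]
    add up to at most [C * x * (K x - K 0) / n].  This gives identities between
    absolutely continuous functions without differentiating them. *)
Lemma increment_const {R : realType} (Phi K : R -> R) (C : R) :
  (forall x y, 0 <= x -> x <= y -> `|Phi y - Phi x| <= C * (y - x) * (K y - K x)) ->
  forall x, 0 <= x -> Phi x = Phi 0.
Proof.
move=> H x x0; apply/eqP; rewrite -subr_eq0 -normr_eq0 eq_le normr_ge0 andbT.
(* [n.+1] steps of equal length; the increments of [K] telescope *)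
have key n : n.+1%:R * `|Phi x - Phi 0| <= C * x * (K x - K 0).
  pose d := x / n.+1%:R; have d0 : 0 <= d by rewrite divr_ge0.
  have step i : `|Phi (i%:R * d) - Phi 0| <= C * d * (K (i%:R * d) - K 0).
    elim: i => [|i IH]; first by rewrite !mul0r !subrr normr0 mulr0.
    have xi : 0 <= i%:R * d by rewrite mulr_ge0.
    have xi1 : i%:R * d <= i.+1%:R * d by apply: ler_wpM2r => //; rewrite ler_nat.
    have -> : Phi (i.+1%:R * d) - Phi 0 =
      (Phi (i.+1%:R * d) - Phi (i%:R * d)) + (Phi (i%:R * d) - Phi 0) by ring.
    apply: le_trans (ler_normD _ _) _; apply: le_trans (lerD (H _ _ xi xi1) IH) _.
    have -> : i.+1%:R * d - i%:R * d = d by rewrite -natr1; ring.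
    by rewrite -mulrDr addrA subrK.
  have := step n.+1; rewrite /d mulrC divfK ?pnatr_eq0// => S.
  have n0 : 0 < n.+1%:R :> R by [].
  rewrite -(ler_pM2l n0) in S; apply: le_trans S _.
  by rewrite le_eqVlt; apply/orP; left; apply/eqP; field; rewrite gt_eqF.
rewrite leNgt; apply/negP => p0.
have /archi_boundP : 0 <= `|C * x * (K x - K 0)| / `|Phi x - Phi 0| by rewrite divr_ge0.
set n := Num.bound _ => nb.
have := key n; apply/negP; rewrite -ltNge; apply: le_lt_trans (ler_norm _) _.
rewrite -ltr_pdivrMr//; apply: lt_trans nb _.
by rewrite ltr_nat.
Qed.

Section cutting.
Context {R : realType}.
Notation mu := (@lebesgue_measure R).
Notation edge := (edge R).
Notation fpair := ((R -> R) * (R -> R))%type.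
Implicit Types (v : R -> R) (p r : fpair) (x y s m : R).

Lemma itvB_edge f x y : rintegrable mu `[0, y]%classic f -> 0 <= x -> x <= y ->
  \int[mu]_(t in `[0, y]) f t - \int[mu]_(t in `[0, x]) f t =
  \int[mu]_(t in `]x, y]) f t.
Proof. by move=> fi x0 xy; rewrite Rintegral_itvB ?bnd_simp. Qed.

Lemma mul_id_integrable g y : 0 <= y -> rintegrable mu `[0, y]%classic g ->
  rintegrable mu `[0, y]%classic (fun t => t * g t).
Proof.
move=> y0 ig; have mg := rintegrable_measurable ig.
have ia : rintegrable mu `[0, y]%classic (fun t => y * `|g t|).
  by apply: rintegrableZ => //; exact: integrable_norm.
apply: (rintegrable_le _ _ _ ia) => //.
  by apply: measurable_funM.
move=> t /=; rewrite in_itv/= => /andP[t0 ty].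
by rewrite normrM ger0_norm//; apply: ler_wpM2r.
Qed.

(** The product rule for [x * u], proved by comparing the increments of both
    sides, which differ by at most twice the step times the increment of the
    integral of [`|u'|]. *)
Lemma pair_mul_id p : sqint mu edge p.1 -> sqint mu edge p.2 ->
  (forall x, 0 <= x -> p.1 x = p.1 0 + \int[mu]_(t in `[0, x]) p.2 t) ->
  forall x, 0 <= x -> x * p.1 x = \int[mu]_(t in `[0, x]) (p.1 t + t * p.2 t).
Proof.
move=> s1 s2 pE.
have ui y (y0 : 0 <= y) := sqint_itv_integrable s1 y0.
have gi y (y0 : 0 <= y) := sqint_itv_integrable s2 y0.
have fi y : 0 <= y -> rintegrable mu `[0, y]%classic (fun t => p.1 t + t * p.2 t).
  move=> y0; apply: rintegrableD => //; first exact: ui.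
  by apply: mul_id_integrable => //; exact: gi.
have sub x y : 0 <= x -> `]x, y]%classic `<=` `[0, y]%classic.
  by move=> x0 t /=; rewrite !in_itv/= => /andP[/ltW/(le_trans x0) -> ->].
have itvS f x y : 0 <= x -> rintegrable mu `[0, y]%classic f -> rintegrable mu `]x, y]%classic f.
  by move=> x0 i; apply: integrableS i => //; exact: sub.
pose Phi x := x * p.1 x - \int[mu]_(t in `[0, x]) (p.1 t + t * p.2 t).
pose K x := \int[mu]_(t in `[0, x]) `|p.2 t|.
have Phi0 : Phi 0 = 0.
  by rewrite /Phi mul0r set_itv1 Rintegral_set1 subrr.
suff H x : 0 <= x -> Phi x = Phi 0.
  by move=> x /H; rewrite Phi0 => /eqP; rewrite subr_eq0 => /eqP.
move: x; apply: (@increment_const _ Phi K 2) => x y x0 xy.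
have y0 := le_trans x0 xy.
have ai : rintegrable mu `[0, y]%classic (fun t => `|p.2 t|).
  by apply: integrable_norm => //; exact: gi.
have KE : K y - K x = \int[mu]_(t in `]x, y]) `|p.2 t| by exact: itvB_edge.
have k0 : 0 <= K y - K x by rewrite KE; exact: Rintegral_ge0.
have mE : fine (mu `]x, y]%classic) = y - x by exact: mu_itv.
have ci c : rintegrable mu `]x, y]%classic (fun=> c).
  by apply: rintegrable_cst => //; exact: itv_lty.
have gi' : rintegrable mu `]x, y]%classic p.2 by apply: itvS => //; exact: gi.
have E : Phi y - Phi x = \int[mu]_(t in `]x, y]) ((p.1 y - p.1 t) + (x - t) * p.2 t).
  have -> : \int[mu]_(t in `]x, y]) ((p.1 y - p.1 t) + (x - t) * p.2 t) =
      \int[mu]_(t in `]x, y]) ((p.1 y + x * p.2 t) - (p.1 t + t * p.2 t)).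
    by apply: eq_Rint => t _; ring.
  rewrite RintegralB//; last 2 first.
  - by apply: rintegrableD => //; exact: rintegrableZ.
  - by apply: itvS => //; exact: fi.
  rewrite RintegralD//; [|exact: ci|exact: rintegrableZ].
  rewrite RintegralZl// Rintegral_cst// mE -(pair_diff s2 pE x0 xy).
  by rewrite -itvB_edge//; [rewrite /Phi; ring|exact: fi].
rewrite E.
have iE : rintegrable mu `]x, y]%classic (fun t => (p.1 y - p.1 t) + (x - t) * p.2 t).
  have : rintegrable mu `]x, y]%classic
    (fun t => (p.1 y + x * p.2 t) - (p.1 t + t * p.2 t)).
    apply: rintegrableB => //; last by apply: itvS => //; exact: fi.
    by apply: rintegrableD => //; exact: rintegrableZ.
  by apply: rintegrable_eq => // t _; ring.
apply: le_trans (le_normr_Rintegral _ iE) _ => //.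
have ai' : rintegrable mu `]x, y]%classic (fun t => `|p.2 t|) by exact: itvS.
apply: (@le_trans _ _ (\int[mu]_(t in `]x, y]) ((K y - K x) + (y - x) * `|p.2 t|))).
  apply: le_Rintegral => //; first exact: integrable_norm.
    by apply: rintegrableD => //; exact: rintegrableZ.
  move=> t /=; rewrite in_itv/= => /andP[xt ty].
  apply: le_trans (ler_normD _ _) _; apply: lerD.
    have t0 : 0 <= t by exact: le_trans (ltW xt).
    rewrite (pair_diff s2 pE t0 ty) KE.
    have st : `]t, y]%classic `<=` `]x, y]%classic.
      by move=> z /=; rewrite !in_itv/= => /andP[/(lt_trans xt) -> ->].
    apply: (@le_trans _ _ (\int[mu]_(z in `]t, y]) `|p.2 z|)).
      by apply: le_normr_Rintegral => //; exact: integrableS gi'.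
    have i1 : rintegrable mu `]t, y]%classic (fun z => `|p.2 z|) by exact: integrableS ai'.
    rewrite -lee_fin -!rintegrableE//; apply: ge0_subset_integral => //.
    by apply/measurable_EFinP; exact: rintegrable_measurable ai'.
  rewrite normrM; apply: ler_wpM2r => //; rewrite ler_norml.
  by apply/andP; split; lra.
rewrite RintegralD//; [|exact: ci|exact: rintegrableZ].
rewrite RintegralZl// Rintegral_cst// mE -KE; lra.
Qed.

(** Multiplication by the cutoff that decreases linearly from [1] at [0] to [0]
    at [m], together with the derivative given by the product rule. *)
Definition cut m r : fpair :=
  (fun s => (1 - s / m) * r.1 s, fun s => (1 - s / m) * r.2 s - r.1 s / m).

Lemma cut_comb m (a : R) r p t : ((cut m (a *: r + p)).1 t = a * (cut m r).1 t + (cut m p).1 t) *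
  ((cut m (a *: r + p)).2 t = a * (cut m r).2 t + (cut m p).2 t).
Proof.
rewrite /cut /= -[(a *: r.1 + p.1) t]/(a * r.1 t + p.1 t).
by rewrite -[(a *: r.2 + p.2) t]/(a * r.2 t + p.2 t); split; ring.
Qed.

Lemma cut_deriv m v r : hl_dom v r -> 0 < m -> forall x, 0 <= x ->
  (cut m r).1 x = r.1 0 + \int[mu]_(t in `[0, x]) (cut m r).2 t.
Proof.
move=> [s1 s2 _ rE] m0 x x0 /=.
have gi := sqint_itv_integrable s2 x0; have ui := sqint_itv_integrable s1 x0.
have fi : rintegrable mu `[0, x]%classic (fun t => r.1 t + t * r.2 t).
  by apply: rintegrableD => //; exact: mul_id_integrable.
have -> : \int[mu]_(t in `[0, x]) ((1 - t / m) * r.2 t - r.1 t / m) =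
    \int[mu]_(t in `[0, x]) (- m^-1 * (r.1 t + t * r.2 t) + r.2 t).
  by apply: eq_Rint => t _; ring.
rewrite Rint_comb// -(pair_mul_id s1 s2 rE x0).
have -> : (1 - x / m) * r.1 x = r.1 x - m^-1 * (x * r.1 x) by ring.
by rewrite {1}(rE _ x0); ring.
Qed.

Lemma cut_factor m t : 1 <= m -> 0 <= t -> t <= m -> 0 <= 1 - t / m <= 1.
Proof.
move=> m1 t0 tm; have m0 : 0 < m by lra.
by rewrite subr_ge0 ler_pdivrMr// mul1r tm/= gerBl divr_ge0// ltW.
Qed.

Lemma cut1_le m r t : 1 <= m -> 0 <= t -> t <= m -> `|(cut m r).1 t| <= `|r.1 t|.
Proof.
move=> m1 t0 tm; have /andP[f0 f1] := cut_factor m1 t0 tm.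
by rewrite /cut/= normrM (ger0_norm f0) ler_piMl.
Qed.

Lemma cut2_le m r t : 1 <= m -> 0 <= t -> t <= m ->
  `|(cut m r).2 t| <= `|r.2 t| + `|r.1 t|.
Proof.
move=> m1 t0 tm; have /andP[f0 f1] := cut_factor m1 t0 tm.
rewrite /cut/=; apply: le_trans (ler_normB _ _) _; apply: lerD.
  by rewrite normrM (ger0_norm f0) ler_piMl.
rewrite normrM [`|m^-1|]ger0_norm ?invr_ge0; last by lra.
by rewrite ler_piMr// invf_le1//; lra.
Qed.

Lemma measurable_cut m r : measurable_fun edge r.1 -> measurable_fun edge r.2 ->
  measurable_fun edge (cut m r).1 /\ measurable_fun edge (cut m r).2.
Proof.
move=> m1 m2.
have mf : measurable_fun edge (fun t : R => 1 - t / m).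
  by apply: measurable_funB => //; apply: measurable_funM.
split; first exact: measurable_funM.
by apply: measurable_funB; [exact: measurable_funM|apply: measurable_funM].
Qed.

Lemma sqint_normD r : sqint mu edge r.1 -> sqint mu edge r.2 ->
  sqint mu edge (fun t => `|r.2 t| + `|r.1 t|).
Proof.
have N f : sqint mu edge f -> sqint mu edge (fun t => `|f t|).
  move=> [mf fi]; split; first exact: measurableT_comp.
  by apply: rintegrable_eq fi => // t _; rewrite real_normK ?num_real.
move=> s1 s2; have := sqint_comb measurable_edgeL 1 (N _ s2) (N _ s1).
move=> [mf fi]; split.
  by apply: eq_measurable_fun mf => t _; rewrite mul1r.
by apply: rintegrable_eq fi => // t _; rewrite mul1r.
Qed.

(** The integrand of the form at two cut functions. *)
Definition cutd m v r p t :=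
  (cut m r).2 t * (cut m p).2 t + v t * (cut m r).1 t * (cut m p).1 t.

(** A majorant of [cutd] independent of [m >= 1], for dominated convergence. *)
Definition cutbound v r p t :=
  (`|r.2 t| + `|r.1 t|) * (`|p.2 t| + `|p.1 t|) + `|v t * r.1 t * p.1 t|.

Lemma cutbound_integrable v r p : hl_pot v -> hl_dom v r -> hl_dom v p ->
  rintegrable mu edge (cutbound v r p).
Proof.
move=> hv dr dp; have [r1 r2 _ _] := dr; have [p1 p2 _ _] := dp.
apply: rintegrableD => //; first by apply: sqint_mul => //; exact: sqint_normD.
exact/integrable_norm/hl_dom_vmul.
Qed.

Lemma cutd_le m v r p t : 1 <= m -> 0 <= t -> t <= m ->
  `|cutd m v r p t| <= cutbound v r p t.
Proof.
move=> m1 t0 tm; apply: le_trans (ler_normD _ _) _; apply: lerD.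
  by rewrite normrM; apply: ler_pM => //; exact: cut2_le.
have nm (a b c : R) : `|a * b * c| = `|a| * (`|b| * `|c|) by rewrite !normrM mulrA.
rewrite !nm; apply: ler_wpM2l => //.
by apply: ler_pM => //; exact: cut1_le.
Qed.

Lemma measurable_cutd m v r p : hl_pot v -> hl_dom v r -> hl_dom v p ->
  measurable_fun edge (cutd m v r p).
Proof.
move=> [mv _] [[r1 _] [r2 _] _ _] [[p1 _] [p2 _] _ _].
have [a1 a2] := measurable_cut m r1 r2; have [b1 b2] := measurable_cut m p1 p2.
by apply: measurable_funD; apply: measurable_funM => //; exact: measurable_funM.
Qed.

Lemma sub_itv0_edge m : `[0, m]%classic `<=` edge.
Proof. exact: sub_itv_edge. Qed.

Lemma cutd_integrable m v r p : 1 <= m -> hl_pot v -> hl_dom v r -> hl_dom v p ->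
  rintegrable mu `[0, m]%classic (cutd m v r p).
Proof.
move=> m1 hv dr dp.
have iB : rintegrable mu `[0, m]%classic (cutbound v r p).
  apply: integrableS (cutbound_integrable hv dr dp) => //; exact: sub_itv0_edge.
apply: (rintegrable_le _ _ _ iB) => //.
  by apply: measurable_funS (measurable_cutd m hv dr dp) => //; exact: sub_itv0_edge.
by move=> t /=; rewrite in_itv/= => /andP[t0 tm]; exact: cutd_le.
Qed.

Lemma cutd_cvg v r p : hl_pot v -> hl_dom v r -> hl_dom v p ->
  \int[mu]_(t in `[0, n.+1%:R]) cutd n.+1%:R v r p t @[n --> \oo] --> hl_h v r p.
Proof.
move=> hv dr dp.
pose F (n : nat) (t : R) := (cutd n.+1%:R v r p \_ `[0, n.+1%:R]%classic) t.
have FE (n : nat) : \int[mu]_(t in `[0, n.+1%:R]) cutd n.+1%:R v r p t =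
    \int[mu]_(t in edge) F n t.
  exact: Rintegral_itv0_restrict.
have mF (n : nat) : measurable_fun edge (F n).
  apply/measurable_restrict => //.
  apply: measurable_funS (measurable_cutd n.+1%:R hv dr dp)  => //.
have iB := cutbound_integrable hv dr dp.
have n1 (n : nat) : 1 <= n.+1%:R :> R by rewrite ler1n.
have FB n t : edge t -> `|F n t| <= cutbound v r p t.
  rewrite edgeE => t0; rewrite /F patchE; case: ifP => [|_].
    by rewrite inE/= in_itv/= => /andP[_ tm]; exact: cutd_le.
  by rewrite normr0 /cutbound addr_ge0// mulr_ge0// addr_ge0.
have Fc t : edge t -> F n t @[n --> \oo] --> r.2 t * p.2 t + v t * r.1 t * p.1 t.
  rewrite edgeE => t0.
  have inv0 : (n.+1%:R^-1 : R) @[n --> \oo] --> (0 : R) by exact: cvg_harmonic.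
  have c1 (q : fpair) : (cut n.+1%:R q).1 t @[n --> \oo] --> q.1 t.
    rewrite -[X in _ --> X]mul1r -[X in X * _]subr0 -[X in _ - X](mulr0 t).
    apply: cvgM; last exact: cvg_cst.
    by apply: cvgB; [exact: cvg_cst|apply: cvgM => //; exact: cvg_cst].
  have c2 (q : fpair) : (cut n.+1%:R q).2 t @[n --> \oo] --> q.2 t.
    have -> : q.2 t = (1 - t * 0) * q.2 t - q.1 t * 0 by ring.
    apply: cvgB; last by apply: cvgM => //; exact: cvg_cst.
    apply: cvgM; last exact: cvg_cst.
    by apply: cvgB; [exact: cvg_cst|apply: cvgM => //; exact: cvg_cst].
  have cc : cutd n.+1%:R v r p t @[n --> \oo] --> r.2 t * p.2 t + v t * r.1 t * p.1 t.
    apply: cvgD; first exact: (cvgM (c2 r) (c2 p)).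
    apply: cvgM (c1 p); apply: cvgM (c1 r); exact: cvg_cst.
  apply: cvg_trans cc; apply: near_eq_cvg.
  exists (Num.truncn t) => // n /= tn; rewrite /F patchE mem_set//= in_itv/= t0/=.
  have /andP[_ /ltW tt] := truncn_itv t0; apply: le_trans tt _.
  by rewrite ler_nat ltnS.
pose L t := r.2 t * p.2 t + v t * r.1 t * p.1 t.
have iL : rintegrable mu edge L by exact: hl_dom_hmul.
have [_ _ dc] : [/\ mu.-integrable edge (EFin \o L),
    [sequence \int[mu]_(t in edge) `|(F n t)%:E - (L t)%:E|]_n @ \oo --> 0 &
    [sequence \int[mu]_(t in edge) (F n t)%:E]_n @ \oo --> \int[mu]_(t in edge) (L t)%:E]%E.
  apply: (@dominated_convergence _ (measurableTypeR R) R mu edge measurable_edgeL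
    (fun n t => (F n t)%:E) (EFin \o L) (EFin \o cutbound v r p)).
  - by move=> n; apply/measurable_EFinP; exact: mF.
  - by apply/measurable_EFinP; exact: rintegrable_measurable iL.
  - by apply: aeW => t Et; apply: cvg_EFin; [exact: nearW|exact: Fc].
  - exact: iB.
  - by apply: aeW => t n Et; rewrite lee_fin; exact: FB.
rewrite (_ : (fun n : nat => _) = (fun n => fine (\int[mu]_(t in edge) (F n t)%:E)%E)); last first.
  by apply/funext => n; rewrite FE.
apply: fine_cvg; rewrite fineK; first exact: dc.
exact: (integrable_fin_num measurable_edgeL iL).
Qed.

End cutting.

(** * Joining two edge functions into one half-line function *)

Section joining.
Context {R : realType}.
Notation mu := (@lebesgue_measure R).
Notation edge := (edge R).
Notation fpair := ((R -> R) * (R -> R))%type.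
Implicit Types (p r : fpair).
Variables (v0 v1 : R -> R) (m : R).
Hypotheses (m1 : 1 <= m) (h0 : hl_pot v0) (h1 : hl_pot v1).

Let m0 : 0 < m. Proof. by rewrite (lt_le_trans ltr01). Qed.

Let edge_itv (f : R -> R) : measurable_fun edge f -> measurable_fun `[0, m]%classic f.
Proof. by move=> mf; apply: measurable_funS mf => //; exact: sub_itv0_edge. Qed.

Let edge_itv_int (f : R -> R) : rintegrable mu edge f -> rintegrable mu `[0, m]%classic f.
Proof. by move=> fi; apply: integrableS fi => //; exact: sub_itv0_edge. Qed.

Lemma hl_pot_glue (q : R) : 1 <= q ->
  rintegrable mu edge (fun t => v0^\- t `^ q) ->
  rintegrable mu edge (fun t => v1^\- t `^ q) -> hl_pot (glue m v0 v1).
Proof.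
move=> q1 i0 i1; split.
  by apply: measurable_glue => //; [case: h0|apply: edge_itv; case: h1].
exists q => //.
apply: rintegrable_eq (rintegrable_glue m0 i0 (edge_itv_int i1)) => // t _.
by rewrite /funrneg /glue; case: ifP.
Qed.

(** The edge functions glued after cutting the second one; the sign of the
    second derivative is due to the reversal of the edge. *)
Definition join p r : fpair :=
  (glue m p.1 (cut m r).1, glue m p.2 (fun s => - (cut m r).2 s)).

Lemma join0 p r : (join p r).1 0 = 0.
Proof.
by rewrite /join /= glue_l// subr0 divff ?gt_eqF// subrr mul0r.
Qed.

Let sqint_glue (f1 f2 : R -> R) : sqint mu edge f1 -> sqint mu `[0, m]%classic f2 ->
  sqint mu edge (glue m f1 f2).
Proof.
move=> [mf1 i1] [mf2 i2]; split; first exact: measurable_glue.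
apply: rintegrable_eq (rintegrable_glue m0 i1 i2) => // t _.
by rewrite /glue; case: ifP.
Qed.

Lemma sqint_cut r : hl_dom v1 r -> sqint mu `[0, m]%classic (cut m r).1 /\
  sqint mu `[0, m]%classic (cut m r).2.
Proof.
move=> [s1 s2 _ _]; have [c1 c2] := measurable_cut m s1.1 s2.1.
have [mN iN] := sqint_normD s1 s2.
split; split; do ?exact: edge_itv.
  apply: (rintegrable_le _ _ _ (edge_itv_int s1.2)) => //.
    by apply: measurable_funX; exact: edge_itv.
  move=> t /=; rewrite in_itv/= => /andP[t0 tm].
  by rewrite ger0_norm ?sqr_ge0//; apply: ler_sqr_norm; exact: cut1_le.
apply: (rintegrable_le _ _ _ (edge_itv_int iN)) => //.
  by apply: measurable_funX; exact: edge_itv.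
move=> t /=; rewrite in_itv/= => /andP[t0 tm].
rewrite ger0_norm ?sqr_ge0//; apply: ler_sqr_norm.
by rewrite [leRHS]ger0_norm ?addr_ge0//; exact: cut2_le.
Qed.

Lemma cut_pos_integrable r : hl_dom v1 r ->
  rintegrable mu `[0, m]%classic (fun t => v1^\+ t * (cut m r).1 t ^+ 2).
Proof.
move=> [s1 s2 s3 _]; have [c1 c2] := measurable_cut m s1.1 s2.1.
have mv : measurable_fun edge v1^\+ by apply: measurable_funrpos; case: h1.
apply: (rintegrable_le _ _ _ (edge_itv_int s3)) => //.
  by apply: measurable_funM; [exact: edge_itv|apply: measurable_funX; exact: edge_itv].
move=> t /=; rewrite in_itv/= => /andP[t0 tm].
rewrite ger0_norm; last by apply: mulr_ge0; [exact: funrpos_ge0|exact: sqr_ge0].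
apply: ler_wpM2l; first exact: funrpos_ge0.
by apply: ler_sqr_norm; exact: cut1_le.
Qed.

(** The joined function vanishes at the endpoint thanks to the cutoff and is
    continuous at [m] because the edge functions agree at the vertex.  The
    integral formula is checked separately before and after [m]. *)
Lemma hl_dom_join p r : hl_dom v0 p -> hl_dom v1 r -> p.1 0 = r.1 0 ->
  hl_dom (glue m v0 v1) (join p r).
Proof.
move=> dp dr pr0; have [p1 p2 p3 pE] := dp; have [r1 r2 r3 rE] := dr.
have [c1 c2] := sqint_cut dr.
have c2N : sqint mu `[0, m]%classic (fun s => - (cut m r).2 s).
  split; first by apply: measurable_funN; case: c2.
  by apply: rintegrable_eq c2.2 => // t _; rewrite sqrrN.
split.
- exact: sqint_glue.
- exact: sqint_glue.
- apply: rintegrable_eq (rintegrable_glue m0 p3 (cut_pos_integrable dr)) => // t _.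
  by rewrite /funrpos /join /glue/=; case: ifP.
- move=> x x0; rewrite join0 add0r /=.
  have cE := cut_deriv dr m0.
  have ic y : rintegrable mu [set` Interval y (BRight m)] (cut m r).2 ->
      \int[mu]_(t in [set` Interval y (BRight m)]) (- (cut m r).2 t) =
      - \int[mu]_(t in [set` Interval y (BRight m)]) (cut m r).2 t.
    move=> i; rewrite -mulN1r -RintegralZl//.
    by apply: eq_Rint => t _; rewrite mulN1r.
  have i2 : rintegrable mu `[0, m]%classic (cut m r).2.
    by apply: sqint_integrable => //; exact: itv_lty.
  have i2N : rintegrable mu `[0, m]%classic (fun s => - (cut m r).2 s).
    by apply: sqint_integrable => //; exact: itv_lty.
  have cm : (cut m r).1 m = 0.
    by rewrite /cut/= divff ?gt_eqF// subrr mul0r.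
  have ic0 : \int[mu]_(t in `[0, m]) (cut m r).2 t = - r.1 0.
    by apply: (@addrI _ (r.1 0)); rewrite -cE ?(ltW m0)// cm subrr.
  have [mx|xm] := leP m x.
    have xm0 : 0 <= x - m by rewrite subr_ge0.
    rewrite glue_r// Rintegral_glue_r//; last exact: sqint_itv_integrable.
    by rewrite ic// ic0 opprK -pr0 [RHS]addrC -pE.
  have mx0 : 0 <= m - x by rewrite subr_ge0 ltW.
  have mxm : m - x <= m by rewrite gerBl.
  rewrite glue_l// (Rintegral_glue_l _ i2N x0 xm).
  have sub : `[m - x, m]%classic `<=` `[0, m]%classic.
    by apply: subset_itvr; rewrite bnd_simp.
  rewrite ic; last exact: integrableS i2.
  rewrite -Rintegral_itv_obnd_cbnd; last first.
    by apply: integrableS i2 => //; apply: subset_trans sub; apply: subset_itvr; rewrite bnd_simp.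
  rewrite -itvB_edge// ic0; rewrite -[(1 - _) * _]/((cut m r).1 (m - x)) cE//; ring.
Qed.

Lemma hl_b_join_le p r : hl_dom v0 p -> hl_dom v1 r ->
  hl_b (join p r) (join p r) <= hl_b p p + hl_b r r.
Proof.
move=> dp dr; have [[_ ip] _ _ _] := dp; have [s1 _ _ _] := dr.
have [c1 _] := sqint_cut dr.
rewrite !hl_bE /sqA.
have -> : \int[mu]_(t in edge) ((join p r).1 t ^+ 2) =
  \int[mu]_(t in edge) glue m (fun t => p.1 t ^+ 2) (fun t => (cut m r).1 t ^+ 2) t.
  by apply: eq_Rint => t _; rewrite /join /glue /=; case: ifP.
rewrite (Rintegral_glue m0 ip c1.2) lerD2l.
apply: (@le_trans _ _ (\int[mu]_(t in `[0, m]) (r.1 t ^+ 2))).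
  apply: le_Rintegral => //; [exact: c1.2|exact: (edge_itv_int s1.2)|].
  move=> t /=; rewrite in_itv/= => /andP[t0 tm].
  by apply: ler_sqr_norm; exact: cut1_le.
apply: Rint_subset => //; [exact: sub_itv0_edge| |exact: s1.2].
by move=> t _; exact: sqr_ge0.
Qed.

Lemma hl_h_join p r p' r' : hl_dom v0 p -> hl_dom v1 r -> hl_dom v0 p' -> hl_dom v1 r' ->
  hl_h (glue m v0 v1) (join p r) (join p' r') =
  hl_h v0 p p' + \int[mu]_(t in `[0, m]) cutd m v1 r r' t.
Proof.
move=> dp dr dp' dr'.
rewrite -(Rintegral_glue m0 (hl_dom_hmul h0 dp dp') (cutd_integrable m1 h1 dr dr')).
apply: eq_Rint => t _; rewrite /join /glue /cutd /=; case: ifP => // _.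
by rewrite mulrNN.
Qed.

End joining.

(** * Transplantation from the line to the half-line *)

Section transplantation.
Context {R : realType}.
Notation mu := (@lebesgue_measure R).
Notation edge := (edge R).
Variables (V : starpot R 2) (q : R).
Hypotheses (q1 : 1 <= q)
  (hq : forall j, rintegrable mu edge (fun t => (V j)^\- t `^ q)).
Notation E := (starspace V false).
Let o1 : 'I_2 := lift ord0 ord0.

Definition glue_pot m (m1 : 1 <= m) : starpot R 1 :=
  StarPot (fun=> hl_pot_glue m1 (starpotP V ord0) (starpotP V o1) q1 (hq ord0) (hq o1)).

Lemma transplant_dom m (m1 : 1 <= m) (u : E) :
  star_dom (glue_pot m1) true (fun=> join m (val u ord0) (val u o1)).
Proof.
have [_ uE _] := star_valP u.
split=> [j|//|_ j]; last exact: join0.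
exact: (hl_dom_join m1 (starpotP V o1) (star_hl_dom u ord0) (star_hl_dom u o1) (uE _ _)).
Qed.

Definition transplant m (m1 : 1 <= m) (u : E) : starspace (glue_pot m1) true :=
  mkstar (transplant_dom m1 u).

Lemma transplant_comb m (m1 : 1 <= m) (a : R) (u w : E) :
  transplant m1 (a *: u + w) = a *: transplant m1 u + transplant m1 w.
Proof.
apply: val_inj; apply/funext => i; rewrite star_val_comb.
rewrite [RHS](surjective_pairing _) /=; congr (_, _); apply/funext => t.
  rewrite -[RHS]/(a * glue m (val u ord0).1 (cut m (val u o1)).1 t +
    glue m (val w ord0).1 (cut m (val w o1)).1 t).
  by rewrite /glue; case: ifP => // _; exact: (cut_comb m a (val u o1) (val w o1) _).1.
rewrite -[RHS]/(a * glue m (val u ord0).2 (fun s => - (cut m (val u o1)).2 s) t +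
    glue m (val w ord0).2 (fun s => - (cut m (val w o1)).2 s) t).
rewrite /glue; case: ifP => // _.
by rewrite (cut_comb m a (val u o1) (val w o1) _).2; ring.
Qed.

Lemma transplant_sum m (m1 : 1 <= m) (I : finType) (c : I -> R) (x : I -> E) :
  transplant m1 (\sum_i c i *: x i) = \sum_i c i *: transplant m1 (x i).
Proof.
have T0 : transplant m1 0 = 0.
  have := transplant_comb m1 (-1) 0 0; rewrite scaler0 addr0 => ->.
  by rewrite scaleN1r addNr.
elim/big_rec2: _ => [//|i y z _ <-]; exact: transplant_comb.
Qed.

Lemma star_b2 (u w : E) :
  star_b u w = hl_b (val u ord0) (val w ord0) + hl_b (val u o1) (val w o1).
Proof. by rewrite /star_b big_ord_recl big_ord1. Qed.

Lemma transplant_b_le m (m1 : 1 <= m) (u : E) :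
  star_b (transplant m1 u) (transplant m1 u) <= star_b u u.
Proof.
rewrite star_b2 /star_b big_ord1.
exact: (hl_b_join_le m1 (star_hl_dom u ord0) (star_hl_dom u o1)).
Qed.

(** On the uncut edge the form is preserved, on the cut edge it converges. *)
Lemma transplant_h_cvg (u w : E) (m1 : forall n : nat, 1 <= n.+1%:R :> R) :
  star_h (transplant (m1 n) u) (transplant (m1 n) w) @[n --> \oo] --> star_h u w.
Proof.
have hE n : star_h (transplant (m1 n) u) (transplant (m1 n) w) =
   hl_h (V ord0) (val u ord0) (val w ord0) +
   \int[mu]_(t in `[0, n.+1%:R]) cutd n.+1%:R (V o1) (val u o1) (val w o1) t.
  rewrite /star_h big_ord1.
  exact: (hl_h_join (m1 n) (starpotP V ord0) (starpotP V o1) (star_hl_dom u ord0)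
    (star_hl_dom u o1) (star_hl_dom w ord0) (star_hl_dom w o1)).
rewrite (_ : (fun n => _) = (fun n => hl_h (V ord0) (val u ord0) (val w ord0) +
   \int[mu]_(t in `[0, n.+1%:R]) cutd n.+1%:R (V o1) (val u o1) (val w o1) t)); last first.
  by apply/funext.
have -> : star_h u w = hl_h (V ord0) (val u ord0) (val w ord0) +
  hl_h (V o1) (val u o1) (val w o1) by rewrite /star_h big_ord_recl big_ord1.
apply: cvgD; first exact: cvg_cst.
by apply: cutd_cvg; [exact: starpotP|exact: star_hl_dom|exact: star_hl_dom].
Qed.

(** For large [m] the form matrix of the transplanted eigenvectors differs from
    the diagonal matrix of the [nu i] by at most [d = e / k.+1] in each entry,
    hence as a quadratic form by at most [k * d <= e], while the [b]-norms do not
    increase; the variational principle applies with [mu i = nu i + e]. *)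
Lemma eigtrace_glue_ge (gamma : R) k (f : 'I_k -> E) nu (e : R) :
  0 <= gamma -> star_eigsys V false f nu ->
  0 < e -> (forall i, nu i + e < 0) ->
  exists m (m1 : 1 <= m), ((\sum_i `|nu i + e| `^ gamma)%:E <=
    star_trace (glue_pot m1) true gamma)%E.
Proof.
move=> g0 [fo fe] e0 nue.
have n1 (n : nat) : 1 <= n.+1%:R :> R by rewrite ler1n.
pose d := e / k.+1%:R.
have d0 : 0 < d by rewrite divr_gt0.
have hfE i j : star_h (f i) (f j) = nu i * (i == j)%:R by rewrite fe fo.
have /choice[N NP] : forall x : 'I_k * 'I_k, exists N : nat, forall n, (N <= n)%N ->
    `|nu x.1 * (x.1 == x.2)%:R -
      star_h (transplant (n1 n) (f x.1)) (transplant (n1 n) (f x.2))| <= d.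
  move=> [i j] /=; have := @transplant_h_cvg (f i) (f j) n1; rewrite hfE.
  by move=> /cvgrPdist_le/(_ _ d0)[n _ H]; exists n => l; exact: H.
pose n := \max_x N x.
have hn i j : `|nu i * (i == j)%:R -
    star_h (transplant (n1 n) (f i)) (transplant (n1 n) (f j))| <= d.
  by apply: (NP (i, j)); exact: leq_bigmax.
exists n.+1%:R, (n1 n).
apply: (eigtrace_ge_variational (w := fun i => transplant (n1 n) (f i))) => // c.
  rewrite -transplant_sum; apply: le_trans (transplant_b_le _ _) _.
  rewrite (symform_sum_sum (symform_star_b V false)).
  have -> : \sum_i c i ^+ 2 = \sum_i 1 * c i ^+ 2 by apply: eq_bigr => i _; rewrite mul1r.
  rewrite -sum_sum_diag le_eqVlt; apply/orP; left; apply/eqP.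
  by apply: eq_bigr => i _; apply: eq_bigr => j _; rewrite mul1r fo.
rewrite (symform_sum_sum (symform_star_h _ true)).
apply: (@le_trans _ _ (\sum_i \sum_j (c i * c j * (nu i * (i == j)%:R) +
    d * ((c i ^+ 2 + c j ^+ 2) / 2)))).
  apply: ler_sum => i _; apply: ler_sum => j _.
  rewrite -lerBlDl -mulrBr; apply: le_trans (ler_norm _) _.
  rewrite normrM mulrC distrC; apply: ler_pM => //.
  rewrite ler_norml; have := sqr_ge0 (c i - c j); have := sqr_ge0 (c i + c j).
  by rewrite sqrrB sqrrD => *; apply/andP; split; lra.
have -> : \sum_i \sum_j (c i * c j * (nu i * (i == j)%:R) +
    d * ((c i ^+ 2 + c j ^+ 2) / 2)) =
    \sum_i nu i * c i ^+ 2 + d * (k%:R * \sum_i c i ^+ 2).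
  rewrite -sum_sum_diag; under eq_bigr do rewrite big_split/=.
  rewrite big_split/=; congr (_ + _).
  under eq_bigr do rewrite -mulr_sumr -mulr_suml big_split/= sumr_const card_ord.
  rewrite -mulr_sumr -mulr_suml big_split/= sumr_const card_ord.
  by rewrite sumrMnl mulr_natl; congr (_ * _); move: (_ *+ k) => S; field.
rewrite (_ : \sum_i (nu i + e) * c i ^+ 2 = \sum_i nu i * c i ^+ 2 + e * \sum_i c i ^+ 2).
  rewrite lerD2l mulrA; apply: ler_wpM2r; first by apply: sumr_ge0 => i _; exact: sqr_ge0.
  rewrite /d mulrAC ler_pdivrMr//; apply: ler_wpM2l; first exact: ltW.
  by rewrite ler_nat.
by rewrite mulr_sumr -big_split/=; apply: eq_bigr => i _; rewrite mulrDl.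
Qed.

End transplantation.

(** * The Lieb--Thirring constants *)

Lemma lee_sum_const {R : realDomainType} n (x y : \bar R) : (0 < n)%N ->
  (\sum_(i < n) x <= \sum_(i < n) y)%E -> (x <= y)%E.
Proof.
case: n => [//|n] _.
have yS k : (\sum_(i < k) +oo)%E != -oo%E :> \bar R.
  by rewrite gt_eqF// (@lt_le_trans _ _ 0%E)//; exact: sume_ge0.
case: x => [x||]; case: y => [y||] //=; rewrite ?leey ?leNye//.
- by rewrite !sumEFin !lee_fin !sumr_const ler_pMn2r// card_ord.
- by rewrite [leRHS]big_ord_recl addNye sumEFin leeNy_eq.
- by rewrite sumEFin big_ord_recl addye// leye_eq.
- by rewrite [leRHS]big_ord_recl addNye leeNy_eq big_ord_recl addye.
Qed.

(** Shifting by a small multiple of the smallest [`|nu i|] multiplies each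
    [`|nu i|] by at least [s < 1]; with [s] the [gamma]-th root of [t] the sum
    is multiplied by at least [t], and [t] tends to [1]. *)
Lemma le_sum_powR_shift {R : realType} k (nu : 'I_k -> R) (gamma r : R) :
  0 < gamma -> (forall i, nu i < 0) ->
  (forall e, 0 < e -> (forall i, nu i + e < 0) -> \sum_i `|nu i + e| `^ gamma <= r) ->
  \sum_i `|nu i| `^ gamma <= r.
Proof.
move=> g0 nu0 H; set S := \sum_i _.
have S0 : 0 <= S by apply: sumr_ge0 => i _; exact: powR_ge0.
have tS t : 0 < t -> t < 1 -> t * S <= r.
  move=> t0 t1; pose s := t `^ gamma^-1.
  have s0 : 0 < s by exact: powR_gt0.
  have s1 : s < 1.
    have <- : 1 `^ gamma^-1 = 1 :> R by rewrite powR1.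
    by rewrite gt0_ltr_powR ?invr_gt0// nnegrE ltW.
  have sg : s `^ gamma = t by rewrite -powRrM mulVf ?gt_eqF// powRr1// ltW.
  pose c : R := \big[Num.min/1]_i `|nu i|.
  have c0 : 0 < c by apply: lt_bigmin => // i _; rewrite normr_gt0 lt_eqF.
  have cnu i : c <= - nu i by rewrite -ltr0_norm//; exact: bigmin_le.
  pose e := (1 - s) * c.
  have e0 : 0 < e by rewrite mulr_gt0 ?subr_gt0.
  have enu i : s * - nu i <= - (nu i + e).
    have := ler_wpM2l (_ : 0 <= 1 - s) (cnu i).
    by rewrite subr_ge0 ltW// -/e => /(_ isT); lra.
  have nue i : nu i + e < 0.
    by rewrite -oppr_gt0; apply: lt_le_trans (enu i); rewrite mulr_gt0// oppr_gt0.
  apply: le_trans (H e e0 nue); rewrite mulr_sumr; apply: ler_sum => i _.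
  rewrite -sg -powRM ?(ltW s0)//.
  apply: ge0_ler_powR; rewrite ?nnegrE ?mulr_ge0 ?(ltW s0) ?(ltW g0)//.
  by rewrite !ltr0_norm.
rewrite leNgt; apply/negP => rS.
have r0 : 0 <= r.
  by apply: le_trans (tS (1 / 2) _ _); [rewrite mulr_ge0//; lra|lra|lra].
have S1 : 0 < S by exact: le_lt_trans rS.
have := tS ((r + S) / (2 * S)).
rewrite divr_gt0 ?ltr_pdivrMr ?ltr_pwDr// ?mulr_gt0// mul1r => /(_ isT).
have -> : r + S < 2 * S by lra.
move=> /(_ isT); have -> : (r + S) / (2 * S) * S = (r + S) / 2.
  by field; rewrite gt_eqF.
by lra.
Qed.

Section Lieb_Thirring.
Context {R : realType}.
Notation mu := (@lebesgue_measure R).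
Notation edge := (edge R).

Definition negint (s : R) (v : R -> R) : \bar R :=
  (\int[mu]_(t in edge) (v^\- t `^ s)%:E)%E.

Lemma negint_ge0 s v : (0 <= negint s v)%E.
Proof. by apply: integral_ge0 => t _; rewrite lee_fin powR_ge0. Qed.

Lemma admissible_const N (v : R -> R) : hl_pot v ->
  (forall a : R, 0 < a -> rintegrable mu `[0, a]%classic v^\+) ->
  admissible (fun _ : 'I_N => v).
Proof.
move=> [mv [p p1 ip]] pv; split=> [//||j]; last exact: pv.
exists p => //; apply/star_integral_ltyP => [j t _|j]; first by rewrite lee_fin powR_ge0.
apply: (rintegrable_ge0P mu _ _).1 => //.
  exact: (rintegrable_measurable ip).
by move=> t _; exact: powR_ge0.
Qed.

Lemma trace_neg_ge0 N (V : starfun N R R) gamma : (0 <= trace_neg gamma V)%E.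
Proof.
apply: esum_ge0 => x _; apply: mule_ge0; first exact: multiplicity_ge0.
by rewrite lee_fin powR_ge0.
Qed.

Definition LT_bound N (gamma L : R) (K : set (starfun N R R)) :=
  forall V : starfun N R R, admissible V -> K V ->
    (trace_neg gamma V <=
     L%:E * star_integral (fun j t => (((V j)^\- t) `^ (gamma + 2^-1))%:E))%E.

(** The well of depth [1] on [[0, 1]] has positive finite potential integral. *)
Lemma LT_bound_ge0 N (gamma L : R) : (0 < N)%N -> 0 < gamma ->
  LT_bound gamma L [set V : starfun N R R | radial V] -> 0 <= L.
Proof.
move=> N0 g0 H; pose v : R -> R := fun t => - \1_(`[0, 1]%classic) t.
have mI : measurable_fun edge (\1_(`[0, 1]%classic) : R -> R).
  by apply: measurable_indic; exact: measurable_itv.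
have vn t : v^\- t = \1_(`[0, 1]%classic) t.
  by rewrite /funrneg /v opprK; apply/max_idPl; rewrite indicE.
have vp t : v^\+ t = 0.
  by rewrite /funrpos /v; apply/max_idPr; rewrite oppr_le0 indicE.
have vns t (s : R) : s != 0 -> v^\- t `^ s = \1_(`[0, 1]%classic) t.
  by move=> s0; rewrite vn indicE; case: (_ \in _); rewrite ?powR1 ?powR0.
have I1 (s : R) : s != 0 -> negint s v = 1%E.
  move=> s0; transitivity (\int[mu]_(t in edge) (\1_(`[0%R, 1%R]%classic) t)%:E)%E.
    by apply: eq_integral => t _; rewrite vns.
  rewrite integral_indic//.
  rewrite setIidl; last exact: sub_itv_edge.
  by rewrite [LHS]lebesgue_measure_itv/= lte_fin ltr01 -EFinB subr0.
have hv : hl_pot v.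
  split; first exact: measurable_funN.
  exists 1 => //; apply: (rintegrable_ge0P mu _ _).2.
  - rewrite (_ : (fun t => _) = \1_(`[0, 1]%classic))//.
    by apply/funext => t; rewrite vns ?oner_neq0.
  - by move=> t _; exact: powR_ge0.
  - by rewrite -/(negint 1 v) I1 ?ltry ?oner_neq0.
have := H (fun=> v) (admissible_const _ hv _) _.
rewrite /star_integral (eq_bigr (fun=> 1%E)); last first.
  by move=> j _; apply: I1; rewrite gt_eqF// addr_gt0// invr_gt0.
rewrite sumEFin -EFinM sumr_const card_ord => HL.
have : (0 <= (L * N%:R)%:E)%E.
  apply: le_trans (trace_neg_ge0 _ _) (HL _ _) => // a a0.
  have i0 : rintegrable mu `[0, a]%classic (fun=> 0).
    by apply: rintegrable_cst => //; exact: itv_lty.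
  by apply: rintegrable_eq i0 => // t _; rewrite vp.
by rewrite lee_fin pmulr_lge0// ltr0n.
Qed.

Lemma negint_radial n (V : starfun n.+1 R R) s : radial V ->
  star_integral (fun j t => (((V j)^\- t) `^ s)%:E) =
  (\sum_(j < n.+1) negint s (V ord0))%E.
Proof.
move=> radV; apply: eq_bigr => j _; apply: eq_integral => t /set_mem.
by rewrite edgeE => t0; rewrite /funrneg (radV j ord0 t t0).
Qed.

Lemma LT_bound_radial n (V : starpot R n.+1) (gamma L : R) : (0 < n)%N ->
  radial V -> admissible V ->
  LT_bound gamma L [set V : starfun n.+1 R R | radial V] ->
  (star_trace (profile V) false gamma +
   \sum_(l < n) star_trace (profile V) true gamma <=
   \sum_(j < n.+1) L%:E * negint (gamma + 2^-1) (V ord0))%E.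
Proof.
move=> n0 radV admV H; rewrite -radial_trace//.
apply: le_trans (H V admV radV) _; rewrite negint_radial//.
by rewrite ge0_sume_distrr// => j _; exact: negint_ge0.
Qed.

(** The trace on the star is a sum of [n.+1] half-line traces, the Neumann one
    included, each of which is at least the Dirichlet trace. *)
Lemma dirichlet_trace_le n (V : starpot R n.+1) (gamma L : R) : (0 < n)%N ->
  radial V -> admissible V -> 0 <= gamma ->
  LT_bound gamma L [set V : starfun n.+1 R R | radial V] ->
  (star_trace (profile V) true gamma <=
   L%:E * negint (gamma + 2^-1) (V ord0))%E.
Proof.
move=> n0 radV admV g0 H; apply: (@lee_sum_const _ n.+1) => //.
apply: le_trans (LT_bound_radial n0 radV admV H).
by rewrite big_ord_recl leeD2r// dirichlet_le_neumann.
Qed.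

Lemma admissible_edge N (V : starfun N R R) j : admissible V ->
  admissible (fun _ : 'I_2 => V j).
Proof.
move=> admV; apply: admissible_const; first exact: admissible_hl_pot.
by case: admV => _ _ + a a0; exact.
Qed.

(** The profile of the radial potential, extended evenly, is a potential on the
    line; it controls one Neumann and one Dirichlet trace, and each further edge
    adds a Dirichlet trace. *)
Lemma LT_bound_line_rad n (gamma L : R) : (0 < n)%N -> 0 <= gamma ->
  LT_bound gamma L [set: starfun 2 R R] ->
  LT_bound gamma L [set V : starfun n.+1 R R | radial V].
Proof.
case: n => [//|n] _ g0 H V admV radV.
pose W : starpot R n.+2 := StarPot (admissible_hl_pot admV).
pose W2 : starpot R 2 := StarPot (fun=> starpotP W ord0).
have adm2 : admissible W2 by exact: (admissible_edge ord0 admV).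
have rad2 : radial W2 by [].
have H2 : LT_bound gamma L [set V : starfun 2 R R | radial V].
  by move=> V' admV' _; exact: H.
have := dirichlet_trace_le (V := W2) isT rad2 adm2 g0 H2.
have := LT_bound_radial (V := W2) isT rad2 adm2 H2.
rewrite (@radial_trace _ _ W)// negint_radial// ge0_sume_distrr; last first.
  by move=> j _; exact: negint_ge0.
rewrite -/(profile W) -[W2 ord0]/(V ord0) -[profile W2]/(profile W).
set F := eigtrace _ _ _; set D := eigtrace _ _ _; set Y := (_ * _)%E.
rewrite big_ord1 !big_ord_recl big_ord0 adde0 => FD DY.
rewrite [in leRHS]addeA addeA; apply: leeD => //.
by apply: lee_sum => i _.
Qed.

Section glued_potential.
Variables (v0 v1 : R -> R) (m : R).
Hypothesis m1 : 1 <= m.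
Let m0 : 0 < m. Proof. by rewrite (lt_le_trans ltr01). Qed.

(** The first component is truncated at [a] to become integrable on the whole
    edge, which does not affect the glued function on [[0, a]]. *)
Lemma loc_integrable_glue :
  (forall a : R, 0 < a -> rintegrable mu `[0, a]%classic v0^\+) ->
  (forall a : R, 0 < a -> rintegrable mu `[0, a]%classic v1^\+) ->
  forall a : R, 0 < a -> rintegrable mu `[0, a]%classic (glue m v0 v1)^\+.
Proof.
move=> i0 i1 a a0; pose f (t : R) := if t <= a then v0^\+ t else 0.
have fi : rintegrable mu edge f.
  have sub : `[0, a]%classic `<=` edge by exact: sub_itv_edge.
  have := i0 a a0; rewrite -[X in rintegrable _ X _](setIidr sub).
  move=> /(integrable_restrict mu _ measurable_edgeL _).1.
  move=> /(_ (measurable_itv _)) fi; apply: (eq_integrable measurable_edgeL _ _ _ fi).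
  move=> t /set_mem; rewrite edgeE patchE /= /f => t0.
  have -> : (t \in `[0, a]%classic) = (t <= a).
    by apply/idP/idP => [/set_mem|ta]; [|apply/mem_set]; rewrite /= in_itv/= t0.
  by case: ifP.
have gi : rintegrable mu `[0, a]%classic (glue m f v1^\+).
  have gi := rintegrable_glue m0 fi (i1 m m0).
  by apply: integrableS gi => //; exact: sub_itv_edge.
apply: rintegrable_eq gi => // t /=; rewrite in_itv/= => /andP[t0 ta].
rewrite /funrpos /glue /f; case: ifPn => // mt.
by rewrite ifT// (le_trans _ ta)// gerBl ltW.
Qed.

Lemma negint_glue_le s : measurable_fun edge v0 -> measurable_fun edge v1 ->
  (negint s (glue m v0 v1) <= negint s v0 + negint s v1)%E.
Proof.
move=> mv0 mv1.
have mp (v : R -> R) : measurable_fun edge v -> measurable_fun edge (fun t => v^\- t `^ s).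
  by move=> mv; apply: (measurableT_comp (measurable_powR _)) => //; exact: measurable_funrneg.
have sub : `[0, m]%classic `<=` edge by exact: sub_itv_edge.
rewrite /negint.
have -> : (\int[mu]_(t in edge) ((glue m v0 v1)^\- t `^ s)%:E =
  \int[mu]_(t in edge) (glue m (fun t => v0^\- t `^ s) (fun t => v1^\- t `^ s) t)%:E)%E.
  by apply: eq_integral => t _; rewrite /funrneg /glue; case: ifP.
rewrite ge0_integral_glue//; [|exact: mp|exact: measurable_funS (mp _ mv1)|..];
  do ?[by move=> t; exact: powR_ge0].
rewrite leeD2l//; apply: ge0_subset_integral => //.
  by apply/measurable_EFinP; exact: mp.
by move=> t _; rewrite lee_fin powR_ge0.
Qed.

End glued_potential.

(** The Dirichlet bound at the radial star potential whose profile is the glued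
    potential does not involve [m], since gluing only loses part of the
    integral; so the limits over [m] and then [e] can be taken. *)
Lemma LT_bound_rad_line n (gamma L : R) : (0 < n)%N -> 0 < gamma ->
  LT_bound gamma L [set V : starfun n.+1 R R | radial V] ->
  LT_bound gamma L [set: starfun 2 R R].
Proof.
move=> n0 g0 H V admV _; have g0' := ltW g0.
have L0 := LT_bound_ge0 (ltn0Sn n) g0 H.
pose W : starpot R 2 := StarPot (admissible_hl_pot admV).
have [mV _ locV] := admV.
have [p p1 hp] : exists2 p : R, 1 <= p &
    forall j, rintegrable mu edge (fun t => (W j)^\- t `^ p) := admissible_exponent admV.
pose X := (L%:E * (negint (gamma + 2^-1) (V ord0) +
  negint (gamma + 2^-1) (V (lift ord0 ord0))))%E.
have -> : star_integral (fun j t => (((V j)^\- t) `^ (gamma + 2^-1))%:E) =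
    (negint (gamma + 2^-1) (V ord0) + negint (gamma + 2^-1) (V (lift ord0 ord0)))%E.
  by rewrite /star_integral big_ord_recl big_ord1.
rewrite -/X.
have sysX k (f : 'I_k -> starspace W false) nu (e : R) :
    star_eigsys W false f nu ->
    0 < e -> (forall i, nu i + e < 0) -> ((\sum_i `|nu i + e| `^ gamma)%:E <= X)%E.
  move=> fnu e0 nue.
  have [m [m1 leD]] := eigtrace_glue_ge p1 hp g0' fnu e0 nue.
  apply: le_trans leD _.
  pose Vr : starpot R n.+1 := StarPot (fun _ : 'I_n.+1 => starpotP (glue_pot p1 hp m1) ord0).
  have admr : admissible Vr.
    apply: admissible_const; first exact: (starpotP (glue_pot p1 hp m1) ord0).
    by apply: loc_integrable_glue => // a a0; exact: locV.
  have := dirichlet_trace_le (V := Vr) n0 _ admr g0' H.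
  rewrite -[profile Vr]/(glue_pot p1 hp m1) => /(_ _)/le_trans; apply => //.
  rewrite /X; apply: lee_wpmul2l; first by rewrite lee_fin.
  by apply: negint_glue_le => //; exact: mV.
apply: (@trace_neg_le_eigsys _ _ W) => k f nu fnu nu0.
have X0 : (0 <= X)%E.
  by apply: mule_ge0; [rewrite lee_fin|apply: adde_ge0; exact: negint_ge0].
move: X X0 sysX => [r||] // _ sysX; last by rewrite leey.
rewrite lee_fin; apply: le_sum_powR_shift => // e e0 nue.
by rewrite -lee_fin; exact: sysX fnu e0 nue.
Qed.

End Lieb_Thirring.

Theorem theorem2 (R : realType) (gamma : R) (hgamma : 2^-1 <= gamma)
    (N : nat) (hN : (2 <= N)%N) :
  LT_rad gamma N = LT_line gamma.
Proof.
have g0 : 0 < gamma by apply: lt_le_trans hgamma; rewrite invr_gt0.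
case: N hN => [//|n] n0; rewrite /LT_rad /LT_line /LT_constant.
congr (ereal_inf (EFin @` _)); apply/seteqP; split => L.
  exact: LT_bound_rad_line.
by apply: LT_bound_line_rad => //; exact: ltW.
Qed.
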